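(* Let $n\ge1$ and $R>0$. Suppose $u\in L^1_{loc}(\mathbb C^n\setminus\overline{B_R})$ is complex-valued and satisfies $$\bar\partial u=Vu\quad\text{on }\mathbb C^n\setminus\overline{B_R}$$ in the sense of distributions for some $(0,1)$-form $V\in L^\infty(\mathbb C^n\setminus\overline{B_R})$. If $$|u(z)|\le e^{-C|z|},\qquad |z|\gg1,$$ for some $C>2\|V\|_{L^\infty(\mathbb C^n\setminus\overline{B_R})}$, then $u$ vanishes identically.
   Context: $B_R$ is the open ball of radius $R$ centered at $0$ in $\mathbb C^n$. For a measurable $(0,1)$-form $V=\sum_{j=1}^n V_j\,d\bar z_j$, $|V|=(\sum_j|V_j|^2)^{1/2}$ pointwise and $\|V\|_{L^\infty}=\operatorname{ess\,sup}|V|$. The equation $\bar\partial u=Vu$ means $\partial u/\partial\bar z_j=V_ju$ for all $j=1,\dots,n$. ''$|z|\gg1$'' means for all $z$ with $|z|$ sufficiently large. Functions are identified with their continuous representatives whenever these exist, and pointwise statements refer to that representative. *)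

(* Defs.v *)
From HB Require Import structures.
From mathcomp Require Import all_boot all_order all_algebra.
From mathcomp Require Import all_classical all_reals all_analysis.
From mathcomp Require Import complex.

Set Implicit Arguments.
Unset Strict Implicit.
Unset Printing Implicit Defensive.

Import Order.TTheory GRing.Theory Num.Theory.
Import numFieldNormedType.Exports.

Local Open Scope classical_set_scope.
Local Open Scope ring_scope.
Local Open Scope complex_scope.

(* [R[i]^o] rather than [R[i]]: the former carries the norm topology of the
   numFieldType [R[i]]. *)
Definition Cn (R : realType) (n : nat) := 'rV[R[i]^o]_n.

HB.instance Definition _ (R : realType) (n : nat) :=
  NormedModule.copy (Cn R n) 'rV[R[i]^o]_n.

Section power_measure.
Context d (T : measurableType d) (R : realType).
Local Open Scope ereal_scope.

Section zero.

Let sfin : sigma_finite [set: 0.-tuple T]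
  (\d_ [tuple] : {measure set (0.-tuple T) -> \bar R}).
Proof.
exists (fun=> setT); first by rewrite bigcup_const//; exists 0%N.
move=> k; split; first exact: measurableT.
by rewrite /= diracT ltry.
Qed.

Definition power_measure0 := \d_ ([tuple] : 0.-tuple T) : set (0.-tuple T) -> \bar R.

HB.instance Definition _ := Measure.on power_measure0.
HB.instance Definition _ := Measure_isSigmaFinite.Build _ _ _ power_measure0 sfin.

End zero.

Definition tuple_cons n (p : T * n.-tuple T) : n.+1.-tuple T :=
  [tuple of p.1 :: p.2].

Lemma measurable_tuple_cons n : measurable_fun setT (@tuple_cons n).
Proof. exact: measurable_cons. Qed.

Section succ.
Variables (n : nat) (mu : {sigma_finite_measure set T -> \bar R})
  (nu : {sigma_finite_measure set (n.-tuple T) -> \bar R}).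

Definition power_measureS := pushforward (mu \x nu) (@tuple_cons n).

Let nuS0 : power_measureS set0 = 0.
Proof. by rewrite /power_measureS /pushforward preimage_set0 measure0. Qed.

Let nuS_ge0 A : 0 <= power_measureS A.
Proof. by rewrite /power_measureS /pushforward; exact: measure_ge0. Qed.

Let nuS_sigma_additive : semi_sigma_additive power_measureS.
Proof.
move=> F mF tF mUF; rewrite /power_measureS /pushforward preimage_bigcup.
have mpre A : measurable A -> measurable (@tuple_cons n @^-1` A).
  by move=> mA; rewrite -[X in measurable X]setTI; exact: measurable_tuple_cons.
apply: measure_semi_sigma_additive.
- by move=> k; exact: mpre.
- apply/trivIsetP => i j _ _ ij; rewrite -preimage_setI.
  by move/trivIsetP : tF => /(_ _ _ _ _ ij) ->//; rewrite preimage_set0.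
- by rewrite -preimage_bigcup; exact: mpre.
Qed.

HB.instance Definition _ := isMeasure.Build _ _ _ power_measureS
  nuS0 nuS_ge0 nuS_sigma_additive.

Let nuS_sigma_finite : sigma_finite setT power_measureS.
Proof.
have /sigma_finiteP[F [TF ndF Foo]] := sigma_finiteT mu.
have /sigma_finiteP[G [TG ndG Goo]] := sigma_finiteT nu.
pose g (t : n.+1.-tuple T) := (thead t, [tuple of behead t]).
have mg : measurable_fun setT g.
  apply/measurable_fun_pair; first exact: measurable_tnth.
  exact: measurable_behead.
exists (fun k => g @^-1` (F k `*` G k)).
  rewrite -preimage_bigcup (_ : \bigcup_k _ = setT) ?preimage_setT//.
  apply/seteqP; split => // -[x y] _.
  have [k _ Fkx] : (\bigcup_k F k) x by rewrite -TF.
  have [l _ Gly] : (\bigcup_k G k) y by rewrite -TG.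
  exists (maxn k l) => //; split => /=.
  - by move: x Fkx; exact/subsetPset/ndF/leq_maxl.
  - by move: y Gly; exact/subsetPset/ndG/leq_maxr.
move=> k; have [mF Fk] := Foo k; have [mG Gk] := Goo k; split.
  by rewrite -[X in measurable X]setTI; apply: mg => //; exact: measurableX.
rewrite /power_measureS /pushforward -comp_preimage.
rewrite (_ : g \o _ = id); last first.
  apply/funext => -[x t] /=.
  by rewrite /g /tuple_cons /= theadE; congr pair; exact/val_inj.
by rewrite preimage_id product_measure1E// lte_mul_pinfty// ge0_fin_numE.
Qed.

HB.instance Definition _ := Measure_isSigmaFinite.Build _ _ _ power_measureS
  nuS_sigma_finite.

End succ.

Fixpoint power_measure (mu : {sigma_finite_measure set T -> \bar R}) n :
    {sigma_finite_measure set (n.-tuple T) -> \bar R} :=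
  if n is m.+1 then power_measureS mu (power_measure mu m)
  else power_measure0.

End power_measure.

Section complex_space.
Variables (R : realType) (n : nat).

Definition of_coords
    (p : n.-tuple (measurableTypeR R) * n.-tuple (measurableTypeR R)) : Cn R n :=
  \row_j ((tnth p.1 j : R) +i* (tnth p.2 j : R)).

(* [of_coords] is a homeomorphism from R^2n, so this is the Borel
   sigma-algebra. *)
Definition Cn_measurable : set (set (Cn R n)) :=
  image_set_system setT of_coords measurable.

Let Cn_sigma_algebra : sigma_algebra setT Cn_measurable.
Proof. exact/sigma_algebra_image/sigma_algebra_measurable. Qed.

Let Cn_measurable0 : Cn_measurable set0.
Proof. by have [] := Cn_sigma_algebra. Qed.

Let Cn_measurableC A : Cn_measurable A -> Cn_measurable (~` A).
Proof. by have [_ + _] := Cn_sigma_algebra => /[apply]; rewrite setTD. Qed.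

Let Cn_measurableU (F : (set (Cn R n))^nat) :
  (forall k, Cn_measurable (F k)) -> Cn_measurable (\bigcup_k F k).
Proof. by have [_ _] := Cn_sigma_algebra; exact. Qed.

HB.instance Definition _ := @isMeasurable.Build default_measure_display
  (Cn R n) Cn_measurable Cn_measurable0 Cn_measurableC Cn_measurableU.

Lemma measurable_of_coords : measurable_fun setT of_coords.
Proof. by move=> _ A. Qed.

(* The 2n-dimensional Lebesgue measure. *)
Definition lebesgue_Cn : set (Cn R n) -> \bar R :=
  pushforward (power_measure lebesgue_measure n \x
               power_measure lebesgue_measure n)%E of_coords.

Let lebesgue_Cn0 : lebesgue_Cn set0 = 0%E.
Proof. by rewrite /lebesgue_Cn /pushforward preimage_set0 measure0. Qed.

Let lebesgue_Cn_ge0 A : (0 <= lebesgue_Cn A)%E.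
Proof. by rewrite /lebesgue_Cn /pushforward; exact: measure_ge0. Qed.

Let lebesgue_Cn_sigma_additive : semi_sigma_additive lebesgue_Cn.
Proof.
move=> F mF tF mUF; rewrite /lebesgue_Cn /pushforward preimage_bigcup.
have mpre A : measurable A -> measurable (of_coords @^-1` A).
  by move=> mA; rewrite -[X in measurable X]setTI; exact: measurable_of_coords.
apply: measure_semi_sigma_additive.
- by move=> k; exact: mpre.
- apply/trivIsetP => i j _ _ ij; rewrite -preimage_setI.
  by move/trivIsetP : tF => /(_ _ _ _ _ ij) ->//; rewrite preimage_set0.
- by rewrite -preimage_bigcup; exact: mpre.
Qed.

HB.instance Definition _ := isMeasure.Build _ _ _ lebesgue_Cn
  lebesgue_Cn0 lebesgue_Cn_ge0 lebesgue_Cn_sigma_additive.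

Definition l2norm (z : Cn R n) : R := Num.sqrt (\sum_j Normc.normc (z 0 j) ^+ 2).

Definition cmeasurable_fun (D : set (Cn R n)) (f : Cn R n -> R[i]^o) : Prop :=
  measurable_fun D (fun z => complex.Re (f z) : measurableTypeR R) /\
  measurable_fun D (fun z => complex.Im (f z) : measurableTypeR R).

Definition cintegral (D : set (Cn R n)) (f : Cn R n -> R[i]^o) : R[i]^o :=
  Rintegral lebesgue_Cn D (fun z => complex.Re (f z)) +i*
  Rintegral lebesgue_Cn D (fun z => complex.Im (f z)).

Definition L1loc (D : set (Cn R n)) (f : Cn R n -> R[i]^o) : Prop :=
  cmeasurable_fun D f /\
  forall K, compact K -> K `<=` D ->
    (\int[lebesgue_Cn]_(z in K) (Normc.normc (f z))%:E < +oo)%E.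

(* The convention identifying an a.e.-class with its continuous representative
   whenever that exists: if [f] agrees a.e. on [D] with a function continuous
   on [D], then it is equal to it on [D].  It is vacuous when the class of [f]
   has no continuous representative. *)
Definition preferred_representative (D : set (Cn R n)) (f : Cn R n -> R[i]^o) :=
  forall g : Cn R n -> R[i]^o, {within D, continuous g} ->
    {ae lebesgue_Cn, forall z, D z -> f z = g z} ->
  forall z, D z -> f z = g z.

(* The L^oo(D)-norm of a vector field (the coefficients of a (0,1)-form); the
   extension by zero makes the essential supremum run over [D] only. *)
Definition Linfty_norm (D : set (Cn R n)) (V : Cn R n -> Cn R n) : \bar R :=
  Lnorm lebesgue_Cn +oo%E ((fun z => (l2norm (V z))%:E) \_ D).

Definition Linfty (D : set (Cn R n)) (V : Cn R n -> Cn R n) : Prop :=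
  (forall j, cmeasurable_fun D (fun z => V z 0 j)) /\
  (Linfty_norm D V < +oo)%E.

(* Derivatives in real directions; [R[i]^o] is not a normed module over [R],
   hence the split into real and imaginary parts. *)
Definition line_re (f : Cn R n -> R[i]^o) (z v : Cn R n) (t : R) : R :=
  complex.Re (f (z + t%:C *: v)).
Definition line_im (f : Cn R n -> R[i]^o) (z v : Cn R n) (t : R) : R :=
  complex.Im (f (z + t%:C *: v)).

Definition rderivable (f : Cn R n -> R[i]^o) (v z : Cn R n) : Prop :=
  derivable (line_re f z v) 0 1 /\ derivable (line_im f z v) 0 1.

Definition rderive (v : Cn R n) (f : Cn R n -> R[i]^o) (z : Cn R n) : R[i]^o :=
  derive1 (line_re f z v) 0 +i* derive1 (line_im f z v) 0.

Definition dir_x (j : 'I_n) : Cn R n := delta_mx 0 j.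
Definition dir_y (j : 'I_n) : Cn R n := (0 +i* 1 : R[i]) *: delta_mx 0 j.

Definition dbar (j : 'I_n) (f : Cn R n -> R[i]^o) (z : Cn R n) : R[i]^o :=
  (rderive (dir_x j) f z + (0 +i* 1) * rderive (dir_y j) f z) / 2%:R.

Fixpoint Ck (k : nat) (f : Cn R n -> R[i]^o) : Prop :=
  continuous f /\
  if k is k'.+1 then
    forall j v, v = dir_x j \/ v = dir_y j ->
      (forall z, rderivable f v z) /\ Ck k' (rderive v f)
  else True.

Definition test_function (D : set (Cn R n)) (phi : Cn R n -> R[i]^o) : Prop :=
  [/\ forall k, Ck k phi,
      compact (closure [set z | phi z != 0]) &
      closure [set z | phi z != 0] `<=` D].

Definition weak_dbar_solution (D : set (Cn R n)) (V : Cn R n -> Cn R n)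
    (u : Cn R n -> R[i]^o) : Prop :=
  forall (j : 'I_n) (phi : Cn R n -> R[i]^o), test_function D phi ->
    cintegral D (fun z => u z * dbar j phi z) =
    - cintegral D (fun z => V z 0 j * u z * phi z).

Definition exterior (r : R) : set (Cn R n) := ~` [set z | l2norm z <= r].

End complex_space.

(* Main.v *)
(* Write M for the L^oo norm of V, and fix a point z0 of the exterior and a
   coordinate j with z0_j <> 0.  Everything is done in the variable z_j, the
   other variables being parameters.

   Gauge.  Approximate V_j by a smooth f with |f| <= M.  On |z_j| <= S the
   equation dbar_j w = f is solved by the Cauchy transform of f minus a
   polynomial in z_j (the truncated reflection of the kernel in the circle
   |z_j| = S), so that Re w = O(sqrt S) for |z_j| ~ S, whereas for bounded |z_j|
   Re w is, up to O(sqrt S), a function of the other variables of size at most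
   2 M S.  This uses that the Cauchy kernel of a disc of radius S has integral
   2 omega S while differences of translates only contribute O(sqrt S).

   Duality.  No regularity of u is needed if the weak equation is tested against
   e^{-w} chi z_j^k T s, with T the Cauchy transform, chi a cut-off to
   r1 < |z_j| < S - 1, s = sigma theta e^w conj(z_j)^k, theta a bump at z0
   supported in r3 < |z_j| < r4, and sigma a smooth approximation of the
   conjugate phase of u.  The errors made in approximating V_j and the phase
   can be sent to 0 because the bounds on w do not depend on f.  What remains is
     r3^{2k} int theta |u| <= A e^{O(sqrt S)} ((r2 r4)^k + e^{-(C - 2M) S} (S r4)^k)
   up to powers of S, the two terms coming from the inner and outer transition
   regions of chi.  As r2 r4 < r3^2, letting X tend to infinity with S = X^8 and
   k = X^5 gives int theta |u| = 0. *)

Require Import Defs.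
From HB Require Import structures.
From mathcomp Require Import all_boot all_order all_algebra.
From mathcomp Require Import all_classical all_reals all_analysis.
From mathcomp Require Import measurable_realfun ess_sup_inf complex.
From mathcomp Require Import ring lra.

Import Order.TTheory GRing.Theory Num.Theory.
Import numFieldNormedType.Exports.

Local Open Scope classical_set_scope.
Local Open Scope ring_scope.
Local Open Scope complex_scope.

Set Implicit Arguments.
Unset Strict Implicit.
Unset Printing Implicit Defensive.

(** * Smooth functions of a real variable *)

(** The constant 2 is sharp: in one variable e^{-C|z|} solves the equation with |V| = C/2.

    For fixed other variables e^{-w} u would be holomorphic in z_j, but the annulus r1 < |z_j| has
    an inner side on which u is merely integrable; the weight z_j^k is there to suppress that side.
    Its exponent must be large compared with sqrt S, for (r2 r4 / r3^2)^k to beat e^{O(sqrt S)},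
    while k log S must be small compared with S, for e^{-(C - 2M) S} to beat (S r4)^k.

    The near-independence of Re w from z_j for bounded |z_j| serves the inner term: there e^{-w(z)}
    meets an integral of e^w over the same slice, so the possibly large common value g cancels. Only
    the outer term pays for g, once, with e^{2MS}; the polynomial part of w ensures that e^{-w}
    costs no more than e^{O(sqrt S)} at the outer end.

    Derivatives are handled as expansions with a quadratic remainder, uniform on polydiscs: such
    expansions pass under Cauchy integrals without exchanging a limit and an integral. *)

Section real_smooth.
Variable R : realType.
Implicit Types (f g : R -> R) (x t s : R) (n : nat).

Lemma is_derive_quad f x l B d : 0 < d ->
  (forall t, `|t| < d -> `|f (x + t) - f x - t * l| <= B * t ^+ 2) ->
  is_derive x 1 f l.
Proof.
move=> d0 H.
have B0 : 0 <= B.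
  have := H (d / 2); rewrite gtr0_norm ?divr_gt0// ltr_pdivrMr//.
  have h : d < d * 2 by lra.
  move=> /(_ h) /(le_trans (normr_ge0 _)).
  by rewrite pmulr_lge0// exprn_gt0// divr_gt0.
suff cv : h^-1 *: (f (h *: 1 + x) - f x) @[h --> 0^'] --> l.
  by split; [apply/cvg_ex; exists l|exact/cvg_lim].
apply/cvgrPdist_le => e e0 /=; near=> h.
have h0 : h != 0 by near: h; exact: nbhs_dnbhs_neq.
have hd : `|h| < d.
  by near: h; exact: dnbhs0_lt.
have he : `|h| <= e / (B + 1).
  by near: h; apply: dnbhs0_le; rewrite divr_gt0// ltr_wpDl.
have -> : l - h^-1 *: (f (h *: 1 + x) - f x) =
    - (h^-1 * (f (x + h) - f x - h * l)).
  rewrite -[h *: 1]/(h * 1) mulr1 [h + x]addrC.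
  by rewrite -[h^-1 *: _]/(h^-1 * _) [in RHS]mulrBr mulKf// opprB.
rewrite normrN normrM normfV mulrC ler_pdivrMr ?normr_gt0//.
apply: (le_trans (H _ hd)).
rewrite -normr_id -(real_normK (num_real h)) expr2 mulrA normr_id ler_wpM2r//.
apply: (le_trans (ler_wpM2l B0 he)).
rewrite mulrA ler_pdivrMr; last by rewrite ltr_wpDl.
by rewrite mulrDr mulr1 mulrC lerDl ltW.
Unshelve. all: by end_near. Qed.

(** The mean value theorem is applied to [f] and then to [f1]. *)
Lemma taylor1_bound f f1 f2 a b M :
  (forall x, is_derive x 1 f (f1 x)) -> (forall x, is_derive x 1 f1 (f2 x)) ->
  (forall x, a <= x <= b -> `|f2 x| <= M) ->
  forall x y, a <= x <= b -> a <= y <= b ->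
  `|f y - f x - (y - x) * f1 x| <= M * (y - x) ^+ 2.
Proof.
move=> d1 d2 HM x y xab yab.
have cont (h h' : R -> R) : (forall x, is_derive x 1 h (h' x)) -> forall p q,
    exists2 c, (p <= c <= q) || (q <= c <= p) & h q - h p = h' c * (q - p).
  move=> hh' p q.
  have ch r s : {within `[r, s], continuous h}.
    apply/continuous_subspaceT => z; apply/differentiable_continuous.
    by apply/derivable1_diffP; case: (hh' z).
  have [pq|qp] := leP p q.
    have [c cpq Hc] := MVT_segment pq (fun z _ => hh' z) (ch _ _).
    by exists c => //; move: cpq; rewrite in_itv/= => ->.
  have [c cpq Hc] := MVT_segment (ltW qp) (fun z _ => hh' z) (ch _ _).
  exists c; first by move: cpq; rewrite in_itv/= => ->; rewrite orbT.
  by rewrite -[LHS]opprB Hc -mulrN opprB.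
have [c cxy ->] := cont _ _ d1 x y.
have [e exc Hec] := cont _ _ d2 x c.
rewrite [(y - x) * _]mulrC -mulrBl Hec !normrM.
have h1 : `|f2 e| <= M by apply: HM; move: xab yab cxy exc; do ?case/orP; lra.
have h2 : `|c - x| <= `|y - x|.
  move: cxy => /orP[] H; [rewrite !ger0_norm|rewrite !ler0_norm]; lra.
rewrite -(real_normK (num_real (y - x))) expr2 mulrA.
rewrite ler_wpM2r// ler_pM//.
Qed.

(* [flat 0] is the C^oo function exp(-1/x) vanishing for x <= 0; the factors
   x^-n appear in its derivatives. *)
Definition flat n x : R := if 0 < x then x ^- n * expR (- x^-1) else 0.

Lemma flat_ge0 n x : 0 <= flat n x.
Proof.
rewrite /flat; case: ifPn => // x0.
by rewrite mulr_ge0 ?expR_ge0// invr_ge0 exprn_ge0// ltW.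
Qed.

(** [expR (x^-1)] dominates the term of degree [n.+2] of its series. The bound is quadratic because
    that is what [is_derive_quad] asks for at 0. *)
Lemma flat_le n x : 0 < x -> flat n x <= (n.+2)`!%:R * x ^+ 2.
Proof.
move=> x0; rewrite /flat x0 expRN.
have H : (x^-1) ^+ n.+2 / (n.+2)`!%:R <= expR x^-1.
  apply: le_trans (expR_ge1Dxn n.+1 _); first by rewrite lerDr.
  by rewrite invr_ge0 ltW.
have f0 : 0 < (n.+2)`!%:R :> R by rewrite ltr0n fact_gt0.
rewrite ler_pdivrMr ?expR_gt0//.
apply: le_trans (ler_wpM2l _ H); last by rewrite mulr_ge0// ?sqr_ge0// ltW.
have -> : n.+2`!%:R * x ^+ 2 * (x^-1 ^+ n.+2 / n.+2`!%:R) = x ^+ 2 * x^-1 ^+ n.+2.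
  by field; rewrite gt_eqF.
by rewrite -[n.+2]addn2 exprD mulrCA -exprMn divff ?gt_eqF// expr1n mulr1 exprVn.
Qed.

(** The family is closed under differentiation: one term comes from the power of [x], the other from
    the exponent. At 0 the derivative is 0 by the quadratic bound [flat_le]. *)
Lemma is_derive_flat n x :
  is_derive x 1 (flat n) (- n%:R * flat n.+1 x + flat n.+2 x).
Proof.
have [x0|x0|->] := ltgtP x 0.
- rewrite /flat ltNge (ltW x0)/= mulr0 addr0.
  apply: (@near_eq_is_derive _ _ _ (cst 0)).
  near=> y; rewrite ltNge ltW//; near: y; exact: lt_nbhsl.
- apply: (@near_eq_is_derive _ _ _ (fun y : R => (y^-1) ^+ n * expR (- y^-1))).
    near=> y; have y0 : 0 < y by near: y; exact: lt_nbhsr.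
    by rewrite /flat y0 exprVn.
  have xn0 : (x : R) != 0 by rewrite gt_eqF.
  have dV : is_derive x 1 (fun y : R => y^-1) (- x ^- 2).
    apply: is_derive_eq (@is_deriveV _ id _ _ _ xn0 (is_derive_id _ _)) _.
    exact: mulr1.
  have dE : is_derive x 1 (fun y : R => expR (- y^-1)) (expR (- x^-1) * x ^- 2).
    have := @is_derive1_comp _ expR (fun y => - y^-1) x (expR (- x^-1)) (x ^- 2).
    apply.
    by apply: is_derive_eq (is_deriveN dV) _; rewrite opprK.
  have dX : is_derive x 1 (fun y : R => (y^-1) ^+ n) (n%:R * x^-1 ^+ n.-1 * - x ^- 2).
    have := @is_derive1_comp _ (fun y => y ^+ n) (fun y => y^-1) x (n%:R * x^-1 ^+ n.-1) (- x ^- 2).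
    apply => //.
    have -> : (fun y : R => y ^+ n) = id ^+ n by apply/funext => y; rewrite exprfctE.
    apply: is_derive_eq (is_deriveX n (is_derive_id (x^-1 : R^o) 1)) _.
    exact: mulr1.
  apply: is_derive_eq (is_deriveM dX dE) _.
  rewrite /flat x0 -[_ *: _]/(_ * _) -[X in _ + X = _]/(_ * _).
  case: n {dX} => [|m]; rewrite ?mul0r ?oppr0 ?mul0r ?mulr0 ?addr0 ?add0r.
    by rewrite expr0 mul1r [LHS]mulrC.
  rewrite -!exprVn mulNr mulrN; move: (x^-1) (expR _) => y E.
  by rewrite /= !exprS; ring.
- have fl0 k : flat k 0 = 0 by rewrite /flat ltxx.
  rewrite !fl0 mulr0 addr0.
  apply: (@is_derive_quad _ _ _ (n.+2)`!%:R 1) => // t _.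
  rewrite add0r mulr0 fl0 !subr0.
  rewrite ger0_norm ?flat_ge0//.
  have [t0|t0] := ltP 0 t; first exact: flat_le.
  by rewrite /flat ltNge t0 mulr_ge0// sqr_ge0.
Unshelve. all: by end_near. Qed.

(** A syntactic class in which every member has a derivative that is again a member, so that
    smoothness of all orders needs no iterated derivatives. Inverse and square root ask for
    positivity on the whole line, which [clamp] provides. *)
Inductive smoothR : (R -> R) -> Prop :=
| smoothR_cst c : smoothR (fun=> c)
| smoothR_id : smoothR id
| smoothR_flat n : smoothR (flat n)
| smoothR_exp : smoothR expR
| smoothR_sin : smoothR sin
| smoothR_cos : smoothR cos
| smoothR_add f g : smoothR f -> smoothR g -> smoothR (fun x => f x + g x)
| smoothR_mul f g : smoothR f -> smoothR g -> smoothR (fun x => f x * g x)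
| smoothR_comp f g : smoothR f -> smoothR g -> smoothR (fun x => f (g x))
| smoothR_inv f : smoothR f -> (forall x, 0 < f x) -> smoothR (fun x => (f x)^-1)
| smoothR_sqrt f : smoothR f -> (forall x, 0 < f x) ->
    smoothR (fun x => Num.sqrt (f x)).

Lemma smoothR_derive f : smoothR f ->
  exists2 f', smoothR f' & forall x, is_derive x 1 f (f' x).
Proof.
elim=> {f}.
- by move=> c; exists (fun=> 0); [exact: smoothR_cst|move=> x; exact: is_derive_cst].
- by exists (fun=> 1); [exact: smoothR_cst|move=> x; exact: is_derive_id].
- move=> n; exists (fun x => - n%:R * flat n.+1 x + flat n.+2 x); last exact: is_derive_flat.
  by apply: smoothR_add; [apply: smoothR_mul; [exact: smoothR_cst|]|];
    exact: smoothR_flat.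
- by exists expR; [exact: smoothR_exp|move=> x; exact: is_derive_expR].
- by exists cos; [exact: smoothR_cos|move=> x; exact: is_derive_sin].
- exists (fun x => -1 * sin x).
    by apply: smoothR_mul; [exact: smoothR_cst|exact: smoothR_sin].
  by move=> x; apply: is_derive_eq (is_derive_cos x) _; rewrite mulN1r.
- move=> f g _ [f' sf' df] _ [g' sg' dg]; exists (fun x => f' x + g' x).
    exact: smoothR_add.
  by move=> x; exact: is_deriveD.
- move=> f g sf [f' sf' df] sg [g' sg' dg].
  exists (fun x => f x * g' x + g x * f' x).
    by apply: smoothR_add; exact: smoothR_mul.
  by move=> x; exact: is_deriveM.
- move=> f g sf [f' sf' df] sg [g' sg' dg].
  exists (fun x => f' (g x) * g' x).
    by apply: smoothR_mul => //; exact: smoothR_comp.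
  by move=> x; exact: (@is_derive1_comp _ f g).
- move=> f sf [f' sf' df] f0.
  exists (fun x => (- 1) * ((f x)^-1 * ((f x)^-1 * f' x))).
    apply: smoothR_mul; first exact: smoothR_cst.
    by apply: smoothR_mul; [|apply: smoothR_mul => //]; exact: smoothR_inv.
  move=> x; apply: is_derive_eq (@is_deriveV _ f _ _ _ _ (df x)) _.
    by rewrite gt_eqF.
  by rewrite -[_ *: _]/(_ * _) expr2 invfM; ring.
- move=> f sf [f' sf' df] f0.
  have f0' x : 0 < Num.sqrt (f x) by rewrite sqrtr_gt0.
  exists (fun x => (2^-1 * (Num.sqrt (f x))^-1) * f' x).
    apply: smoothR_mul => //; apply: smoothR_mul; first exact: smoothR_cst.
    by apply: smoothR_inv => //; exact: smoothR_sqrt.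
  move=> x; apply: (@is_derive1_comp _ Num.sqrt f).
  by apply: is_derive_eq (is_derive1_sqrt (f0 x)) _; rewrite invfM.
Qed.

Lemma smoothR_continuous f : smoothR f -> continuous f.
Proof.
move=> /smoothR_derive[f' _ df] x; apply/differentiable_continuous.
by apply/derivable1_diffP; case: (df x).
Qed.

Lemma smoothR_bounded f a b : smoothR f ->
  exists2 M, 0 <= M & forall x, a <= x <= b -> `|f x| <= M.
Proof.
move=> sf; have [ab|ba] := leP a b; last first.
  by exists 0 => // x /andP[ax xb]; move: ba; rewrite ltNge (le_trans ax xb).
have cf : {within `[a, b], continuous (fun x => `|f x|)}.
  apply/continuous_subspaceT => x; apply: (@continuous_comp _ _ _ f Num.norm).
    exact: smoothR_continuous.
  exact: norm_continuous.
have [c _ Hc] := EVT_max ab cf; exists `|f c| => // x xab; exact: Hc.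
Qed.

Lemma smoothR_quad f f' r : smoothR f -> smoothR f' ->
  (forall x, is_derive x 1 f (f' x)) ->
  exists2 M, 0 <= M & forall x y, `|x| <= r -> `|y| <= r ->
  `|f y - f x - (y - x) * f' x| <= M * (y - x) ^+ 2.
Proof.
move=> sf sf' df; have [f'' sf'' df'] := smoothR_derive sf'.
have [M M0 HM] := smoothR_bounded (- r) r sf''.
exists M => // x y xr yr.
by apply: (taylor1_bound df df' HM); rewrite -ler_norml.
Qed.

End real_smooth.

Section smooth_step.
Variable R : realType.
Implicit Types (s a : R).

Local Notation fl := (@flat R).

Lemma flat_gt0 n s : 0 < s -> 0 < fl n s.
Proof.
by move=> s0; rewrite /flat s0 mulr_gt0 ?expR_gt0// invr_gt0 exprn_gt0.
Qed.

Lemma flat_le0 n s : s <= 0 -> fl n s = 0.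
Proof. by move=> s0; rewrite /flat ltNge s0. Qed.

Let den s := fl 0 s + fl 0 (1 - s).

Let den_gt0 s : 0 < den s.
Proof.
have [s0|s0] := ltP 0 s; first by rewrite ltr_pwDl ?flat_gt0 ?flat_ge0.
by rewrite ltr_wpDl ?flat_ge0// flat_gt0// subr_gt0 (le_lt_trans s0).
Qed.

(** The classical smooth transition from 0 on the negative half-line to 1 beyond 1. *)
Definition step s : R := fl 0 s * (fl 0 s + fl 0 (1 - s))^-1.

(** The derivative of [step], with the quotient rule simplified until its sign and its vanishing
    outside (0, 1) can be read off. *)
Definition dstep s : R :=
  (fl 2 s * fl 0 (1 - s) + fl 0 s * fl 2 (1 - s)) *
  ((fl 0 s + fl 0 (1 - s))^-1 * (fl 0 s + fl 0 (1 - s))^-1).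

Let smooth_1B f : smoothR f -> smoothR (fun s : R => f (1 - s)).
Proof.
move=> sf; apply: (smoothR_comp sf (g := fun s : R => 1 - s)).
have -> : (fun s : R => 1 - s) = (fun s => 1 + (-1) * s).
  by apply/funext => s; rewrite mulN1r.
apply: smoothR_add; first exact: smoothR_cst.
by apply: smoothR_mul; [exact: smoothR_cst|exact: smoothR_id].
Qed.

Let smooth_den : smoothR den.
Proof.
by apply: smoothR_add; [|apply: smooth_1B]; exact: smoothR_flat.
Qed.

Lemma smoothR_step : smoothR step.
Proof.
apply: smoothR_mul; first exact: smoothR_flat.
exact: (smoothR_inv smooth_den).
Qed.

Lemma smoothR_dstep : smoothR dstep.
Proof.
by apply: smoothR_mul; [apply: smoothR_add|]; apply: smoothR_mul;
  do ?[exact: smoothR_flat|apply: smooth_1B|exact: (smoothR_inv smooth_den)].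
Qed.

Lemma is_derive_step s : is_derive s 1 step (dstep s).
Proof.
have d0 (u : R) : is_derive u 1 (fl 0) (fl 2 u).
  by apply: is_derive_eq (is_derive_flat 0 u) _; rewrite oppr0 mul0r add0r.
have dB : is_derive s 1 (fun s : R => 1 - s) (-1).
  by apply: is_derive_eq (is_deriveB (is_derive_cst (1 : R^o) (s : R^o) 1) (is_derive_id (s : R^o) 1)) _; rewrite sub0r.
have d1 : is_derive s 1 (fun s => fl 0 (1 - s)) (fl 2 (1 - s) * -1).
  by apply: (@is_derive1_comp _ (fl 0) (fun s => 1 - s)).
have dd : is_derive s 1 den (fl 2 s + fl 2 (1 - s) * -1) by exact: is_deriveD.
have dn : den s != 0 by rewrite gt_eqF.
apply: is_derive_eq (is_deriveM (d0 s) (@is_deriveV _ den _ _ _ dn dd)) _.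
rewrite /dstep -/(den s) -[_ *: (_ *: _)]/(_ * (_ * _)) -[_ *: _]/(_ * _).
have -> : fl 0 (1 - s) = den s - fl 0 s by rewrite /den addrAC subrr add0r.
by field.
Qed.

Lemma step_le0 s : s <= 0 -> step s = 0.
Proof. by move=> s0; rewrite /step flat_le0// mul0r. Qed.

Lemma step_ge1 s : 1 <= s -> step s = 1.
Proof.
move=> s1; rewrite /step [fl 0 (1 - s)]flat_le0 ?subr_le0// addr0 divff//.
by rewrite gt_eqF// flat_gt0// (lt_le_trans _ s1).
Qed.

Lemma step_ge0 s : 0 <= step s.
Proof. by rewrite mulr_ge0 ?flat_ge0// invr_ge0 ltW// den_gt0. Qed.

Lemma step_le1 s : step s <= 1.
Proof. by rewrite ler_pdivrMr ?den_gt0// mul1r lerDl flat_ge0. Qed.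

Lemma dstep_ge0 s : 0 <= dstep s.
Proof.
by rewrite mulr_ge0// ?addr_ge0 ?mulr_ge0 ?flat_ge0// invr_ge0 ltW// den_gt0.
Qed.

Lemma dstep_out s : (s <= 0) || (1 <= s) -> dstep s = 0.
Proof.
move=> /orP[s0|s1]; rewrite /dstep.
  by rewrite !(flat_le0 _ s0) !mul0r addr0 mul0r.
have s1' : 1 - s <= 0 by rewrite subr_le0.
by rewrite !(flat_le0 _ s1') !mulr0 addr0 mul0r.
Qed.

(** For [0 < a] this is positive everywhere, equal to [s] for [a <= s] and to 1 for [s <= a / 2]. It
    replaces [s] under inverses and square roots wherever the other factor vanishes for [s <= a]. *)
Definition clamp a s : R :=
  s * step (2 / a * s - 1) + (1 - step (2 / a * s - 1)).

Lemma smoothR_clamp a : smoothR (clamp a).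
Proof.
have sG : smoothR (fun s => step (2 / a * s - 1)).
  apply: (smoothR_comp smoothR_step (g := fun s => 2 / a * s - 1)).
  apply: smoothR_add; last exact: smoothR_cst.
  by apply: smoothR_mul; [exact: smoothR_cst|exact: smoothR_id].
apply: smoothR_add; first by apply: smoothR_mul; [exact: smoothR_id|].
have -> : (fun s => 1 - step (2 / a * s - 1)) =
    (fun s => 1 + (-1) * step (2 / a * s - 1)).
  by apply/funext => s; rewrite mulN1r.
apply: smoothR_add; first exact: smoothR_cst.
by apply: smoothR_mul => //; exact: smoothR_cst.
Qed.

Lemma clamp_gt0 a s : 0 < a -> 0 < clamp a s.
Proof.
move=> a0; rewrite /clamp; set x := _ - 1.
have [x0|x0] := leP x 0; first by rewrite step_le0// mulr0 add0r subr0.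
have s0 : 0 < s.
  move: x0; rewrite /x subr_gt0 mulrAC ltr_pdivlMr// mul1r => h.
  by have := lt_trans a0 h; rewrite pmulr_rgt0.
have := step_ge0 x; have := step_le1 x; move: (step x) => g g1 g0.
have [->|gn] := eqVneq g 0; first by rewrite mulr0 add0r subr0.
by rewrite ltr_pwDl ?subr_ge0// mulr_gt0// lt_neqAle eq_sym gn.
Qed.

Lemma clamp_id a s : 0 < a -> a <= s -> clamp a s = s.
Proof.
move=> a0 ls; rewrite /clamp step_ge1 ?mulr1 ?subrr ?addr0//.
rewrite lerBrDr mulrAC ler_pdivlMr//; lra.
Qed.

End smooth_step.

(** * Complex-valued integrals on C^n *)

Notation nc := Normc.normc.

Section modulus.
Variable R : rcfType.
Implicit Types (x y z : R[i]) (a b : R).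

Lemma creD x y : complex.Re (x + y) = complex.Re x + complex.Re y.
Proof. by case: x; case: y. Qed.
Lemma cimD x y : complex.Im (x + y) = complex.Im x + complex.Im y.
Proof. by case: x; case: y. Qed.
Lemma creN x : complex.Re (- x) = - complex.Re x.
Proof. by case: x. Qed.
Lemma cimN x : complex.Im (- x) = - complex.Im x.
Proof. by case: x. Qed.
Lemma creM x y : complex.Re (x * y) =
  complex.Re x * complex.Re y - complex.Im x * complex.Im y.
Proof. by case: x; case: y. Qed.
Lemma cimM x y : complex.Im (x * y) =
  complex.Re x * complex.Im y + complex.Im x * complex.Re y.
Proof. by case: x; case: y. Qed.
Lemma cre_conj x : complex.Re x^*%C = complex.Re x.
Proof. by case: x. Qed.
Lemma cim_conj x : complex.Im x^*%C = - complex.Im x.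
Proof. by case: x. Qed.
Lemma complex_ext x y : complex.Re x = complex.Re y ->
  complex.Im x = complex.Im y -> x = y.
Proof. by case: x; case: y => a b c d /= -> ->. Qed.

Lemma ncE x : nc x = Num.sqrt (complex.Re x ^+ 2 + complex.Im x ^+ 2).
Proof. by case: x. Qed.

Lemma nc_sqr x : nc x ^+ 2 = complex.Re x ^+ 2 + complex.Im x ^+ 2.
Proof. by rewrite ncE sqr_sqrtr// addr_ge0// sqr_ge0. Qed.

Lemma nc_ge0 x : 0 <= nc x.
Proof. by rewrite ncE sqrtr_ge0. Qed.

Lemma nc_norm x : (nc x)%:C = `|x|.
Proof. by rewrite ncE -normc_def. Qed.

Lemma nc0 : nc (0 : R[i]) = 0. Proof. exact: Normc.normc0. Qed.
Lemma nc1 : nc (1 : R[i]) = 1. Proof. exact: Normc.normc1. Qed.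
Lemma ncM x y : nc (x * y) = nc x * nc y. Proof. exact: Normc.normcM. Qed.
Lemma ncV x : nc x^-1 = (nc x)^-1. Proof. exact: Normc.normcV. Qed.
Lemma ncN x : nc (- x) = nc x. Proof. exact: normcN. Qed.
Lemma ncD x y : nc (x + y) <= nc x + nc y. Proof. exact: le_normcD. Qed.
Lemma ncB x y : nc (x - y) <= nc x + nc y.
Proof. by rewrite -(ncN y) ncD. Qed.
Lemma ncBC x y : nc (x - y) = nc (y - x).
Proof. by rewrite -ncN opprB. Qed.
Lemma ncX x n : nc (x ^+ n) = nc x ^+ n.
Proof. by elim: n => [|n IH]; rewrite ?expr0 ?nc1// !exprS ncM IH. Qed.
Lemma nc_real a : nc a%:C = `|a|.
Proof. by rewrite ncE/= expr0n/= addr0 sqrtr_sqr. Qed.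
Lemma nc_conj x : nc x^*%C = nc x.
Proof. by case: x => a b; rewrite !ncE/= sqrrN. Qed.
Lemma nc_i : nc ('i : R[i]) = 1.
Proof. by rewrite ncE/= expr0n expr1n add0r sqrtr1. Qed.
Lemma nc_eq0 x : (nc x == 0) = (x == 0).
Proof.
by apply/eqP/eqP => [|->]; [exact: Normc.eq0_normc|exact: nc0].
Qed.
Lemma nc_gt0 x : (0 < nc x) = (x != 0).
Proof. by rewrite lt_neqAle nc_ge0 andbT eq_sym nc_eq0. Qed.

Lemma nc_ge_Re x : `|complex.Re x| <= nc x.
Proof.
rewrite ncE -sqrtr_sqr ler_sqrt ?addr_ge0 ?sqr_ge0//.
by rewrite lerDl sqr_ge0.
Qed.

Lemma nc_ge_Im x : `|complex.Im x| <= nc x.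
Proof.
rewrite ncE -sqrtr_sqr ler_sqrt ?addr_ge0 ?sqr_ge0//.
by rewrite lerDr sqr_ge0.
Qed.

Lemma nc_le_ReIm x : nc x <= `|complex.Re x| + `|complex.Im x|.
Proof.
rewrite [x in nc x]complexE (le_trans (ncD _ _))// ncM nc_i mul1r.
by rewrite !nc_real.
Qed.

Lemma nc_dist x y : `|nc x - nc y| <= nc (x - y).
Proof.
rewrite ler_norml; apply/andP; split.
  by rewrite lerNl opprB lerBlDr ncBC; apply: le_trans (ncD _ _); rewrite subrK.
by rewrite lerBlDr; apply: le_trans (ncD _ _); rewrite subrK.
Qed.

Lemma conjM x y : (x * y)^*%C = x^*%C * y^*%C.
Proof. exact: (rmorphM (@conjc R)). Qed.

Lemma conj_nc x : x * x^*%C = (nc x ^+ 2)%:C.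
Proof.
by rewrite nc_sqr; case: x => a b; apply: complex_ext => /=; ring.
Qed.

End modulus.

Section complex_integral.
Context d (T : measurableType d) (R : realType).
Variable mu : {measure set T -> \bar R}.
Implicit Types (f g : T -> R[i]) (h : T -> R) (c : R[i]).

Definition cmeas f :=
  measurable_fun setT (fun x => complex.Re (f x)) /\
  measurable_fun setT (fun x => complex.Im (f x)).

Definition rintegrable h := mu.-integrable setT (fun x => (h x)%:E).

Definition cintegrable f :=
  rintegrable (fun x => complex.Re (f x)) /\
  rintegrable (fun x => complex.Im (f x)).

Definition cint f : R[i] :=
  (Rintegral mu setT (fun x => complex.Re (f x))) +i*
  (Rintegral mu setT (fun x => complex.Im (f x))).

Lemma cmeas_cst c : cmeas (fun=> c).
Proof. by split; exact: measurable_cst. Qed.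

Lemma cmeas_real h : measurable_fun setT h -> cmeas (fun x => (h x)%:C).
Proof. by move=> mh; split => //=; exact: measurable_cst. Qed.

Lemma cmeasD f g : cmeas f -> cmeas g -> cmeas (fun x => f x + g x).
Proof.
move=> [f1 f2] [g1 g2]; split.
  under eq_fun do rewrite creD; exact: measurable_funD.
under eq_fun do rewrite cimD; exact: measurable_funD.
Qed.

Lemma cmeasM f g : cmeas f -> cmeas g -> cmeas (fun x => f x * g x).
Proof.
move=> [f1 f2] [g1 g2]; split.
  under eq_fun do rewrite creM.
  by apply: measurable_funB; exact: measurable_funM.
under eq_fun do rewrite cimM.
by apply: measurable_funD; exact: measurable_funM.
Qed.

Lemma cmeasN f : cmeas f -> cmeas (fun x => - f x).
Proof.
move=> mf; under [X in cmeas X]eq_fun do rewrite -mulN1r.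
by apply: cmeasM => //; exact: cmeas_cst.
Qed.

Lemma cmeasB f g : cmeas f -> cmeas g -> cmeas (fun x => f x - g x).
Proof. by move=> mf mg; apply: cmeasD => //; exact: cmeasN. Qed.

Lemma cmeas_conj f : cmeas f -> cmeas (fun x => (f x)^*%C).
Proof.
move=> [f1 f2]; split.
  by under eq_fun do rewrite cre_conj.
by under eq_fun do rewrite cim_conj; exact: measurable_funN.
Qed.

Lemma measurable_nc f : cmeas f -> measurable_fun setT (fun x => nc (f x)).
Proof.
move=> [f1 f2]; under eq_fun do rewrite ncE.
apply: measurableT_comp.
  by apply: continuous_measurable_fun; exact: sqrt_continuous.
by apply: measurable_funD; exact: measurable_funX.
Qed.

Lemma rintegrable_le h (h' : T -> R) : measurable_fun setT h -> rintegrable h' ->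
  (forall x, `|h x| <= h' x) -> rintegrable h.
Proof.
move=> mh ih' hh'; apply: le_integrable ih' => //; first exact/measurable_EFinP.
by move=> x _ /=; rewrite lee_fin (le_trans (hh' x))// ler_norm.
Qed.

Lemma cintegrable_meas f : cintegrable f -> cmeas f.
Proof. by move=> [/measurable_int/measurable_EFinP ? /measurable_int/measurable_EFinP]. Qed.

Lemma cintegrable_le f h : cmeas f -> rintegrable h ->
  (forall x, nc (f x) <= h x) -> cintegrable f.
Proof.
move=> [f1 f2] ih fh; split.
  by apply: (rintegrable_le f1 ih) => x; exact: le_trans (nc_ge_Re _) (fh x).
by apply: (rintegrable_le f2 ih) => x; exact: le_trans (nc_ge_Im _) (fh x).
Qed.

Lemma rintegrableD h1 h2 : rintegrable h1 -> rintegrable h2 ->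
  rintegrable (fun x => h1 x + h2 x).
Proof. by move=> i1 i2; have := integrableD measurableT i1 i2. Qed.

Lemma rintegrableZ a h : rintegrable h -> rintegrable (fun x => a * h x).
Proof. by move=> i1; have := integrableZl measurableT a i1. Qed.

Lemma rintegrable_norm h : rintegrable h -> rintegrable (fun x => `|h x|).
Proof. by move=> i1; have := integrable_norm i1. Qed.

Lemma rintegrable_nc f : cintegrable f -> rintegrable (fun x => nc (f x)).
Proof.
move=> If; have [i1 i2] := If.
apply: (rintegrable_le (measurable_nc (cintegrable_meas If))
  (rintegrableD (rintegrable_norm i1) (rintegrable_norm i2))) => x.
by rewrite ger0_norm ?nc_ge0// nc_le_ReIm.
Qed.

Lemma cintegrable_nc f : cmeas f -> rintegrable (fun x => nc (f x)) -> cintegrable f.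
Proof. by move=> mf i; exact: (cintegrable_le mf i). Qed.

Lemma cintegrableD f g : cintegrable f -> cintegrable g ->
  cintegrable (fun x => f x + g x).
Proof.
move=> If Ig; apply: cintegrable_le (rintegrableD (rintegrable_nc If) (rintegrable_nc Ig)) _.
  by apply: cmeasD; exact: cintegrable_meas.
by move=> x; exact: ncD.
Qed.

Lemma cintegrableZ c f : cintegrable f -> cintegrable (fun x => c * f x).
Proof.
move=> If; apply: cintegrable_le (rintegrableZ (nc c) (rintegrable_nc If)) _.
  by apply: cmeasM; [exact: cmeas_cst|exact: cintegrable_meas].
by move=> x; rewrite ncM.
Qed.

Lemma cintegrable_bM b M f : cmeas b -> (forall x, nc (b x) <= M) -> cintegrable f ->
  cintegrable (fun x => b x * f x).
Proof.
move=> mb bM If; apply: cintegrable_le (rintegrableZ M (rintegrable_nc If)) _.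
  by apply: cmeasM => //; exact: cintegrable_meas.
by move=> x; rewrite ncM ler_wpM2r ?nc_ge0.
Qed.

Lemma cintegrableN f : cintegrable f -> cintegrable (fun x => - f x).
Proof.
move=> If; under [X in cintegrable X]eq_fun do rewrite -mulN1r.
exact: cintegrableZ.
Qed.

Lemma cintegrableB f g : cintegrable f -> cintegrable g ->
  cintegrable (fun x => f x - g x).
Proof. by move=> If Ig; apply: cintegrableD => //; exact: cintegrableN. Qed.

Lemma cintegrable_real h : rintegrable h -> cintegrable (fun x => (h x)%:C).
Proof.
move=> ih; split => //=; exact: integrable0.
Qed.

Lemma cintD f g : cintegrable f -> cintegrable g ->
  cint (fun x => f x + g x) = cint f + cint g.
Proof.
move=> [f1 f2] [g1 g2]; rewrite /cint; apply: complex_ext => /=.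
  under eq_Rintegral do rewrite creD; exact: RintegralD.
under eq_Rintegral do rewrite cimD; exact: RintegralD.
Qed.

Lemma cintZ c f : cintegrable f -> cint (fun x => c * f x) = c * cint f.
Proof.
move=> [f1 f2]; rewrite /cint; apply: complex_ext; rewrite ?creM ?cimM/=.
  under eq_Rintegral do rewrite creM.
  by rewrite RintegralB// ?RintegralZl//; exact: rintegrableZ.
under eq_Rintegral do rewrite cimM.
by rewrite RintegralD// ?RintegralZl//; exact: rintegrableZ.
Qed.

Lemma cintN f : cintegrable f -> cint (fun x => - f x) = - cint f.
Proof.
by move=> If; rewrite -mulN1r -cintZ//; congr cint; apply/funext => x; rewrite mulN1r.
Qed.

Lemma cintB f g : cintegrable f -> cintegrable g ->
  cint (fun x => f x - g x) = cint f - cint g.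
Proof. by move=> If Ig; rewrite cintD ?cintN//; exact: cintegrableN. Qed.

Lemma cint_real h : cint (fun x => (h x)%:C) = (Rintegral mu setT h)%:C.
Proof. by rewrite /cint/= [X in _ +i* X]/Rintegral integral0. Qed.

Lemma Rintegral_le h (h' : T -> R) : rintegrable h -> rintegrable h' ->
  (forall x, h x <= h' x) -> Rintegral mu setT h <= Rintegral mu setT h'.
Proof. by move=> i1 i2 hh'; exact: le_Rintegral. Qed.

Lemma nc_cint f : cintegrable f -> nc (cint f) <= Rintegral mu setT (fun x => nc (f x)).
Proof.
move=> If; have [->|n0] := eqVneq (cint f) 0.
  by rewrite nc0; apply: Rintegral_ge0 => x _; exact: nc_ge0.
(* Multiplication by this unimodular constant turns the integral into its modulus, which is then the
   integral of a real part. *)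
pose a := (nc (cint f))%:C / cint f.
have aE : a * cint f = (nc (cint f))%:C by rewrite /a mulfVK.
have na : nc a = 1 by rewrite /a ncM ncV nc_real ger0_norm ?nc_ge0// divff ?nc_eq0.
have -> : nc (cint f) = Rintegral mu setT (fun x => complex.Re (a * f x)).
  by have := cintZ a If; rewrite aE => /(congr1 (@complex.Re R)).
apply: Rintegral_le; [by case: (cintegrableZ a If)|exact: rintegrable_nc|].
move=> x; apply: le_trans (ler_norm _) _; apply: le_trans (nc_ge_Re _) _.
by rewrite ncM na mul1r.
Qed.

Lemma nc_cint_le f h : cintegrable f -> rintegrable h ->
  (forall x, nc (f x) <= h x) -> nc (cint f) <= Rintegral mu setT h.
Proof.
move=> If ih fh; apply: le_trans (nc_cint If) _.
by apply: Rintegral_le => //; exact: rintegrable_nc.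
Qed.

End complex_integral.

(** * Topology and Borel sets of C^n *)

Section cn_topology.
Variables (R : realType) (n : nat).
Local Notation E := (Cn R n).
Implicit Types (z y : E) (U : set E).

(** An open polydisc with a real radius; the balls of [Cn] have radii in [R[i]]. *)
Definition near_by (d : R) z y := forall i, nc (y 0 i - z 0 i) < d.

Lemma near_by_ball (d : R) z y : 0 < d -> ball z d%:C y <-> near_by d z y.
Proof.
move=> d0; rewrite /ball/= /mx_ball; split=> H.
  by move=> i; have [_ /(_ 0 i)] := H; rewrite /ball/= -nc_norm ltcR ncBC.
by split=> [|i j]; rewrite ?ltcR// ord1 /ball/= -nc_norm ltcR ncBC.
Qed.

Lemma gt0_complexP (e : R[i]) : 0 < e -> exists2 d : R, 0 < d & e = d%:C.
Proof.
case: e => a b; rewrite ltcE/= => /andP[/eqP b0 a0].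
by exists a => //; rewrite b0.
Qed.

Lemma cn_nbhsP z U : nbhs z U <-> exists2 d : R, 0 < d & forall y, near_by d z y -> U y.
Proof.
split.
  move=> /nbhs_ballP[e /= /gt0_complexP[d d0 ->] H]; exists d => // y yz.
  exact/H/near_by_ball.
move=> [d d0 H]; apply/nbhs_ballP; exists d%:C => /=; first by rewrite ltcR.
by move=> y /(near_by_ball _ _ d0); exact: H.
Qed.

Lemma cn_continuousP (f : E -> R[i]^o) : (forall z (e : R), 0 < e ->
  exists2 d : R, 0 < d & forall y, near_by d z y -> nc (f y - f z) < e) -> continuous f.
Proof.
move=> H z; have ? := nbhs_filter z; apply/cvgrPdist_lt => e /gt0_complexP[d d0 ->].
have [d' d'0 H'] := H z d d0.
apply/cn_nbhsP; exists d' => // y yz.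
by rewrite -nc_norm ltcR ncBC; exact: H'.
Qed.

Lemma continuous_nearP (f : E -> R[i]^o) z (e : R) : continuous f -> 0 < e ->
  exists2 d : R, 0 < d & forall y, near_by d z y -> nc (f y - f z) < e.
Proof.
move=> cf e0; have ? := nbhs_filter z; have /cvgrPdist_lt /(_ e%:C) := cf z.
rewrite ltcR => /(_ e0) /cn_nbhsP[d d0 H]; exists d => // y /H.
by rewrite -nc_norm ltcR ncBC.
Qed.

End cn_topology.

Section cn_measurable.
Variables (R : realType) (n : nat).
Local Notation E := (Cn R n).
Implicit Types (z y : E) (U : set E).

Lemma measurable_Re_coord (i : 'I_n) :
  measurable_fun setT (fun z : E => complex.Re (z 0 i)).
Proof.
move=> _ A mA; rewrite setTI.
rewrite /measurable/= /Cn_measurable /image_set_system/= setTI.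
rewrite [X in measurable X](_ : _ =
  (fun p : n.-tuple (measurableTypeR R) * n.-tuple (measurableTypeR R) =>
    tnth p.1 i) @^-1` A); last by apply/seteqP; split => p /=; rewrite mxE.
rewrite -[X in measurable X]setTI.
apply: (measurableT_comp (measurable_tnth i) measurable_fst) => //.
Qed.

Lemma measurable_Im_coord (i : 'I_n) :
  measurable_fun setT (fun z : E => complex.Im (z 0 i)).
Proof.
move=> _ A mA; rewrite setTI.
rewrite /measurable/= /Cn_measurable /image_set_system/= setTI.
rewrite [X in measurable X](_ : _ =
  (fun p : n.-tuple (measurableTypeR R) * n.-tuple (measurableTypeR R) =>
    tnth p.2 i) @^-1` A); last by apply/seteqP; split => p /=; rewrite mxE.
rewrite -[X in measurable X]setTI.
apply: (measurableT_comp (measurable_tnth i) measurable_snd) => //.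
Qed.

Lemma cmeas_coord (i : 'I_n) : cmeas (fun z : E => z 0 i).
Proof. by split; [exact: measurable_Re_coord|exact: measurable_Im_coord]. Qed.

Lemma measurable_fun_Cn d (X : measurableType d) (phi : X -> E) :
  (forall i, cmeas (fun x => phi x 0 i)) -> measurable_fun setT phi.
Proof.
move=> mphi.
pose psi x : n.-tuple (measurableTypeR R) * n.-tuple (measurableTypeR R) :=
  ([tuple complex.Re (phi x 0 i) | i < n], [tuple complex.Im (phi x 0 i) | i < n]).
have -> : phi = @of_coords R n \o psi.
  apply/funext => x; apply/rowP => i.
  by rewrite /= mxE !tnth_mktuple; apply: complex_ext.
apply: measurableT_comp; first exact: measurable_of_coords.
apply/measurable_fun_pair; apply/measurable_fun_tnthP => i /=.
  rewrite [X in measurable_fun _ X](_ : _ = fun x => complex.Re (phi x 0 i)).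
    by have [] := mphi i.
  by apply/funext => x /=; rewrite tnth_mktuple.
rewrite [X in measurable_fun _ X](_ : _ = fun x => complex.Im (phi x 0 i)).
  by have [] := mphi i.
by apply/funext => x /=; rewrite tnth_mktuple.
Qed.

Lemma cmeas_comp d (X : measurableType d) (phi : X -> E) (f : E -> R[i]) :
  cmeas f -> (forall i, cmeas (fun x => phi x 0 i)) -> cmeas (fun x => f (phi x)).
Proof.
move=> [f1 f2] /measurable_fun_Cn mphi; split.
  exact: (measurableT_comp f1 mphi).
exact: (measurableT_comp f2 mphi).
Qed.

(** Boxes with rational centres form a countable base. They serve twice: to show that open sets are
    measurable, and to pass from local to global vanishing almost everywhere. *)
Definition rbox (q : {ffun 'I_n -> rat * rat}) (m : nat) : set E :=
  [set z | forall i, `|complex.Re (z 0 i) - ratr (q i).1| < m.+1%:R^-1 /\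
    `|complex.Im (z 0 i) - ratr (q i).2| < m.+1%:R^-1].

Lemma measurable_rbox q m : measurable (rbox q m).
Proof.
have -> : rbox q m = \bigcap_(i in [set: 'I_n])
    (((fun z : E => `|complex.Re (z 0 i) - ratr (q i).1|) @^-1` `]-oo, m.+1%:R^-1[) `&`
    ((fun z : E => `|complex.Im (z 0 i) - ratr (q i).2|) @^-1` `]-oo, m.+1%:R^-1[)).
  apply/seteqP; split => z H i.
    by move=> _; have [? ?] := H i; split => /=; rewrite in_itv.
  by have [/=] := H i I; rewrite !in_itv.
apply: fin_bigcap_measurable => // i _; apply: measurableI.
  rewrite -[X in measurable X]setTI.
  have : measurable_fun setT (fun z : E => `|complex.Re (z 0 i) - ratr (q i).1|).
    apply: measurableT_comp; first exact: normr_measurable.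
    by apply: measurable_funB; [exact: measurable_Re_coord|exact: measurable_cst].
  by apply; [exact: measurableT|exact: measurable_itv].
rewrite -[X in measurable X]setTI.
have : measurable_fun setT (fun z : E => `|complex.Im (z 0 i) - ratr (q i).2|).
  apply: measurableT_comp; first exact: normr_measurable.
  by apply: measurable_funB; [exact: measurable_Im_coord|exact: measurable_cst].
by apply; [exact: measurableT|exact: measurable_itv].
Qed.

Lemma rbox_nbhs z U : nbhs z U -> exists q m, rbox q m z /\ rbox q m `<=` U.
Proof.
move=> /cn_nbhsP[d d0 H].
(* In each real component [z] and any other point of the box are within [d / 4] of the centre, hence
   within [d / 2] of each other; the modulus is at most the sum of the two components. *)
have [m Hm] : exists m : nat, m.+1%:R^-1 < d / 4.
  have d4 : 0 < 4 / d by rewrite divr_gt0.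
  exists (Num.truncn (4 / d)).
  rewrite -[d / 4]invrK ltf_pV2 ?posrE ?ltr0n// ?invr_gt0 ?divr_gt0//.
  by rewrite invf_div; exact: truncnS_gt.
have e0 : 0 < m.+1%:R^-1 :> R by rewrite invr_gt0 ltr0n.
have ra (x : R) : {q : rat | `|x - ratr q| < m.+1%:R^-1}.
  apply: cid; move: (m.+1%:R^-1) e0 => e e0; have : x - e < x + e by lra.
  move=> /rat_in_itvoo[q]; rewrite in_itv/= => /andP[q1 q2]; exists q.
  by rewrite ltr_norml; apply/andP; split; lra.
exists [ffun i => (sval (ra (complex.Re (z 0 i))), sval (ra (complex.Im (z 0 i))))], m.
split; first by move=> i; rewrite ffunE/=; split; [case: (ra _)|case: (ra _)].
move=> y yq; apply: H => i.
have [] := yq i; rewrite ffunE/=.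
case: (ra (complex.Re _)) => q1 /= h1; case: (ra (complex.Im _)) => q2 /= h2.
move=> h3 h4; apply: le_lt_trans (nc_le_ReIm _) _; rewrite creD cimD creN cimN.
move: (m.+1%:R^-1) Hm h1 h2 h3 h4 => e Hm; rewrite !ltr_norml => /andP[h1 h1'] /andP[h2 h2'] /andP[h3 h3'] /andP[h4 h4'].
have : `|complex.Re (y 0 i) - complex.Re (z 0 i)| < d / 2.
  by rewrite ltr_norml; apply/andP; split; lra.
have : `|complex.Im (y 0 i) - complex.Im (z 0 i)| < d / 2.
  by rewrite ltr_norml; apply/andP; split; lra.
by move=> k1 k2; rewrite [d]splitr ltrD.
Qed.

Lemma open_rboxE U : open U ->
  U = \bigcup_(i in [set i | rbox i.1 i.2 `<=` U]) rbox i.1 i.2.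
Proof.
move=> oU; apply/seteqP; split => z.
  move=> Uz; have /rbox_nbhs [q [m [zq qU]]] : nbhs z U by exact: open_nbhs_nbhs.
  by exists (q, m).
by move=> [i /= iU] /iU.
Qed.

Lemma open_measurable_Cn U : open U -> measurable U.
Proof.
move=> /open_rboxE ->.
have -> : \bigcup_(i in [set i | rbox i.1 i.2 `<=` U]) rbox i.1 i.2 =
    \bigcup_i (if `[< rbox i.1 i.2 `<=` U >] then rbox i.1 i.2 else set0).
  apply/seteqP; split => z [k].
    by move=> /= iU zi; exists k => //; rewrite (asboolT iU).
  by move=> _; case: asboolP => // iU zi; exists k.
apply: countable_bigcupT_measurable; first exact: countableP.
by move=> i; case: ifP => _; [exact: measurable_rbox|exact: measurable0].
Qed.

Lemma closed_measurable_Cn U : closed U -> measurable U.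
Proof.
by move=> cU; rewrite -[U]setCK; apply: measurableC; apply: open_measurable_Cn; rewrite openC.
Qed.

Lemma continuous_cmeas (f : E -> R[i]^o) : continuous f -> cmeas f.
Proof.
move=> cf; split.
  apply: (measurability _ (RGenOInfty.measurableE R)) => /= _ [_ [a ->] <-].
  rewrite setTI; apply: open_measurable_Cn; rewrite openE => z /=.
  rewrite in_itv/= andbT => az.
  have e0 : 0 < complex.Re (f z) - a by rewrite subr_gt0.
  have [d d0 H] := continuous_nearP z cf e0.
  apply/cn_nbhsP; exists d => // y /H yz /=; rewrite in_itv/= andbT.
  have := le_lt_trans (nc_ge_Re _) yz; rewrite creD creN ltr_norml; lra.
apply: (measurability _ (RGenOInfty.measurableE R)) => /= _ [_ [a ->] <-].
rewrite setTI; apply: open_measurable_Cn; rewrite openE => z /=.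
rewrite in_itv/= andbT => az.
have e0 : 0 < complex.Im (f z) - a by rewrite subr_gt0.
  have [d d0 H] := continuous_nearP z cf e0.
apply/cn_nbhsP; exists d => // y /H yz /=; rewrite in_itv/= andbT.
have := le_lt_trans (nc_ge_Im _) yz; rewrite cimD cimN ltr_norml; lra.
Qed.

End cn_measurable.

(** * Lebesgue measure on the plane of one complex variable *)

Section plane.
Variable R : realType.

Definition plane := (measurableTypeR R * measurableTypeR R)%type.

Definition lam2 : {measure set plane -> \bar R} :=
  (@lebesgue_measure R \x @lebesgue_measure R)%E.

Lemma lam2_rect (A B : set (measurableTypeR R)) : measurable A -> measurable B ->
  lam2 (A `*` B) = (lebesgue_measure A * lebesgue_measure B)%E.
Proof. by move=> mA mB; exact: product_measure1E. Qed.

Definition shift1 (a : R) (x : measurableTypeR R) : measurableTypeR R := x + a.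

Lemma measurable_shift1 a : measurable_fun setT (shift1 a).
Proof. by apply: measurable_funD; [exact: measurable_id|exact: measurable_cst]. Qed.

HB.instance Definition _ a := @isMeasurableFun.Build _ _ _ _ (shift1 a) (measurable_shift1 a).

Lemma lebesgue_measure_shift a (A : set R) : measurable A ->
  pushforward (@lebesgue_measure R) (shift1 a) A = lebesgue_measure A.
Proof.
move=> mA; apply/esym/lebesgue_measure_unique => //= _ [[x y]] _ <-.
rewrite /pushforward.
have -> : shift1 a @^-1` `]x, y]%classic = `]x - a, y - a]%classic.
  apply/seteqP; split => t /=; rewrite !in_itv/= /shift1 => /andP[h1 h2];
    apply/andP; split; lra.
rewrite !lebesgue_measure_itv/= !lte_fin ltrD2r.
by case: ifP => // _; congr EFin; lra.
Qed.

Definition shift2 (a : plane) (p : plane) : plane := (shift1 a.1 p.1, shift1 a.2 p.2).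

Lemma measurable_shift2 a : measurable_fun setT (shift2 a).
Proof.
apply/measurable_fun_pair.
  exact: (measurableT_comp (measurable_shift1 _) measurable_fst).
exact: (measurableT_comp (measurable_shift1 _) measurable_snd).
Qed.

HB.instance Definition _ a := @isMeasurableFun.Build _ _ _ _ (shift2 a) (measurable_shift2 a).

Lemma lam2_shift a (A : set plane) : measurable A ->
  pushforward lam2 (shift2 a) A = lam2 A.
Proof.
move=> mA; apply/esym/product_measure_unique => //= B C mB mC.
rewrite /pushforward /lam2.
have -> : shift2 a @^-1` (B `*` C) = (shift1 a.1 @^-1` B) `*` (shift1 a.2 @^-1` C).
  by apply/seteqP; split.
rewrite product_measure1E; last 2 first.
- by rewrite -[X in measurable X]setTI; exact: measurable_shift1.
- by rewrite -[X in measurable X]setTI; exact: measurable_shift1.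
by rewrite -(lebesgue_measure_shift a.1 mB) -(lebesgue_measure_shift a.2 mC).
Qed.

Lemma integrable_shift a (f : plane -> R) : rintegrable lam2 f ->
  rintegrable lam2 (fun p => f (shift2 a p)) /\
  Rintegral lam2 setT (fun p => f (shift2 a p)) = Rintegral lam2 setT f.
Proof.
move=> If.
have If' : (pushforward lam2 (shift2 a)).-integrable setT (fun p => (f p)%:E).
  apply/integrableP; split; first exact: (measurable_int _ If).
  move/integrableP : If => [_]; apply: le_lt_trans.
  by rewrite le_eqVlt; apply/orP; left; apply/eqP/eq_measure_integral => A mA _; exact: lam2_shift.
have mf := measurable_int _ If.
have Ic : rintegrable lam2 (fun p => f (shift2 a p)).
  apply/integrableP; split; first exact: (measurableT_comp mf (measurable_shift2 a)).
  move/integrableP : If' => [_]; rewrite ge0_integral_pushforward//.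
  exact: measurableT_comp.
split => //.
rewrite /Rintegral; congr fine.
transitivity (\int[pushforward lam2 (shift2 a)]_p (f p)%:E)%E.
  by rewrite integral_pushforward.
by apply: eq_measure_integral => A mA _; exact: lam2_shift.
Qed.

Lemma cint_shift a (f : plane -> R[i]) : cintegrable lam2 f ->
  cintegrable lam2 (fun p => f (shift2 a p)) /\
  cint lam2 (fun p => f (shift2 a p)) = cint lam2 f.
Proof.
move=> [/(integrable_shift a)[i1 e1] /(integrable_shift a)[i2 e2]]; split => //.
by rewrite /cint e1 e2.
Qed.

Definition pt (p : plane) : R[i] := (p.1 : R) +i* (p.2 : R).

Lemma cmeas_pt : cmeas pt.
Proof. by split; [exact: measurable_fst|exact: measurable_snd]. Qed.

Lemma pt_shift2 a p : pt (shift2 a p) = pt p + pt a.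
Proof. by []. Qed.

Definition disc (L : R) : set plane := [set p | nc (pt p) < L].

Lemma measurable_disc L : measurable (disc L).
Proof.
have -> : disc L = (fun p => nc (pt p)) @^-1` `]-oo, L[.
  by apply/seteqP; split => p /=; rewrite in_itv.
rewrite -[X in measurable X]setTI.
by apply: (measurable_nc cmeas_pt) => //; exact: measurable_itv.
Qed.

Lemma lam2_disc_le L : 0 < L -> (lam2 (disc L) <= ((2 * L) ^+ 2)%:E)%E.
Proof.
move=> L0.
have mI : measurable (`[- L, L]%classic : set (measurableTypeR R)) by exact: measurable_itv.
have := lam2_rect mI mI; set I2 := _ `*` _ => I2E.
have dI : (lam2 (disc L) <= lam2 I2)%E.
  apply: le_measure; rewrite ?inE.
  - exact: measurable_disc.
  - exact: measurableX.
  - move=> p /= /ltW pL; split => /=; rewrite in_itv/= -ler_norml.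
      exact: le_trans (nc_ge_Re (pt p)) pL.
    exact: le_trans (nc_ge_Im (pt p)) pL.
apply: (le_trans dI); rewrite I2E lebesgue_measure_itv/= lte_fin gtrN//.
by rewrite -EFinM lee_fin le_eqVlt; apply/orP; left; apply/eqP; ring.
Qed.

Lemma lam2_disc_fin L : (lam2 (disc L) < +oo)%E.
Proof.
have L0 : 0 < `|L| + 1 by rewrite ltr_wpDl.
apply: (@le_lt_trans _ _ (lam2 (disc (`|L| + 1)))); last first.
  exact: le_lt_trans (lam2_disc_le L0) (ltry _).
apply: le_measure; rewrite ?inE; [exact: measurable_disc|exact: measurable_disc|].
by move=> p /lt_trans; apply; rewrite (le_lt_trans (ler_norm _))// ltrDl.
Qed.

End plane.

(** * A class of smooth functions on C^n *)

Section calculus.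
Variables (R : realType) (n : nat).
Local Notation E := (Cn R n).
Implicit Types (z v : E) (f g : E -> R[i]) (r t : R).

Definition cbnd r z := forall i, nc (z 0 i) <= r.

Definition isdir v := exists j : 'I_n, v = dir_x R j \/ v = dir_y R j.

Lemma isdir_le1 v i : isdir v -> nc (v 0 i) <= 1.
Proof.
move=> [j [->|->]]; rewrite /dir_x /dir_y !mxE eqxx/=.
  by case: eqP => _; rewrite ?nc1 ?nc0.
by case: eqP => _; rewrite ?mulr1 ?mulr0 ?nc0// nc_i.
Qed.

Lemma cbnd_ex z : exists2 r, 0 <= r & cbnd r z.
Proof.
exists (\sum_i nc (z 0 i)); first by apply: sumr_ge0 => i _; exact: nc_ge0.
move=> i; rewrite (bigD1 i)//= lerDl; apply: sumr_ge0 => k _; exact: nc_ge0.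
Qed.

Lemma cbnd_step r z v t : isdir v -> `|t| <= 1 -> cbnd r z ->
  cbnd (r + 1) (z + t%:C *: v).
Proof.
move=> dv t1 rz i; rewrite !mxE; apply: le_trans (ncD _ _) _.
rewrite lerD// ncM nc_real mulr_ile1 ?nc_ge0//; exact: isdir_le1.
Qed.

Definition locbounded f :=
  forall r, exists2 B, 0 <= B & forall z, cbnd r z -> nc (f z) <= B.

(* [g] is the derivative of [f] in direction [v], with an error which is
   quadratic, locally uniformly in the base point. *)
Definition dd v f g := forall r, exists2 B, 0 <= B & forall z t,
  cbnd r z -> `|t| <= 1 -> nc (f (z + t%:C *: v) - f z - t%:C * g z) <= B * t ^+ 2.

(** The expansion at [t = 1] expresses [g] by two values of [f] and a bounded remainder. *)
Lemma dd_locbounded v f g : isdir v -> locbounded f -> dd v f g -> locbounded g.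
Proof.
move=> dv bf df r; have [B B0 HB] := df r.
have [A A0 HA] := bf (r + 1).
exists (B + (A + A)) => [|z rz]; first by rewrite !addr_ge0.
have h1 : `|1 : R| <= 1 by rewrite normr1.
have := HB z 1 rz h1; rewrite expr1n mulr1 mul1r => H.
have -> : g z = - (f (z + 1%:C *: v) - f z - g z) + (f (z + 1%:C *: v) - f z).
  by rewrite opprB subrK.
apply: le_trans (ncD _ _) _; rewrite ncN lerD//.
apply: le_trans (ncB _ _) _; rewrite lerD//; apply: HA.
  exact: cbnd_step.
by move=> i; rewrite (le_trans (rz i))// lerDl.
Qed.

Lemma dd_lip v f g r : isdir v -> locbounded f -> dd v f g ->
  exists2 B, 0 <= B & forall z t, cbnd r z -> `|t| <= 1 ->
    nc (f (z + t%:C *: v) - f z) <= B * `|t|.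
Proof.
move=> dv bf df; have [B B0 HB] := df r.
have [A A0 HA] := dd_locbounded dv bf df r.
exists (B + A) => [|z t rz t1]; first by rewrite addr_ge0.
rewrite -[f _ - f z](subrK (t%:C * g z)) (le_trans (ncD _ _))// mulrDl lerD//.
  apply: le_trans (HB _ _ rz t1) _; rewrite ler_wpM2l// -real_normK ?num_real//.
  by rewrite expr2 ler_piMl.
by rewrite ncM nc_real mulrC ler_wpM2r// HA.
Qed.

Lemma dd_uniq v f g g' : dd v f g -> dd v f g' -> g = g'.
Proof.
move=> df df'; apply/funext => z; have [r r0 rz] := cbnd_ex z.
have [B B0 HB] := df r; have [B' B'0 HB'] := df' r.
apply/eqP; rewrite -subr_eq0 -nc_eq0 eq_le nc_ge0 andbT.
apply/ler_addgt0Pl => e e0; rewrite addr0.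
pose t : R := Num.min 1 (e / (B + B' + 1)).
have BB : 0 < B + B' + 1 by rewrite ltr_wpDl// addr_ge0.
have t0 : 0 < t by rewrite lt_min ltr01 divr_gt0.
have t1 : `|t| <= 1 by rewrite gtr0_norm// ge_min lexx.
have := lerD (HB _ _ rz t1) (HB' _ _ rz t1).
move=> /(le_trans (ncB _ _)).
rewrite [X in nc X](_ : _ = t%:C * (g' z - g z)); last by ring.
rewrite ncM nc_real gtr0_norm// -mulrDl expr2 mulrCA ler_pM2l// ncBC.
move=> /le_trans; apply.
have : t <= e / (B + B' + 1) by rewrite ge_min lexx orbT.
rewrite ler_pdivlMr// => H; apply: le_trans H.
by rewrite mulrC ler_wpM2l ?lerDl// ltW.
Qed.

Lemma dd_cst v (c : R[i]) : dd v (fun=> c) (fun=> 0).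
Proof.
by move=> r; exists 0 => // z t _ _; rewrite subrr mulr0 subrr nc0 mul0r.
Qed.

Lemma dd_coord v (i : 'I_n) : dd v (fun z => z 0 i) (fun=> v 0 i).
Proof.
move=> r; exists 0 => // z t _ _; rewrite !mxE [z 0 i + _]addrC addrK.
by rewrite subrr nc0 mul0r.
Qed.

Lemma dd_conj v f g : dd v f g -> dd v (fun z => (f z)^*%C) (fun z => (g z)^*%C).
Proof.
move=> df r; have [B B0 HB] := df r; exists B => // z t rz t1.
apply: le_trans (HB z t rz t1); rewrite -nc_conj.
by rewrite !(rmorphB, rmorphM)/= !conjcK oppr0.
Qed.

Lemma dd_add v f f' g g' : dd v f f' -> dd v g g' ->
  dd v (fun z => f z + g z) (fun z => f' z + g' z).
Proof.
move=> df dg r; have [B B0 HB] := df r; have [A A0 HA] := dg r.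
exists (B + A) => [|z t rz t1]; first by rewrite addr_ge0.
rewrite mulrDl; apply: le_trans (lerD (HB z t rz t1) (HA z t rz t1)).
by apply: le_trans (ncD _ _); rewrite le_eqVlt; apply/orP; left; apply/eqP; congr nc; ring.
Qed.

Lemma dd_mul v f f' g g' : isdir v -> locbounded f -> locbounded g ->
  dd v f f' -> dd v g g' ->
  dd v (fun z => f z * g z) (fun z => f z * g' z + f' z * g z).
Proof.
move=> dv bf bg df dg r; have [B B0 HB] := df r; have [A A0 HA] := dg r.
have [M1 M10 HM1] := bf r; have [M2 M20 HM2] := bg (r + 1).
have [M3 M30 HM3] := dd_locbounded dv bf df r.
have [M4 M40 HM4] := dd_locbounded dv bg dg r.
exists (B * M2 + (M1 + M3) * A + M3 * M4) => [|z t rz t1].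
  by rewrite !addr_ge0// mulr_ge0// addr_ge0.
set F := f _; set G := g (z + _).
have -> : F * G - f z * g z - t%:C * (f z * g' z + f' z * g z) =
  (F - f z - t%:C * f' z) * G +
  (f z + t%:C * f' z) * (G - g z - t%:C * g' z) +
  t%:C ^+ 2 * (f' z * g' z) by ring.
have tt : t ^+ 2 = `|t| ^+ 2 by rewrite real_normK ?num_real.
rewrite 2!(mulrDl _ _ (t ^+ 2)).
apply: le_trans (ncD _ _) _; apply: lerD.
  apply: le_trans (ncD _ _) _; apply: lerD.
    rewrite ncM mulrAC; apply: ler_pM; rewrite ?nc_ge0//; first exact: HB.
    by apply: HM2; exact: cbnd_step.
  rewrite ncM -mulrA.
  apply: ler_pM; rewrite ?nc_ge0//; last exact: HA.
  apply: le_trans (ncD _ _) _; apply: lerD; first exact: HM1.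
  by rewrite ncM nc_real -[M3]mul1r ler_pM ?nc_ge0 ?HM3.
rewrite ncM ncX nc_real -tt mulrC ler_wpM2r ?sqr_ge0//.
by rewrite ncM ler_pM ?nc_ge0 ?HM3 ?HM4.
Qed.

Lemma dd_comp v f f' (G G' : R -> R) : isdir v -> locbounded f -> dd v f f' ->
  smoothR G -> smoothR G' -> (forall x : R, is_derive x 1 G (G' x)) ->
  dd v (fun z => (G (complex.Re (f z)))%:C)
       (fun z => (G' (complex.Re (f z)) * complex.Re (f' z))%:C).
Proof.
move=> dv bf df sG sG' dG r.
have [B B0 HB] := df r; have [A A0 HA] := dd_lip r dv bf df.
have [M M0 HM] := bf (r + 1).
have [Q Q0 HQ] := smoothR_quad M sG sG' dG.
have [D D0 HD] := smoothR_bounded (- M) M sG'.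
exists (Q * A ^+ 2 + B * D) => [|z t rz t1].
  by rewrite addr_ge0// mulr_ge0// sqr_ge0.
have rz' : cbnd (r + 1) z by move=> i; rewrite (le_trans (rz i))// lerDl.
set x := complex.Re (f z); set y := complex.Re (f (z + _)).
have xM : `|x| <= M by apply: le_trans (nc_ge_Re _) (HM _ rz').
have yM : `|y| <= M by apply: le_trans (nc_ge_Re _) (HM _ (cbnd_step dv t1 rz)).
rewrite [X in nc X](_ : _ = (G y - G x - t * (G' x * complex.Re (f' z)))%:C); last first.
  by apply: complex_ext; rewrite !(creD, cimD, creN, cimN, creM, cimM)/=; ring.
rewrite nc_real.
have -> : G y - G x - t * (G' x * complex.Re (f' z)) =
  (G y - G x - (y - x) * G' x) + (y - x - t * complex.Re (f' z)) * G' x by ring.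
apply: le_trans (ler_normD _ _) _; rewrite (mulrDl _ _ (t ^+ 2)); apply: lerD.
  apply: le_trans (HQ _ _ xM yM) _; rewrite -mulrA ler_wpM2l//.
  rewrite -(real_normK (num_real (y - x))) -(real_normK (num_real t)) -exprMn.
  rewrite ler_sqr ?nnegrE ?mulr_ge0//.
  apply: le_trans (HA _ _ rz t1).
  by apply: le_trans (nc_ge_Re _); rewrite creD creN.
rewrite normrM mulrAC; apply: ler_pM => //; last by apply: HD; rewrite -ler_norml.
apply: le_trans (HB _ _ rz t1); apply: le_trans (nc_ge_Re _).
rewrite le_eqVlt; apply/orP; left; apply/eqP; congr (`|_|).
by rewrite !(creD, creN, creM)/= -/x -/y; ring.
Qed.

(** Along each of the 2n real coordinate directions [f] is Lipschitz, uniformly on polydiscs; a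
    nearby [y] is reached from [z] by 2n such steps. *)
Lemma locbounded_dd_continuous f :
  locbounded f -> (forall v, isdir v -> exists g, dd v f g) -> continuous (f : E -> R[i]^o).
Proof.
move=> bf df; apply: cn_continuousP => z e e0.
have [r r0 rz] := cbnd_ex z.
(* Each of the 2n steps has length at most 1, so the whole path stays in this polydisc. *)
pose r' := r + (n + n)%:R.
have lip : exists2 B, 0 <= B & forall v w t, isdir v -> cbnd r' w -> `|t| <= 1 ->
    nc (f (w + t%:C *: v) - f w) <= B * `|t|.
  have Lx (j : 'I_n) : {B | 0 <= B & forall w t, cbnd r' w -> `|t| <= 1 ->
      nc (f (w + t%:C *: dir_x R j) - f w) <= B * `|t|}.
    apply: cid2; have dv : isdir (dir_x R j) by exists j; left.
    by have [g dg] := df _ dv; exact: dd_lip.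
  have Ly (j : 'I_n) : {B | 0 <= B & forall w t, cbnd r' w -> `|t| <= 1 ->
      nc (f (w + t%:C *: dir_y R j) - f w) <= B * `|t|}.
    apply: cid2; have dv : isdir (dir_y R j) by exists j; right.
    by have [g dg] := df _ dv; exact: dd_lip.
  exists (\sum_j (s2val (Lx j) + s2val (Ly j))).
    by apply: sumr_ge0 => j _; rewrite addr_ge0//; [case: (Lx j)|case: (Ly j)].
  move=> v w t [j] dv rw t1.
  have h : s2val (Lx j) + s2val (Ly j) <= \sum_j (s2val (Lx j) + s2val (Ly j)).
    rewrite [leRHS](bigD1 j)//= lerDl; apply: sumr_ge0 => k _.
    by rewrite addr_ge0//; [case: (Lx k)|case: (Ly k)].
  apply: (@le_trans _ _ ((s2val (Lx j) + s2val (Ly j)) * `|t|)); last exact: ler_wpM2r.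
  case: (Lx j) (Ly j) dv => /= B B0 HB [/= B' B'0 HB'] [->|->].
    by rewrite (le_trans (HB _ _ rw t1))// ler_wpM2r// lerDl.
  by rewrite (le_trans (HB' _ _ rw t1))// ler_wpM2r// lerDr.
have [B B0 HB] := lip.
pose d := Num.min 1 (e / ((B + 1) * (n + n).+1%:R)).
have D0 : 0 < (B + 1) * (n + n).+1%:R by rewrite mulr_gt0// ltr_wpDl.
have d0 : 0 < d by rewrite lt_min ltr01 divr_gt0.
exists d => // y yz.
pose tv (k : 'I_n + 'I_n) : R * E := match k with
  | inl j => (complex.Re (y 0 j - z 0 j), dir_x R j)
  | inr j => (complex.Im (y 0 j - z 0 j), dir_y R j) end.
have tvdir k : isdir (tv k).2.
  by case: k => j /=; exists j; [left|right].
have tvd k : `|(tv k).1| < d.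
  case: k => j /=; first exact: le_lt_trans (nc_ge_Re _) (yz j).
  exact: le_lt_trans (nc_ge_Im _) (yz j).
have d1 : d <= 1 by rewrite ge_min lexx.
have yE : y = z + \sum_(k <- enum {: 'I_n + 'I_n}) (tv k).1%:C *: (tv k).2.
  rewrite big_enum/= big_sumType/= -big_split/=.
  rewrite [X in z + X](_ : _ = y - z); first by rewrite addrC subrK.
  rewrite [RHS]row_sum_delta; apply: eq_bigr => j _.
  rewrite /dir_x /dir_y scalerA -scalerDl !mxE; congr (_ *: _).
  by apply: complex_ext; rewrite !(creD, cimD, creN, cimN, creM, cimM)/=; ring.
have key (s : seq ('I_n + 'I_n)) : (size s <= n + n)%N ->
    cbnd (r + (size s)%:R) (z + \sum_(k <- s) (tv k).1%:C *: (tv k).2) /\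
    nc (f (z + \sum_(k <- s) (tv k).1%:C *: (tv k).2) - f z) <= B * d * (size s)%:R.
  elim: s => [|k s IH]; first by rewrite big_nil !addr0 subrr nc0 mulr0.
  move=> /= ss; have [IH1 IH2] := IH (ltnW ss).
  rewrite big_cons [_ *: _ + _]addrC addrA; set w := z + _ in IH1 IH2 *.
  have tk1 : `|(tv k).1| <= 1 by rewrite ltW// (lt_le_trans (tvd k)).
  split.
    by rewrite -natr1 addrA; apply: cbnd_step.
  rewrite -[f _ - f z](subrKA (f w)) (le_trans (ncD _ _))//.
  rewrite -natr1 mulrDr mulr1 [leRHS]addrC lerD//.
  have rw : cbnd r' w.
    by move=> i; rewrite (le_trans (IH1 i))// lerD2l ler_nat ltnW.
  apply: le_trans (HB _ _ _ (tvdir k) rw tk1) _.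
  by rewrite ler_wpM2l// ltW.
rewrite yE; have sz : size (enum {: 'I_n + 'I_n}) = (n + n)%N.
  by rewrite -cardE card_sum card_ord.
have [_] := key (enum {: 'I_n + 'I_n}) (eq_leq sz).
move=> /le_lt_trans; apply; rewrite sz.
have dle : d <= e / ((B + 1) * (n + n).+1%:R) by rewrite ge_min lexx orbT.
have : d * ((B + 1) * (n + n).+1%:R) <= e by rewrite -ler_pdivlMr.
apply: lt_le_trans; rewrite [B * d]mulrC -mulrA ltr_pM2l//.
apply: (@le_lt_trans _ _ ((B + 1) * (n + n)%:R)); first by rewrite ler_wpM2r// lerDl.
by rewrite ltr_pM2l ?ltr_nat// ltr_wpDl.
Qed.

End calculus.

(** * A class closed under differentiation and convolution in one variable *)

Section smooth_class.
Variables (R : realType) (n : nat).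
Local Notation E := (Cn R n).
Implicit Types (z v : E) (f g : E -> R[i]) (r t : R) (j : 'I_n) (k : plane R -> R[i]).

Definition kern k := cintegrable (@lam2 R) k /\
  exists2 L, 0 <= L & forall p, L < nc (pt p) -> k p = 0.

Definition slide j z (p : plane R) : E := z + pt p *: dir_x R j.

Lemma slideE j z p i : slide j z p 0 i = z 0 i + (if i == j then pt p else 0).
Proof.
rewrite /slide /dir_x !mxE/=; case: eqP => _; first by rewrite mulr1.
by rewrite mulr0.
Qed.

Lemma cmeas_slide j z f : cmeas f -> cmeas (fun p => f (slide j z p)).
Proof.
move=> mf; apply: cmeas_comp => // i.
under [X in cmeas X]eq_fun do rewrite slideE.
apply: cmeasD; first exact: cmeas_cst.
by case: (i == j); [exact: cmeas_pt|exact: cmeas_cst].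
Qed.

Lemma cbnd_slide j z p r L : cbnd r z -> nc (pt p) <= L -> cbnd (r + L) (slide j z p).
Proof.
move=> rz pL i; rewrite slideE; apply: le_trans (ncD _ _) _; apply: lerD => //.
case: eqP => // _; rewrite nc0; exact: le_trans (nc_ge0 _) pL.
Qed.

(** Convolution in the [j]-th variable, up to the reflection of the kernel. The translation sits on
    [f], so that all derivatives fall on [f] and the kernel may be singular. *)
Definition cconv j k f : E -> R[i] := fun z => cint (@lam2 R) (fun p => f (slide j z p) * k p).

Lemma cconv_bound j k f r : kern k -> locbounded f ->
  exists2 B, 0 <= B & forall z, cbnd r z -> forall p,
    nc (f (slide j z p) * k p) <= B * nc (k p).
Proof.
move=> [_ [L L0 kL]] bf; have [B B0 HB] := bf (r + L); exists B => // z rz p.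
have [pL|pL] := leP (nc (pt p)) L; last by rewrite kL// mulr0 nc0 mulr0.
by rewrite ncM ler_wpM2r ?nc_ge0//; apply: HB; exact: cbnd_slide.
Qed.

Lemma cconv_integrable j k f z : kern k -> locbounded f -> cmeas f ->
  cintegrable (@lam2 R) (fun p => f (slide j z p) * k p).
Proof.
move=> kk bf mf; have [r r0 rz] := cbnd_ex z.
have [B B0 HB] := cconv_bound j r kk bf; have [ki _] := kk.
apply: cintegrable_le (rintegrableZ B (rintegrable_nc ki)) (HB _ rz).
by apply: cmeasM; [exact: cmeas_slide|exact: cintegrable_meas ki].
Qed.

Lemma cconv_locbounded j k f : kern k -> locbounded f -> cmeas f ->
  locbounded (cconv j k f).
Proof.
move=> kk bf mf r; have [B B0 HB] := cconv_bound j r kk bf; have [ki _] := kk.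
exists (B * Rintegral (@lam2 R) setT (fun p => nc (k p))).
  by rewrite mulr_ge0// Rintegral_ge0// => p _; exact: nc_ge0.
move=> z rz; rewrite -RintegralZl//; last exact: rintegrable_nc.
apply: nc_cint_le; [exact: cconv_integrable| |exact: HB].
by apply: rintegrableZ; exact: rintegrable_nc.
Qed.

(** The remainder of [f] is quadratic, uniformly on the polydisc swept out by the support of [k],
    and is simply integrated against |k|. This is the reason for the form of [dd]. *)
Lemma cconv_dd j k v f g : isdir v -> kern k -> locbounded f -> cmeas f -> cmeas g ->
  dd v f g -> dd v (cconv j k f) (cconv j k g).
Proof.
move=> dv kk bf mf mg df r; have [ki [L L0 kL]] := kk.
have bg := dd_locbounded dv bf df.
have [B B0 HB] := df (r + L).
exists (B * Rintegral (@lam2 R) setT (fun p => nc (k p))).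
  by rewrite mulr_ge0// Rintegral_ge0// => p _; exact: nc_ge0.
move=> z t rz t1.
have i1 := cconv_integrable j (z + t%:C *: v) kk bf mf.
have i2 := cconv_integrable j z kk bf mf.
have i3 := cconv_integrable j z kk bg mg.
have i4 := cintegrableZ t%:C i3.
rewrite /cconv -cintB// -cintZ// -cintB//; last exact: cintegrableB.
rewrite mulrAC -RintegralZl//; last exact: rintegrable_nc.
apply: nc_cint_le.
- by apply: cintegrableB => //; exact: cintegrableB.
- by apply: rintegrableZ; exact: rintegrable_nc.
move=> p; have [pL|pL] := leP (nc (pt p)) L; last first.
  by rewrite kL// !mulr0 !subr0 nc0 mulr0.
rewrite mulrA -!mulrBl ncM ler_wpM2r ?nc_ge0//.
have -> : slide j (z + t%:C *: v) p = slide j z p + t%:C *: v.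
  by rewrite /slide addrAC.
by apply: HB => //; exact: cbnd_slide.
Qed.

(** [g] is the pointwise limit of the difference quotients of step [m.+1%:R^-1]. *)
Lemma dd_cmeas v f g : cmeas f -> dd v f g -> cmeas g.
Proof.
move=> mf df.
pose h (m : nat) z : R[i] := m.+1%:R%:C * (f (z + m.+1%:R^-1%:C *: v) - f z).
have mh (m : nat) : cmeas (h m).
  apply: cmeasM; first exact: cmeas_cst.
  apply: cmeasB => //; apply: cmeas_comp => // i.
  under [X in cmeas X]eq_fun do rewrite !mxE.
  by apply: cmeasD; [exact: cmeas_coord|exact: cmeas_cst].
have hg z : exists2 B, 0 <= B & forall m : nat, nc (h m z - g z) <= B / m.+1%:R.
  have [r r0 rz] := cbnd_ex z; have [B B0 HB] := df r; exists B => // m.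
  have m0 : 0 < m.+1%:R :> R by rewrite ltr0n.
  have m1 : `|m.+1%:R^-1 : R| <= 1.
    by rewrite gtr0_norm ?invr_gt0// invf_le1// ler1n.
  have := HB z _ rz m1.
  have -> : h m z - g z = m.+1%:R%:C *
    (f (z + m.+1%:R^-1%:C *: v) - f z - m.+1%:R^-1%:C * g z).
    by rewrite mulrBr mulrA -rmorphM/= divff ?gt_eqF// mul1r.
  rewrite ncM nc_real gtr0_norm// => /(ler_wpM2l (ltW m0)) /le_trans; apply.
  by rewrite le_eqVlt; apply/orP; left; apply/eqP; field; rewrite gt_eqF.
have cvg0 (B : R) : (B / m.+1%:R) @[m --> \oo] --> (0 : R).
  rewrite -(mulr0 B); apply: cvgMr; exact: cvg_harmonic.
split.
  apply: (@measurable_fun_cvg _ _ _ _ (fun m z => complex.Re (h m z))).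
    by move=> m; have [] := mh m.
  move=> z _; have [B B0 HB] := hg z; apply/cvgrPdist_le => e e0.
  have /cvgrPdist_le /(_ e e0) := cvg0 B.
  apply: filterS => m; rewrite sub0r normrN => H.
  apply: le_trans H; rewrite distrC -creN -creD.
  apply: le_trans (nc_ge_Re _) _; apply: le_trans (HB m) _; exact: ler_norm.
apply: (@measurable_fun_cvg _ _ _ _ (fun m z => complex.Im (h m z))).
  by move=> m; have [] := mh m.
move=> z _; have [B B0 HB] := hg z; apply/cvgrPdist_le => e e0.
have /cvgrPdist_le /(_ e e0) := cvg0 B.
apply: filterS => m; rewrite sub0r normrN => H.
apply: le_trans H; rewrite distrC -cimN -cimD.
apply: le_trans (nc_ge_Im _) _; apply: le_trans (HB m) _; exact: ler_norm.
Qed.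

(** Everything from which test functions are built: polynomials in the coordinates and their
    conjugates, smooth functions of real parts, and convolutions, in particular Cauchy transforms.
    By [Sm_spec] the class is closed under directional derivatives, which gives [Ck] for every
    order. *)
Inductive Sm : (E -> R[i]) -> Prop :=
| Sm_cst c : Sm (fun=> c)
| Sm_coord (i : 'I_n) : Sm (fun z => z 0 i)
| Sm_conj f : Sm f -> Sm (fun z => (f z)^*%C)
| Sm_add f g : Sm f -> Sm g -> Sm (fun z => f z + g z)
| Sm_mul f g : Sm f -> Sm g -> Sm (fun z => f z * g z)
| Sm_comp G f : smoothR G -> Sm f -> Sm (fun z => (G (complex.Re (f z)))%:C)
| Sm_cconv j k f : kern k -> Sm f -> Sm (cconv j k f).

Lemma Sm_spec f : Sm f ->
  locbounded f /\ forall v, isdir v -> exists g, Sm g /\ dd v f g.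
Proof.
elim=> {f}.
- move=> c; split; first by move=> r; exists (nc c) => //; exact: nc_ge0.
  by move=> v _; exists (fun=> 0); split; [exact: Sm_cst|exact: dd_cst].
- move=> i; split.
    move=> r; exists `|r| => // z rz; exact: le_trans (rz i) (ler_norm _).
  by move=> v _; exists (fun=> v 0 i); split; [exact: Sm_cst|exact: dd_coord].
- move=> f _ [bf df]; split.
    by move=> r; have [B B0 HB] := bf r; exists B => // z /HB; rewrite nc_conj.
  move=> v /df[g [sg dg]]; exists (fun z => (g z)^*%C); split; first exact: Sm_conj.
  exact: dd_conj.
- move=> f g _ [bf df] _ [bg dg]; split.
    move=> r; have [B B0 HB] := bf r; have [A A0 HA] := bg r.
    exists (B + A) => [|z rz]; first by rewrite addr_ge0.
    by apply: le_trans (ncD _ _) _; rewrite lerD ?HA ?HB.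
  move=> v dv; have [f' [sf' df']] := df _ dv; have [g' [sg' dg']] := dg _ dv.
  by exists (fun z => f' z + g' z); split; [exact: Sm_add|exact: dd_add].
- move=> f g sf [bf df] sg [bg dg]; split.
    move=> r; have [B B0 HB] := bf r; have [A A0 HA] := bg r.
    exists (B * A) => [|z rz]; first by rewrite mulr_ge0.
    by rewrite ncM ler_pM ?nc_ge0 ?HA ?HB.
  move=> v dv; have [f' [sf' df']] := df _ dv; have [g' [sg' dg']] := dg _ dv.
  exists (fun z => f z * g' z + f' z * g z); split; last exact: dd_mul.
  by apply: Sm_add; exact: Sm_mul.
- move=> G f sG sf [bf df]; split.
    move=> r; have [B B0 HB] := bf r; have [A A0 HA] := smoothR_bounded (- B) B sG.
    exists A => // z rz; rewrite nc_real; apply: HA; rewrite -ler_norml.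
    exact: le_trans (nc_ge_Re _) (HB _ rz).
  move=> v dv; have [f' [sf' df']] := df _ dv.
  have [G' sG' dG] := smoothR_derive sG.
  exists (fun z => (G' (complex.Re (f z)) * complex.Re (f' z))%:C).
  split; last exact: dd_comp.
  have -> : (fun z => (G' (complex.Re (f z)) * complex.Re (f' z))%:C) =
    (fun z => (G' (complex.Re (f z)))%:C * (complex.Re (f' z))%:C).
    by apply/funext => z; rewrite rmorphM.
  by apply: Sm_mul; [|apply: (Sm_comp (smoothR_id R))]; first exact: Sm_comp.
- move=> j k f kk sf [bf df].
  have mf : cmeas f.
    apply: continuous_cmeas; apply: locbounded_dd_continuous => // v dv.
    by have [g [_ dg]] := df _ dv; exists g.
  split; first exact: cconv_locbounded.
  move=> v dv; have [g [sg dg]] := df _ dv.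
  exists (cconv j k g); split; first exact: Sm_cconv.
  by apply: cconv_dd => //; exact: dd_cmeas dg.
Qed.

Lemma Sm_locbounded f : Sm f -> locbounded f.
Proof. by case/Sm_spec. Qed.

Lemma Sm_continuous f : Sm f -> continuous (f : E -> R[i]^o).
Proof.
move=> /Sm_spec[bf df]; apply: locbounded_dd_continuous => // v dv.
by have [g [_ dg]] := df _ dv; exists g.
Qed.

Lemma Sm_cmeas f : Sm f -> cmeas f.
Proof. by move=> /Sm_continuous cf; exact: continuous_cmeas. Qed.

Lemma dd_rderive v f g : dd v f g -> (forall z, rderivable f v z) /\ rderive v f = g.
Proof.
move=> df.
have H z : is_derive (0 : R) 1 (line_re f z v) (complex.Re (g z)) /\
           is_derive (0 : R) 1 (line_im f z v) (complex.Im (g z)).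
  have [r r0 rz] := cbnd_ex z; have [B B0 HB] := df r.
  split; apply: (@is_derive_quad _ _ _ _ B 1) => // t /ltW t1;
    apply: le_trans (HB z t rz t1);
    rewrite add0r /line_re /line_im rmorph0 scale0r addr0.
    apply: le_trans (nc_ge_Re _); rewrite le_eqVlt; apply/orP; left; apply/eqP.
    by congr (`|_|); rewrite !(creD, creN, creM)/=; ring.
  apply: le_trans (nc_ge_Im _); rewrite le_eqVlt; apply/orP; left; apply/eqP.
  by congr (`|_|); rewrite !(cimD, cimN, cimM)/=; ring.
split; first by move=> z; have [[? _] [? _]] := H z.
apply/funext => z; have [[? h1] [? h2]] := H z.
by rewrite /rderive !derive1E h1 h2; apply: complex_ext.
Qed.

Lemma Sm_rderive v f : isdir v -> Sm f ->
  [/\ forall z, rderivable f v z, Sm (rderive v f) & dd v f (rderive v f)].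
Proof.
move=> dv /Sm_spec[_ /(_ v dv)[g [sg dg]]].
by have [? ->] := dd_rderive dg.
Qed.

Lemma Sm_Ck (m : nat) f : Sm f -> Ck m (f : E -> R[i]^o).
Proof.
elim: m f => [|m IH] f sf /=; first by split => //; exact: Sm_continuous.
split; first exact: Sm_continuous.
move=> j v jv; have dv : isdir v by exists j.
by have [? ? _] := Sm_rderive dv sf; split => //; exact: IH.
Qed.

End smooth_class.

(** * Rules for the d-bar operator and the complex exponential *)

Section dbar_rules.
Variables (R : realType) (n : nat).
Local Notation E := (Cn R n).
Implicit Types (z v : E) (f g : E -> R[i]) (r t : R) (j : 'I_n) (k : plane R -> R[i]).
Local Notation db j f := (dbar j (f : E -> R[i]^o) : E -> R[i]).

Lemma isdir_x j : isdir (dir_x R j). Proof. by exists j; left. Qed.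
Lemma isdir_y j : isdir (dir_y R j). Proof. by exists j; right. Qed.
#[local] Hint Resolve isdir_x isdir_y : core.

Lemma dbar_dd j f gx gy : dd (dir_x R j) f gx -> dd (dir_y R j) f gy ->
  db j f = (fun z => 2^-1 * (gx z + 'i * gy z)).
Proof.
move=> /dd_rderive[_ ex] /dd_rderive[_ ey]; apply/funext => z.
by rewrite /dbar ex ey mulrC.
Qed.

Lemma dbar_ddP j f : Sm f -> exists gx gy,
  [/\ Sm gx, Sm gy, dd (dir_x R j) f gx, dd (dir_y R j) f gy &
   db j f = (fun z => 2^-1 * (gx z + 'i * gy z))].
Proof.
move=> sf; have [_ sx dx] := Sm_rderive (isdir_x j) sf.
have [_ sy dy] := Sm_rderive (isdir_y j) sf.
exists (rderive (dir_x R j) f), (rderive (dir_y R j) f); split => //.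
exact: dbar_dd.
Qed.

Lemma Sm_lin (c d : R[i]) f g : Sm f -> Sm g -> Sm (fun z => c * (f z + d * g z)).
Proof.
move=> sf sg; apply: Sm_mul; first exact: Sm_cst.
by apply: Sm_add => //; apply: Sm_mul => //; exact: Sm_cst.
Qed.

Lemma Sm_dbar j f : Sm f -> Sm (db j f).
Proof. by move=> /(dbar_ddP j)[gx [gy [sx sy _ _ ->]]]; exact: Sm_lin. Qed.

Lemma Sm_opp f : Sm f -> Sm (fun z => - f z).
Proof.
move=> sf; under [X in Sm X]eq_fun do rewrite -mulN1r.
by apply: Sm_mul => //; exact: Sm_cst.
Qed.

Lemma Sm_exp (m : nat) f : Sm f -> Sm (fun z => f z ^+ m).
Proof.
move=> sf; elim: m => [|m IH].
  by under [X in Sm X]eq_fun do rewrite expr0; exact: Sm_cst.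
by under [X in Sm X]eq_fun do rewrite exprS; exact: Sm_mul.
Qed.

Lemma dbar_cst j (c : R[i]) : db j (fun=> c) = (fun=> 0).
Proof.
rewrite (dbar_dd (dd_cst _ c) (dd_cst _ c)).
by apply/funext => z; rewrite mulr0 addr0 mulr0.
Qed.

Lemma dbar_add j f g : Sm f -> Sm g ->
  db j (fun z => f z + g z) = (fun z => db j f z + db j g z).
Proof.
move=> /(dbar_ddP j)[fx [fy [_ _ dfx dfy ->]]] /(dbar_ddP j)[gx [gy [_ _ dgx dgy ->]]].
rewrite (dbar_dd (dd_add dfx dgx) (dd_add dfy dgy)).
by apply/funext => z; ring.
Qed.

Lemma dbar_mul j f g : Sm f -> Sm g ->
  db j (fun z => f z * g z) = (fun z => f z * db j g z + db j f z * g z).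
Proof.
move=> sf sg; have := Sm_locbounded sf; have := Sm_locbounded sg => bg bf.
move: sf sg => /(dbar_ddP j)[fx [fy [_ _ dfx dfy ->]]] /(dbar_ddP j)[gx [gy [_ _ dgx dgy ->]]].
rewrite (dbar_dd (dd_mul (isdir_x j) bf bg dfx dgx) (dd_mul (isdir_y j) bf bg dfy dgy)).
by apply/funext => z; ring.
Qed.

Lemma dbar_coord j : db j (fun z => z 0 j) = (fun=> 0).
Proof.
rewrite (dbar_dd (dd_coord _ j) (dd_coord _ j)); apply/funext => z.
rewrite /dir_x /dir_y !mxE !eqxx/= mulr1 (_ : 'i * 'i = -1 :> R[i]).
  by rewrite subrr mulr0.
by apply: complex_ext => /=; ring.
Qed.

Lemma dbar_conj_coord j : db j (fun z => (z 0 j)^*%C) = (fun=> 1).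
Proof.
rewrite (dbar_dd (dd_conj (dd_coord _ j)) (dd_conj (dd_coord _ j))); apply/funext => z.
rewrite /dir_x /dir_y !mxE !eqxx/= mulr1.
rewrite [X in _ * X](_ : _ = 2%:R) ?mulVf ?pnatr_eq0//.
by apply: complex_ext => /=; ring.
Qed.

Lemma dbar_expn0 j f (m : nat) z : Sm f -> db j f z = 0 -> db j (fun z => f z ^+ m) z = 0.
Proof.
move=> sf f0; elim: m => [|m IH].
  by under [X in dbar j X]eq_fun do rewrite expr0; rewrite dbar_cst.
under [X in dbar j X]eq_fun do rewrite exprS.
rewrite (dbar_mul j sf (Sm_exp m sf)).
by rewrite f0 mul0r addr0 -[X in _ * X]/(db j (fun z => f z ^+ m) z) IH mulr0.
Qed.

(** For real [f] the conjugate of a directional derivative is again a derivative of [f], so by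
    [dd_uniq] the derivative is real and the real part taken in [dd_comp] disappears. *)
Lemma dbar_comp j (G G' : R -> R) f : smoothR G -> smoothR G' ->
  (forall x : R, is_derive x 1 G (G' x)) -> Sm f -> (forall z, complex.Im (f z) = 0) ->
  db j (fun z => (G (complex.Re (f z)))%:C) =
  (fun z => (G' (complex.Re (f z)))%:C * db j f z).
Proof.
move=> sG sG' dG sf f0; have bf := Sm_locbounded sf.
have real v g : dd v f g -> forall z, (complex.Re (g z))%:C = g z.
  move=> df z; apply: complex_ext => //=.
  have df' : dd v f (fun z => (g z)^*%C).
    have := dd_conj df; congr dd; apply/funext => y.
    by apply: complex_ext; rewrite ?cre_conj// cim_conj f0 oppr0.
  have /(congr1 (fun h => complex.Im (h z))) := dd_uniq df df'.
  by rewrite cim_conj; lra.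
move: sf => /(dbar_ddP j)[fx [fy [_ _ dfx dfy ->]]].
rewrite (dbar_dd (dd_comp (isdir_x j) bf dfx sG sG' dG)
                 (dd_comp (isdir_y j) bf dfy sG sG' dG)).
apply/funext => z; rewrite !rmorphM/= (real _ _ dfx) (real _ _ dfy); ring.
Qed.

Lemma dd_lin (c d : R[i]) v f g f' g' : dd v f f' -> dd v g g' ->
  dd v (fun z => c * (f z + d * g z)) (fun z => c * (f' z + d * g' z)).
Proof.
move=> df dg r; have [B B0 HB] := df r; have [A A0 HA] := dg r.
exists (nc c * (B + nc d * A)) => [|z t rz t1].
  by rewrite mulr_ge0 ?nc_ge0// addr_ge0// mulr_ge0 ?nc_ge0.
rewrite [X in nc X](_ : _ = c * ((f (z + t%:C *: v) - f z - t%:C * f' z) +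
  d * (g (z + t%:C *: v) - g z - t%:C * g' z))); last by ring.
rewrite ncM -mulrA ler_wpM2l ?nc_ge0// mulrDl (le_trans (ncD _ _))// lerD ?HB//.
by rewrite ncM -mulrA ler_wpM2l ?nc_ge0// HA.
Qed.

Lemma cconv_lin j k c d f g : kern k -> Sm f -> Sm g ->
  cconv j k (fun z => c * (f z + d * g z)) = (fun z => c * (cconv j k f z + d * cconv j k g z)).
Proof.
move=> kk sf sg; apply/funext => z; rewrite /cconv.
have i1 := cconv_integrable j z kk (Sm_locbounded sf) (Sm_cmeas sf).
have i2 := cconv_integrable j z kk (Sm_locbounded sg) (Sm_cmeas sg).
rewrite -cintZ// -cintD//; last exact: cintegrableZ.
rewrite -cintZ//; last by apply: cintegrableD => //; exact: cintegrableZ.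
by congr cint; apply/funext => p; ring.
Qed.

Lemma dbar_cconv j j' k f : kern k -> Sm f ->
  db j (cconv j' k f) = cconv j' k (db j f).
Proof.
move=> kk sf; have bf := Sm_locbounded sf; have mf := Sm_cmeas sf.
move: sf => /(dbar_ddP j)[fx [fy [sx sy dfx dfy ->]]].
rewrite cconv_lin//.
by apply: dbar_dd; apply: cconv_dd => //; exact: Sm_cmeas.
Qed.

Definition cexp (w : R[i]) : R[i] :=
  (expR (complex.Re w))%:C * ((cos (complex.Im w))%:C + 'i * (sin (complex.Im w))%:C).

Lemma nc_cexp w : nc (cexp w) = expR (complex.Re w).
Proof.
rewrite /cexp ncM nc_real ger0_norm ?expR_ge0// [X in _ * X](_ : _ = 1) ?mulr1//.
rewrite ncE !(creD, cimD, creM, cimM)/=.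
rewrite !mul0r !mul1r !subr0 !add0r addr0 (_ : _ + _ = 1) ?sqrtr1//.
exact: cos2Dsin2.
Qed.

Lemma cexpD w w' : cexp (w + w') = cexp w * cexp w'.
Proof.
rewrite /cexp !creD !cimD expRD cosD sinD; apply: complex_ext;
  rewrite !(creD, cimD, creM, cimM)/=; ring.
Qed.

Lemma cexp0 : cexp 0 = 1.
Proof.
rewrite /cexp/= expR0 cos0 sin0.
by apply: complex_ext; rewrite !(creD, cimD, creM, cimM)/=; ring.
Qed.

Lemma cexpN w : cexp (- w) * cexp w = 1.
Proof. by rewrite -cexpD addNr cexp0. Qed.

(** [Sm_comp] and [dd_comp] only see real parts, so the imaginary part is rewritten as the real part
    of [- 'i * f]. *)
Let cexpE f : (fun z => cexp (f z)) =
  (fun z => (expR (complex.Re (f z)))%:C *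
    ((cos (complex.Re (- 'i * f z)))%:C + 'i * (sin (complex.Re (- 'i * f z)))%:C)).
Proof.
apply/funext => z; rewrite /cexp; have -> // : complex.Im (f z) = complex.Re (- 'i * f z).
by rewrite creM/=; ring.
Qed.

Lemma Sm_cexp f : Sm f -> Sm (fun z => cexp (f z)).
Proof.
move=> sf; rewrite cexpE.
have sif : Sm (fun z => - 'i * f z) by apply: Sm_mul => //; exact: Sm_cst.
apply: Sm_mul; first by apply: Sm_comp => //; exact: smoothR_exp.
apply: Sm_add; first by apply: Sm_comp => //; exact: smoothR_cos.
by apply: Sm_mul; [exact: Sm_cst|apply: Sm_comp => //; exact: smoothR_sin].
Qed.

Lemma dd_cexp v f g : isdir v -> Sm f -> dd v f g ->
  dd v (fun z => cexp (f z)) (fun z => cexp (f z) * g z).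
Proof.
move=> dv sf df; rewrite cexpE; have bf := Sm_locbounded sf.
(* A zero second summand turns [dd_lin] into the rule for a constant factor. *)
have ci : (fun z => - 'i * f z) = (fun z => - 'i * (f z + 0 * 0)).
  by apply/funext => z; rewrite mul0r addr0.
have sif : Sm (fun z => - 'i * f z) by apply: Sm_mul => //; exact: Sm_cst.
have dif : dd v (fun z => - 'i * f z) (fun z => - 'i * (g z + 0 * 0)).
  by rewrite ci; apply: dd_lin => //; exact: (dd_cst v 0).
have bif := Sm_locbounded sif.
have sN : smoothR (fun x : R => -1 * sin x).
  by apply: smoothR_mul; [exact: smoothR_cst|exact: smoothR_sin].
have dN (x : R) : is_derive x 1 cos (-1 * sin x).
  by apply: is_derive_eq (is_derive_cos x) _; rewrite mulN1r.
have d1 := dd_comp dv bf df (smoothR_exp R) (smoothR_exp R) (@is_derive_expR R).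
have d2 := dd_comp dv bif dif (smoothR_cos R) sN dN.
have d3 := dd_comp dv bif dif (smoothR_sin R) (smoothR_cos R) (@is_derive_sin R).
have s1 : Sm (fun z => (expR (complex.Re (f z)))%:C) by apply: Sm_comp => //; exact: smoothR_exp.
have s2 : Sm (fun z => (cos (complex.Re (- 'i * f z)))%:C) by apply: Sm_comp => //; exact: smoothR_cos.
have s3 : Sm (fun z => (sin (complex.Re (- 'i * f z)))%:C) by apply: Sm_comp => //; exact: smoothR_sin.
have d4 := dd_lin 1 'i d2 d3.
have s4 := Sm_lin 1 'i s2 s3.
have := dd_mul dv (Sm_locbounded s1) (Sm_locbounded s4) d1 d4.
congr dd; apply/funext => z; first by rewrite mul1r.
rewrite -[X in _ = X * _]/((fun z => cexp (f z)) z) cexpE.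
move: (expR _) (cos _) (sin _) (g z) => a b c e.
by apply: complex_ext; rewrite !(creD, cimD, creM, cimM)/=; ring.
Qed.

Lemma dbar_cexp j f : Sm f -> db j (fun z => cexp (f z)) = (fun z => cexp (f z) * db j f z).
Proof.
move=> sf; have := sf => /(dbar_ddP j)[fx [fy [sx sy dfx dfy ->]]].
rewrite (dbar_dd (dd_cexp (isdir_x j) sf dfx) (dd_cexp (isdir_y j) sf dfy)).
by apply/funext => z; ring.
Qed.

End dbar_rules.

(** * The Cauchy-Pompeiu formula *)

(** The common device for letting an error term tend to 0. *)
Lemma le0_small (R : realFieldType) (x B : R) : 0 <= B ->
  (forall t, 0 < t -> t <= 1 -> x <= B * t) -> x <= 0.
Proof.
move=> B0 H; apply/ler_addgt0Pl => e e0; rewrite addr0.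
have BB : 0 < B + 1 by rewrite ltr_wpDl.
pose t : R := Num.min 1 (e / (B + 1)).
have t0 : 0 < t by rewrite lt_min ltr01 divr_gt0.
have t1 : t <= 1 by rewrite ge_min lexx.
have : t <= e / (B + 1) by rewrite ge_min lexx orbT.
rewrite ler_pdivlMr// => h; apply: le_trans (H t t0 t1) _; apply: le_trans h.
by rewrite mulrC ler_wpM2l ?lerDl// ltW.
Qed.

Lemma rintegrable_indic d (T : measurableType d) (R : realType)
    (mu : {measure set T -> \bar R}) (A : set T) :
  measurable A -> (mu A < +oo)%E -> rintegrable mu (fun x => \1_A x).
Proof.
move=> mA Afin; apply/integrableP; split; first exact/measurable_EFinP.
rewrite (eq_integral (fun x => (\1_A x)%:E)); last first.
  by move=> t _; rewrite gee0_abs// lee_fin.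
by rewrite integral_indic// setIT.
Qed.

Lemma Rintegral_indic d (T : measurableType d) (R : realType)
    (mu : {measure set T -> \bar R}) (A : set T) :
  measurable A -> Rintegral mu setT (fun x => \1_A x) = fine (mu A).
Proof. by move=> mA; rewrite /Rintegral integral_indic// setIT. Qed.

Section plane_integrals.
Variables (R : realType) (n : nat).
Local Notation E := (Cn R n).
Implicit Types (z v : E) (f g : E -> R[i]) (r t : R) (j : 'I_n).
Local Notation db j f := (dbar j (f : E -> R[i]^o) : E -> R[i]).
Local Notation "\int2 h" := (Rintegral (@lam2 R) setT h) (at level 50).

Lemma disc_integrable L (c : R) : rintegrable (@lam2 R) (fun p => c * \1_(disc L) p).
Proof.
apply: rintegrableZ; apply: rintegrable_indic; first exact: measurable_disc.
exact: lam2_disc_fin.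
Qed.

Lemma supp_integrable (F : plane R -> R[i]) B L : cmeas F ->
  (forall p, nc (pt p) < L -> nc (F p) <= B) ->
  (forall p, L <= nc (pt p) -> F p = 0) ->
  cintegrable (@lam2 R) F.
Proof.
move=> mF FB F0; apply: cintegrable_le mF (disc_integrable L B) _ => p.
rewrite indicE; have [pL|pL] := ltP (nc (pt p)) L.
  by rewrite mem_set// mulr1; exact: FB.
by rewrite F0// nc0 memNset ?mulr0//= => /lt_geF; rewrite /disc/= pL.
Qed.

Lemma Sm_supp_integrable j f z L : Sm f ->
  (forall p, L <= nc (pt p) -> f (slide j z p) = 0) ->
  cintegrable (@lam2 R) (fun p => f (slide j z p)).
Proof.
move=> sf f0; have [r r0 rz] := cbnd_ex z.
have [B B0 HB] := Sm_locbounded sf (r + L).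
apply: (@supp_integrable _ B L) => //.
  by apply: cmeas_slide; exact: Sm_cmeas.
by move=> p pL; apply: HB; apply: cbnd_slide => //; exact: ltW.
Qed.

Lemma dd_vanish v f g z : dd v f g -> (forall t, 0 <= t -> t <= 1 -> f (z + t%:C *: v) = 0) ->
  g z = 0.
Proof.
move=> df f0; have [r r0 rz] := cbnd_ex z; have [B B0 HB] := df r.
have fz : f z = 0 by have := f0 0 (lexx _) ler01; rewrite rmorph0 scale0r addr0.
apply/eqP; rewrite -nc_eq0 eq_le nc_ge0 andbT; apply: (le0_small B0) => t t0 t1.
have := HB z t rz; rewrite gtr0_norm// => /(_ t1).
rewrite (f0 t (ltW t0) t1) fz subrr sub0r ncN ncM nc_real gtr0_norm//.
by rewrite expr2 mulrCA ler_pM2l.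
Qed.

(* Translation invariance makes the integral of a difference quotient vanish. *)
Lemma cint_quotient0 (F G : plane R -> R[i]) (a : R -> plane R) B L : 0 <= B ->
  cintegrable (@lam2 R) F -> cintegrable (@lam2 R) G ->
  (forall t p, 0 < t -> t <= 1 ->
    nc (F (shift2 (a t) p) - F p - t%:C * G p) <= (B * t ^+ 2) * \1_(disc L) p) ->
  cint (@lam2 R) G = 0.
Proof.
move=> B0 IF IG H.
pose D := fine (@lam2 R (disc L)).
have D0 : 0 <= D by rewrite fine_ge0.
apply/eqP; rewrite -nc_eq0 eq_le nc_ge0 andbT.
apply: (@le0_small _ _ (B * D)); first exact: mulr_ge0.
move=> t t0 t1.
have [Is es] := cint_shift (a t) IF.
have ItG := cintegrableZ t%:C IG.
have I1 := cintegrableB Is IF.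
rewrite -(ler_pM2l t0).
have -> : t * nc (cint (@lam2 R) G) = nc (cint (@lam2 R) (fun p => t%:C * G p)).
  by rewrite (cintZ t%:C IG) ncM nc_real gtr0_norm.
have := cintB I1 ItG; rewrite (cintB Is IF) es subrr sub0r => e0.
rewrite -ncN -e0.
have -> : t * (B * D * t) = Rintegral (@lam2 R) setT (fun p => (B * t ^+ 2) * \1_(disc L) p).
  rewrite RintegralZl//; last exact: rintegrable_indic (measurable_disc _) (lam2_disc_fin _).
  by rewrite Rintegral_indic; [rewrite -/D; ring|exact: measurable_disc].
apply: nc_cint_le; [exact: cintegrableB|exact: disc_integrable|] => p.
exact: H.
Qed.

(** A step in the direction [pt a *: dir_x R j] is a translation in the plane of the [j]-th
    variable, so [cint_quotient0] applies. The radius [L + 1] contains the supports of all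
    translates with |t| <= 1. *)
Lemma int_dd0 j (a : plane R) f g z L : nc (pt a) <= 1 -> Sm f -> Sm g ->
  isdir (pt a *: dir_x R j) -> dd (pt a *: dir_x R j) f g ->
  (forall p, L <= nc (pt p) -> f (slide j z p) = 0) ->
  cint (@lam2 R) (fun p => g (slide j z p)) = 0.
Proof.
move=> a1 sf sg dv df f0; have L1 : L <= L + 1 by rewrite lerDl.
pose ta t : plane R := (t * a.1, t * a.2).
have pta t : pt (ta t) = t%:C * pt a.
  by apply: complex_ext; rewrite /= ?(creM, cimM)/=; ring.
have shiftE p t : slide j z p + t%:C *: (pt a *: dir_x R j) = slide j z (shift2 (ta t) p).
  by rewrite /slide pt_shift2 scalerDl addrA pta scalerA.
have far p t : L + 1 <= nc (pt p) -> `|t| <= 1 -> L <= nc (pt (shift2 (ta t) p)).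
  move=> pL t1; rewrite pt_shift2 pta.
  have h : nc (t%:C * pt a) <= 1 by rewrite ncM nc_real mulr_ile1 ?nc_ge0.
  have := ncB (pt p + t%:C * pt a) (t%:C * pt a); rewrite addrK; lra.
have g0 p : L + 1 <= nc (pt p) -> g (slide j z p) = 0.
  move=> pL; apply: (dd_vanish df) => t t0 t1; rewrite shiftE; apply: f0.
  by apply: far => //; rewrite ger0_norm.
have Ig : cintegrable (@lam2 R) (fun p => g (slide j z p)) by exact: Sm_supp_integrable g0.
have If : cintegrable (@lam2 R) (fun p => f (slide j z p)) by exact: Sm_supp_integrable f0.
have [r r0 rz] := cbnd_ex z; have [B B0 HB] := df (r + (L + 1)).
apply: (cint_quotient0 (a := ta) (L := L + 1) B0 If Ig) => t p t0 t1.
have t1' : `|t| <= 1 by rewrite gtr0_norm.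
rewrite indicE; have [pL|pL] := ltP (nc (pt p)) (L + 1).
  rewrite mem_set// mulr1 -shiftE; apply: HB => //.
  by apply: cbnd_slide => //; exact: ltW.
rewrite memNset ?mulr0; last by rewrite /disc/= => /lt_geF; rewrite pL.
have e := congr2 (fun x y => x - t%:C * y)
  (congr2 (fun x y => x - y) (f0 _ (far _ _ pL t1')) (f0 _ (le_trans L1 pL))) (g0 _ pL).
by rewrite [X in X <= _](congr1 (fun w => nc w) e) mulr0 !subr0 nc0.
Qed.

(** Stokes' formula without boundary term: [int_dd0] in the directions 1 and i. *)
Lemma int_dbar0 j f z L : Sm f -> (forall p, L <= nc (pt p) -> f (slide j z p) = 0) ->
  cint (@lam2 R) (fun p => db j f (slide j z p)) = 0.
Proof.
move=> sf f0; have [gx [gy [sx sy dfx dfy ->]]] := dbar_ddP j sf.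
have f0' p : L + 1 <= nc (pt p) -> f (slide j z p) = 0.
  by move=> pL; apply: f0; apply: le_trans pL; rewrite lerDl.
pose ax : plane R := (1, 0); pose ay : plane R := (0, 1).
have nx : pt ax = 1 by apply: complex_ext.
have ny : pt ay = 'i by apply: complex_ext.
have ex : pt ax *: dir_x R j = dir_x R j by rewrite nx scale1r.
have ey : pt ay *: dir_x R j = dir_y R j by rewrite ny.
have nx1 : nc (pt ax) <= 1 by rewrite nx nc1.
have ny1 : nc (pt ay) <= 1 by rewrite ny nc_i.
have ix : cint (@lam2 R) (fun p => gx (slide j z p)) = 0.
  apply: (int_dd0 nx1 sf sx _ _ f0); first by rewrite ex; exact: isdir_x.
  by rewrite ex.
have iy : cint (@lam2 R) (fun p => gy (slide j z p)) = 0.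
  apply: (int_dd0 ny1 sf sy _ _ f0); first by rewrite ey; exact: isdir_y.
  by rewrite ey.
have far p a t : L + 1 <= nc (pt p) -> nc (pt a) <= 1 -> 0 <= t -> t <= 1 ->
    f (slide j z p + t%:C *: (pt a *: dir_x R j)) = 0.
  move=> pL a1 t0 t1.
  have -> : slide j z p + t%:C *: (pt a *: dir_x R j) =
      slide j z (shift2 (t * a.1, t * a.2) p).
    rewrite /slide pt_shift2 scalerDl addrA scalerA; congr (_ + _ *: _).
    by apply: complex_ext; rewrite ?(creM, cimM)/=; ring.
  apply: f0; rewrite pt_shift2.
  have h : nc (pt (t * a.1, t * a.2)) <= 1.
    rewrite (_ : pt _ = t%:C * pt a); last by apply: complex_ext; rewrite ?(creM, cimM)/=; ring.
    by rewrite ncM nc_real mulr_ile1 ?nc_ge0// ger0_norm.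
  have := ncB (pt p + pt (t * a.1, t * a.2)) (pt (t * a.1, t * a.2)); rewrite addrK; lra.
have gx0 p : L + 1 <= nc (pt p) -> gx (slide j z p) = 0.
  move=> pL; apply: (dd_vanish dfx) => t t0 t1.
  by have := far p ax t pL nx1 t0 t1; rewrite ex.
have gy0 p : L + 1 <= nc (pt p) -> gy (slide j z p) = 0.
  move=> pL; apply: (dd_vanish dfy) => t t0 t1.
  by have := far p ay t pL ny1 t0 t1; rewrite ey.
have Ix := Sm_supp_integrable sx gx0; have Iy := Sm_supp_integrable sy gy0.
move: ix iy Ix Iy.
set Fx := fun p => gx (slide j z p); set Fy := fun p => gy (slide j z p).
rewrite -[X in _ -> _ -> _ -> _ -> X]/(cint _ (fun p => 2^-1 * (Fx p + 'i * Fy p)) = 0).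
move: Fx Fy => Fx Fy ix iy Ix Iy; have Iy' := cintegrableZ 'i Iy.
rewrite (cintZ _ (cintegrableD Ix Iy')) (cintD Ix Iy') (cintZ _ Iy) ix iy.
by rewrite mulr0 addr0 mulr0.
Qed.

End plane_integrals.

Section scaled_step.
Variable R : realType.
Implicit Types (a d s : R).

Definition stp a d s : R := step ((s - a) / d).
Definition dstp a d s : R := dstep ((s - a) / d) / d.

Lemma smoothR_affine (c e : R) : smoothR (fun s => c * s + e).
Proof.
apply: smoothR_add; last exact: smoothR_cst.
by apply: smoothR_mul; [exact: smoothR_cst|exact: smoothR_id].
Qed.

Let affE a d : (fun s : R => (s - a) / d) = (fun s => d^-1 * s + (- a / d)).
Proof. by apply/funext => s; rewrite mulrBl mulNr mulrC. Qed.

Lemma smoothR_stp a d : smoothR (stp a d).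
Proof.
by apply: (smoothR_comp (smoothR_step R) (g := fun s => (s - a) / d)); rewrite affE; exact: smoothR_affine.
Qed.

Lemma smoothR_dstp a d : smoothR (dstp a d).
Proof.
apply: smoothR_mul; last exact: smoothR_cst.
by apply: (smoothR_comp (smoothR_dstep R) (g := fun s => (s - a) / d)); rewrite affE; exact: smoothR_affine.
Qed.

Lemma is_derive_affine (c e s : R) : is_derive s 1 (fun s : R => c * s + e) c.
Proof.
have d1 : is_derive s 1 (fun s : R => c * s) c.
  by apply: is_derive_eq (is_deriveZ c (is_derive_id (s : R^o) 1)) _; exact: mulr1.
by apply: is_derive_eq (is_deriveD d1 (is_derive_cst (e : R^o) (s : R^o) 1)) _; rewrite addr0.
Qed.

Lemma is_derive_stp a d s : is_derive s 1 (stp a d) (dstp a d s).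
Proof.
apply: (@is_derive1_comp _ (@step R) (fun s => (s - a) / d)).
  exact: is_derive_step.
by rewrite affE; exact: is_derive_affine.
Qed.

Lemma stp_le a d s : 0 < d -> s <= a -> stp a d s = 0.
Proof. by move=> d0 sa; rewrite /stp step_le0// pmulr_lle0 ?invr_gt0// subr_le0. Qed.

Lemma stp_ge a d s : 0 < d -> a + d <= s -> stp a d s = 1.
Proof. by move=> d0 sa; rewrite /stp step_ge1// ler_pdivlMr// mul1r; lra. Qed.

Lemma stp_ge0 a d s : 0 <= stp a d s. Proof. exact: step_ge0. Qed.
Lemma stp_le1 a d s : stp a d s <= 1. Proof. exact: step_le1. Qed.

Lemma dstp_ge0 a d s : 0 < d -> 0 <= dstp a d s.
Proof. by move=> d0; rewrite mulr_ge0 ?dstep_ge0// invr_ge0 ltW. Qed.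

Lemma dstp_out a d s : 0 < d -> (s <= a) || (a + d <= s) -> dstp a d s = 0.
Proof.
move=> d0 H; rewrite /dstp dstep_out ?mul0r//.
by rewrite pmulr_lle0 ?invr_gt0// subr_le0 ler_pdivlMr// mul1r lerBrDl.
Qed.

End scaled_step.

Section radial.
Variables (R : realType) (n : nat) (j : 'I_n).
Local Notation E := (Cn R n).
Local Notation db f := (dbar j (f : E -> R[i]^o) : E -> R[i]).
Implicit Types (a : R[i]) (z : E).

Definition rad a z : R[i] := (z 0 j - a) * (z 0 j - a)^*%C.

Lemma rad_nc a z : rad a z = (nc (z 0 j - a) ^+ 2)%:C.
Proof. exact: conj_nc. Qed.

Lemma Sm_coordB a : Sm (fun z => z 0 j - a).
Proof. by apply: Sm_add; [exact: Sm_coord|exact: Sm_cst]. Qed.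

Lemma Sm_rad a : Sm (rad a).
Proof. by apply: Sm_mul; [|apply: Sm_conj]; exact: Sm_coordB. Qed.

(** Radial functions are taken as functions of the squared modulus, which is a polynomial in the
    coordinate and its conjugate and hence smooth at the centre as well. *)
Lemma Sm_radial a p : smoothR p -> Sm (fun z => (p (nc (z 0 j - a) ^+ 2))%:C).
Proof.
move=> sp; have -> : (fun z => (p (nc (z 0 j - a) ^+ 2))%:C) =
    (fun z => (p (complex.Re (rad a z)))%:C).
  by apply/funext => z; rewrite rad_nc.
by apply: Sm_comp => //; exact: Sm_rad.
Qed.

Lemma dbar_coordB a : db (fun z => z 0 j - a) = (fun=> 0).
Proof.
rewrite (dbar_add j (Sm_coord _ j) (Sm_cst _ (- a))).
by apply/funext => z; rewrite dbar_coord dbar_cst addr0.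
Qed.

Lemma dbar_conj_coordB a : db (fun z => (z 0 j - a)^*%C) = (fun=> 1).
Proof.
have -> : (fun z : E => (z 0 j - a)^*%C) = (fun z => (z 0 j)^*%C + (- a)^*%C).
  by apply/funext => z; rewrite rmorphD.
rewrite (dbar_add j (Sm_conj (Sm_coord _ j)) (Sm_cst _ _)).
by apply/funext => z; rewrite dbar_conj_coord dbar_cst addr0.
Qed.

Lemma dbar_rad a : db (rad a) = (fun z => z 0 j - a).
Proof.
rewrite (dbar_mul j (Sm_coordB a) (Sm_conj (Sm_coordB a))).
by apply/funext => z; rewrite dbar_conj_coordB dbar_coordB mulr1 mul0r addr0.
Qed.

Lemma dbar_radial a (G G' : R -> R) : smoothR G -> smoothR G' ->
  (forall x : R, is_derive x 1 G (G' x)) ->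
  db (fun z => (G (nc (z 0 j - a) ^+ 2))%:C) =
  (fun z => (G' (nc (z 0 j - a) ^+ 2))%:C * (z 0 j - a)).
Proof.
move=> sG sG' dG.
have -> : (fun z => (G (nc (z 0 j - a) ^+ 2))%:C) =
    (fun z => (G (complex.Re (rad a z)))%:C).
  by apply/funext => z; rewrite rad_nc.
rewrite (dbar_comp j sG sG' dG (Sm_rad a)); last by move=> z; rewrite rad_nc.
by apply/funext => z; rewrite dbar_rad rad_nc.
Qed.

(* [conj zeta * p (|zeta|^2)] is [P (|zeta|^2) / zeta]. *)
Lemma dbar_conj_radial a (p P P' : R -> R) : smoothR p -> 
  (forall s, s * p s = P s) -> (forall s : R, is_derive s 1 P (P' s)) ->
  db (fun z => (z 0 j - a)^*%C * (p (nc (z 0 j - a) ^+ 2))%:C) =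
  (fun z => (P' (nc (z 0 j - a) ^+ 2))%:C).
Proof.
move=> sp pP dP; have [p' sp' dp] := smoothR_derive sp.
have P'E s : P' s = s * p' s + p s.
  have PE : P = (fun s => s * p s) by apply/funext => s0; rewrite pP.
  have d1 : is_derive s 1 P (s * p' s + p s).
    rewrite PE; apply: is_derive_eq (is_deriveM (is_derive_id (s : R^o) 1) (dp s)) _.
    by congr (_ + _); exact: mulr1.
  by case: d1 => _ <-; case: (dP s) => _ <-.
rewrite (dbar_mul j (Sm_conj (Sm_coordB a)) (Sm_radial a sp)).
apply/funext => z; rewrite (dbar_radial a sp sp' dp) dbar_conj_coordB mul1r P'E.
have := conj_nc (z 0 j - a); move: (z 0 j - a) => w hw.
by rewrite rmorphD rmorphM/= -hw; ring.
Qed.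

End radial.

Lemma measurable_invr (R : realType) : measurable_fun setT (fun x : R => x^-1).
Proof.
have -> : [set: R] = [set 0] `|` ~` [set 0] by rewrite setUv.
have m0 : measurable [set (0 : R)] by exact: measurable_set1.
apply/(measurable_funU _ m0); first exact: measurableC.
split; first exact: measurable_fun_set1.
apply: open_continuous_measurable_fun.
  by rewrite openC; exact: closed_eq.
by move=> x; rewrite inE/= => /eqP x0; exact: inv_continuous.
Qed.

(** * Integrals of radial functions *)

Section radial_integrals.
Variable R : realType.
Local Notation "\int2 h" := (Rintegral (@lam2 R) setT h) (at level 50).
Local Notation E1 := (Cn R 1).
Implicit Types (L a d s : R) (p : plane R).

Let slide0 p : slide ord0 (0 : E1) p 0 0 = pt p.
Proof. by rewrite slideE mxE eqxx add0r. Qed.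

Lemma nc_sqr_ge (x L : R) : 0 <= L -> 0 <= x -> (L ^+ 2 <= x ^+ 2) = (L <= x).
Proof. by move=> L0 x0; rewrite ler_sqr ?nnegrE. Qed.

Lemma radial_integrable (q : R -> R) B L : smoothR q -> 0 <= L ->
  (forall s, L ^+ 2 <= s -> q s = 0) -> (forall s, 0 <= s -> `|q s| <= B) ->
  rintegrable (@lam2 R) (fun p => q (nc (pt p) ^+ 2)).
Proof.
move=> sq L0 q0 qB.
have : cintegrable (@lam2 R) (fun p => (q (nc (pt p) ^+ 2))%:C).
  apply: (@supp_integrable _ _ B L).
  - apply: cmeas_real; apply: measurableT_comp.
      by apply: continuous_measurable_fun; exact: smoothR_continuous.
    by apply: measurable_funX; apply: measurable_nc; exact: cmeas_pt.
  - by move=> p _; rewrite nc_real; apply: qB; exact: sqr_ge0.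
  - by move=> p pL; rewrite q0// nc_sqr_ge// nc_ge0.
by case.
Qed.

(** By [dbar_conj_radial] the integrand is the d-bar derivative of a compactly supported function.
    This replaces polar coordinates, in which the integral is pi times that of P' over the
    half-line, with P zero at both ends. *)
Lemma radial_int0 (p P P' : R -> R) L : 0 <= L -> smoothR p ->
  (forall s, s * p s = P s) -> (forall s : R, is_derive s 1 P (P' s)) ->
  (forall s, L ^+ 2 <= s -> p s = 0) ->
  \int2 (fun x => P' (nc (pt x) ^+ 2)) = 0.
Proof.
move=> L0 sp pP dP p0.
pose f (z : E1) : R[i] := (z 0 0 - 0)^*%C * (p (nc (z 0 0 - 0) ^+ 2))%:C.
have sf : Sm f.
  by apply: Sm_mul; [apply: Sm_conj; exact: Sm_coordB|exact: Sm_radial].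
have f0 x : L <= nc (pt x) -> f (slide 0 (0 : E1) x) = 0.
  by move=> xL; rewrite /f slide0 subr0 p0 ?mulr0// nc_sqr_ge// nc_ge0.
have := int_dbar0 sf f0; rewrite (dbar_conj_radial _ _ sp pP dP).
rewrite -[RHS]/((0 : R)%:C) (_ : (fun x => _) = (fun x => (P' (nc (pt x) ^+ 2))%:C)).
  by rewrite cint_real => -[].
by apply/funext => x; rewrite slide0 subr0.
Qed.

(** In polar coordinates this is seen to be pi. What enters below is that every radial step gives
    the same value ([int_dstp]) and that it is positive ([omega_gt0]). *)
Definition omega : R := \int2 (fun x => dstp 1 1 (nc (pt x) ^+ 2)).

Lemma dstp_bound a d : 0 < a -> 0 < d ->
  exists B, forall s, 0 <= s -> `|dstp a d s| <= B.
Proof.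
move=> a0 d0; have [B B0 HB] := smoothR_bounded 0 (a + d) (smoothR_dstp a d).
exists B => s s0; have [sa|sa] := leP s (a + d); first by apply: HB; rewrite s0.
by rewrite dstp_out ?normr0// (ltW sa) orbT.
Qed.

Lemma dstp_integrable a d : 0 < a -> 0 < d ->
  rintegrable (@lam2 R) (fun x => dstp a d (nc (pt x) ^+ 2)).
Proof.
move=> a0 d0; have [B HB] := dstp_bound a0 d0.
apply: (@radial_integrable _ B (Num.sqrt (a + d))) => //; first exact: smoothR_dstp.
move=> s; rewrite sqr_sqrtr; last by rewrite addr_ge0 ?ltW.
by move=> H; rewrite dstp_out// H orbT.
Qed.

(** The difference of two steps vanishes for [s <= m] and for large [s], so it is [s * p s] with [p]
    smooth and zero for large [s], and [radial_int0] applies to it. *)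
Lemma int_dstp a d : 0 < a -> 0 < d ->
  \int2 (fun x => dstp a d (nc (pt x) ^+ 2)) = omega.
Proof.
move=> a0 d0; pose m := Num.min a 1.
have m0 : 0 < m by rewrite lt_min a0 ltr01.
pose p s := (stp a d s + -1 * stp 1 1 s) * (clamp m s)^-1.
have sp : smoothR p.
  apply: smoothR_mul; last by apply: smoothR_inv; [exact: smoothR_clamp|move=> s; exact: clamp_gt0].
  apply: smoothR_add; first exact: smoothR_stp.
  by apply: smoothR_mul; [exact: smoothR_cst|exact: smoothR_stp].
have m1 : m <= 1 by rewrite ge_min lexx orbT.
have ma : m <= a by rewrite ge_min lexx.
have H : \int2 (fun x => dstp a d (nc (pt x) ^+ 2) - dstp 1 1 (nc (pt x) ^+ 2)) = 0.
  apply: (@radial_int0 p (fun s => stp a d s - stp 1 1 s)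
    (fun s => dstp a d s - dstp 1 1 s) (Num.sqrt (a + d + 2))) => //.
  - move=> s; rewrite /p mulN1r; have [ms|sm] := leP m s.
      by rewrite clamp_id// mulrC divfK// gt_eqF// (lt_le_trans m0 ms).
    have sa : s <= a by rewrite ltW// (lt_le_trans sm).
    have s1 : s <= 1 by rewrite ltW// (lt_le_trans sm).
    by rewrite !stp_le// subrr mul0r mulr0.
  - by move=> s; apply: is_deriveB; exact: is_derive_stp.
  - move=> s; rewrite sqr_sqrtr; last by rewrite !addr_ge0 ?ltW.
    move=> H; rewrite /p !stp_ge//; [|lra|lra].
    by rewrite mulN1r subrr mul0r.
move: H; rewrite RintegralB//; [|exact: dstp_integrable|exact: dstp_integrable].
by move/eqP; rewrite subr_eq0 => /eqP.
Qed.

(* The mass 1/|zeta| puts on a disc is computed by applying [radial_int0] to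
   P = (1 - stp) sqrt, cut off near 0. *)
Lemma int_inv_annulus L e : 0 < e -> 2 * e <= L ^+ 2 -> 0 < L ->
  \int2 (fun x => \1_[set x | 2 * e <= nc (pt x) ^+ 2 /\ nc (pt x) <= L] x / nc (pt x))
  <= 2 * L * omega.
Proof.
move=> e0 eL L0.
pose A := [set x : plane R | 2 * e <= nc (pt x) ^+ 2 /\ nc (pt x) <= L].
have L20 : 0 < L ^+ 2 by rewrite exprn_gt0.
pose k s := Num.sqrt (clamp e s).
have sk : smoothR k.
  by apply: smoothR_sqrt; [exact: smoothR_clamp|move=> s; exact: clamp_gt0].
have [k' sk' dk] := smoothR_derive sk.
have k0 s : 0 < k s by rewrite sqrtr_gt0 clamp_gt0.
have k'E s : e < s -> k' s = (2 * Num.sqrt s)^-1.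
  move=> es; have s0 : 0 < s := lt_trans e0 es.
  have d1 : is_derive s 1 k (2 * Num.sqrt s)^-1.
    apply: (@near_eq_is_derive _ _ _ Num.sqrt); last exact: is_derive1_sqrt.
    near=> y; rewrite /k clamp_id//; apply/ltW; near: y; exact: lt_nbhsr.
  by case: (dk s) => _ <-; case: d1 => _ <-.
(* A square root switched on smoothly between [e] and [2 * e]; beyond that, [h'] at |zeta|^2 is 1 /
   (2 |zeta|), half of the integrand. *)
pose h s := stp e e s * k s.
pose h' s := stp e e s * k' s + dstp e e s * k s.
have sh : smoothR h by apply: smoothR_mul => //; exact: smoothR_stp.
have dh s : is_derive s 1 h (h' s).
  apply: is_derive_eq (is_deriveM (is_derive_stp e e s) (dk s)) _.
  by rewrite /h'; congr (_ + _); rewrite mulrC.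
have h'0 s : 0 <= h' s.
  have [se|es] := leP s e.
    by rewrite /h' stp_le// mul0r add0r mulr_ge0 ?dstp_ge0 ?ltW.
  rewrite /h' k'E//; apply: addr_ge0; apply: mulr_ge0.
  - exact: stp_ge0.
  - by rewrite invr_ge0 mulr_ge0// sqrtr_ge0.
  - exact: dstp_ge0.
  - exact/ltW/k0.
have o0 : 0 <= omega.
  by apply: Rintegral_ge0 => x _; exact: dstp_ge0.
have mA : measurable A.
  have -> : A = (fun x : plane R => nc (pt x) ^+ 2) @^-1` `[2 * e, +oo[ `&`
      (fun x : plane R => nc (pt x)) @^-1` `]-oo, L].
    by apply/seteqP; split => x /=; rewrite !in_itv/= ?andbT.
  apply: measurableI; rewrite -[X in measurable X]setTI.
    by apply: measurable_funX => //; apply: measurable_nc; exact: cmeas_pt.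
  by apply: (measurable_nc (@cmeas_pt R)) => //; exact: measurable_itv.
have mF : measurable_fun setT (fun x : plane R => \1_A x / nc (pt x)).
  apply: measurable_funM => //; apply: (measurableT_comp (@measurable_invr R)).
  by apply: measurable_nc; exact: cmeas_pt.
(* [d] is the width of the outer transition; it can be sent to 0 because sqrt (L^2 + d) <= L + d /
   L. *)
suff key d : 0 < d -> \int2 (fun x => \1_A x / nc (pt x)) <= 2 * Num.sqrt (L ^+ 2 + d) * omega.
  rewrite -subr_le0; apply: (@le0_small _ _ (2 * omega / L)).
    by rewrite divr_ge0 ?mulr_ge0// ltW.
  move=> t t0 t1; rewrite lerBlDr; apply: le_trans (key t t0) _.
  have : Num.sqrt (L ^+ 2 + t) <= L + t / L.
    rewrite -[leRHS]ger0_norm; last by rewrite addr_ge0 ?divr_ge0 ?ltW.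
    rewrite -sqrtr_sqr ler_wsqrtr// sqrrD [X in _ <= _ + X + _](_ : _ = 2 * t); last first.
      by rewrite mulrCA divff ?gt_eqF// mulr1 mulr_natl.
    by rewrite -addrA lerD2l; have := sqr_ge0 (t / L); lra.
  move=> /(ler_wpM2l (mulr_ge0 (ler0n R 2) o0)).
  rewrite mulrDr mulrA => H.
  rewrite (_ : 2 * Num.sqrt (L ^+ 2 + t) * omega = 2 * omega * Num.sqrt (L ^+ 2 + t)); last by ring.
  by apply: le_trans H _; rewrite addrC -!mulrA [omega * L]mulrC [_^-1 * t]mulrC.
move=> d0.
pose X s := 1 + -1 * stp (L ^+ 2) d s.
have sX : smoothR X.
  apply: smoothR_add; first exact: smoothR_cst.
  by apply: smoothR_mul; [exact: smoothR_cst|exact: smoothR_stp].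
have dX s : is_derive s 1 X (- dstp (L ^+ 2) d s).
  apply: is_derive_eq (is_deriveD (is_derive_cst (1 : R^o) (s : R^o) 1)
    (is_deriveZ (-1) (is_derive_stp (L ^+ 2) d s))) _.
  by rewrite add0r -[LHS]/(-1 * _) mulN1r.
have X0 s : 0 <= X s by rewrite /X mulN1r subr_ge0 stp_le1.
have Lout s : Num.sqrt (L ^+ 2 + d) ^+ 2 <= s -> X s = 0.
  rewrite (sqr_sqrtr (addr_ge0 (ltW L20) (ltW d0))) => Hs.
  by rewrite /X stp_ge// mulN1r subrr.
have Ld0 : 0 <= Num.sqrt (L ^+ 2 + d) by exact: sqrtr_ge0.
have sXh' : smoothR (fun s => X s * h' s).
  apply: smoothR_mul => //; apply: smoothR_add; apply: smoothR_mul => //.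
    exact: smoothR_stp.
  exact: smoothR_dstp.
have sdh : smoothR (fun s => dstp (L ^+ 2) d s * h s).
  by apply: smoothR_mul => //; exact: smoothR_dstp.
have bnd q : smoothR q -> (forall s, Num.sqrt (L ^+ 2 + d) ^+ 2 <= s -> q s = 0) ->
    rintegrable (@lam2 R) (fun x => q (nc (pt x) ^+ 2)).
  move=> sq q0; have [B B0 HB] := smoothR_bounded 0 (Num.sqrt (L ^+ 2 + d) ^+ 2) sq.
  apply: (radial_integrable sq Ld0 q0 (B := B)) => s s0.
  have [sL|sL] := leP s (Num.sqrt (L ^+ 2 + d) ^+ 2); first by apply: HB; rewrite s0.
  by rewrite q0 ?normr0// ltW.
have I1 := bnd _ sXh' (fun s Hs => etrans (congr1 (fun w => w * h' s) (Lout s Hs)) (mul0r _)).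
have I2 : rintegrable (@lam2 R) (fun x => dstp (L ^+ 2) d (nc (pt x) ^+ 2) * h (nc (pt x) ^+ 2)).
  apply: (bnd (fun s => dstp (L ^+ 2) d s * h s)) => // s Hs; rewrite dstp_out ?mul0r//.
  by rewrite -(sqr_sqrtr (addr_ge0 (ltW L20) (ltW d0))) Hs orbT.
(* Integration by parts for [X * h], which vanishes near 0 and beyond [L ^+ 2 + d]. It is [s] times
   a smooth function because [k s ^+ 2 = s] where the step does not vanish. *)
have e1 : \int2 (fun x => X (nc (pt x) ^+ 2) * h' (nc (pt x) ^+ 2)) =
    \int2 (fun x => dstp (L ^+ 2) d (nc (pt x) ^+ 2) * h (nc (pt x) ^+ 2)).
  apply/eqP; rewrite -subr_eq0 -RintegralB//; apply/eqP.
  apply: (@radial_int0 (fun s => X s * (stp e e s / k s)) (fun s => X s * h s)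
    (fun s => X s * h' s - dstp (L ^+ 2) d s * h s) (Num.sqrt (L ^+ 2 + d))) => //.
  - apply: smoothR_mul => //; apply: smoothR_mul; first exact: smoothR_stp.
    by apply: smoothR_inv.
  - move=> s; rewrite mulrCA; congr (_ * _); rewrite /h.
    have [es|se] := leP e s; last by rewrite stp_le ?mul0r ?mulr0// ltW.
    rewrite mulrCA; congr (_ * _); rewrite /k clamp_id//.
    have s0 : 0 < s := lt_le_trans e0 es.
    rewrite -[X in X / _](@sqr_sqrtr _ s) ?(ltW s0)// expr2 mulfK// gt_eqF// sqrtr_gt0//.
  - move=> s; apply: is_derive_eq (is_deriveM (dX s) (dh s)) _.
    by rewrite -[X in X + _]/(_ * _) -[X in _ + X]/(_ * _) mulrN [h s * _]mulrC.
  - by move=> s Hs; rewrite Lout ?mul0r.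
apply: (@le_trans _ _ (2 * \int2 (fun x => X (nc (pt x) ^+ 2) * h' (nc (pt x) ^+ 2)))).
  rewrite -RintegralZl//.
  have pw (x : plane R) : \1_A x / nc (pt x) <= 2 * (X (nc (pt x) ^+ 2) * h' (nc (pt x) ^+ 2)).
    rewrite indicE; case: (boolP (x \in A)) => [|_]; last by rewrite mul0r !mulr_ge0.
    rewrite inE => -[xe xL]; rewrite mul1r.
    have sL : nc (pt x) ^+ 2 <= L ^+ 2 by rewrite nc_sqr_ge// ?nc_ge0// ltW.
    have se : e < nc (pt x) ^+ 2 by rewrite (lt_le_trans _ xe)//; lra.
    rewrite /X stp_le// mulr0 addr0 mul1r /h' k'E// stp_ge//; last by lra.
    rewrite sqrtr_sqr ger0_norm ?nc_ge0// mul1r invfM mulrDr mulrA divff ?mul1r//.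
    by rewrite lerDl mulr_ge0// mulr_ge0 ?dstp_ge0 ?(ltW (k0 _)).
  apply: Rintegral_le => //; last exact: rintegrableZ.
  apply: (rintegrable_le mF (rintegrableZ 2 I1)) => x.
  by rewrite ger0_norm// divr_ge0 ?nc_ge0// indicE.
rewrite e1 -mulrA ler_wpM2l// -(int_dstp L20 d0) -RintegralZl//; last exact: dstp_integrable.
apply: Rintegral_le => //; first by apply: rintegrableZ; exact: dstp_integrable.
move=> x; rewrite mulrC; set s := _ ^+ 2.
have [s1|s1] := leP s (L ^+ 2); first by rewrite dstp_out ?s1// !mulr0.
have [s2|s2] := leP (L ^+ 2 + d) s; first by rewrite dstp_out ?s2 ?orbT// !mulr0.
rewrite ler_wpM2r ?dstp_ge0// /h /k clamp_id//; last by lra.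
rewrite stp_ge ?mul1r//; last by lra.
by rewrite ler_wsqrtr// ltW.
Unshelve. all: by end_near. Qed.

End radial_integrals.

Section cauchy_pompeiu.
Variable R : realType.
Local Notation "\int2 h" := (Rintegral (@lam2 R) setT h) (at level 50).
Implicit Types (L a d s : R) (p : plane R).

Lemma omega_ge0 : 0 <= @omega R.
Proof. by apply: Rintegral_ge0 => x _; exact: dstp_ge0. Qed.

Lemma measurable_inv_nc :
  measurable_fun setT (fun x : plane R => (nc (pt x))^-1).
Proof.
apply: (measurableT_comp (@measurable_invr R)).
by apply: measurable_nc; exact: cmeas_pt.
Qed.

(** Monotone convergence along the annuli of [int_inv_annulus], which exhaust the punctured disc.
    With omega = pi the bound is the exact integral of 1/|zeta|. *)
Lemma inv_integrable L : 0 < L ->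
  rintegrable (@lam2 R) (fun x => \1_(disc L) x / nc (pt x)) /\
  \int2 (fun x => \1_(disc L) x / nc (pt x)) <= 2 * L * omega R.
Proof.
move=> L0.
have L20 : 0 < L ^+ 2 by rewrite exprn_gt0.
pose e (k : nat) := L ^+ 2 / 2 / k.+1%:R.
have e0 k : 0 < e k by rewrite !divr_gt0.
have e2 k : 2 * e k = L ^+ 2 / k.+1%:R by rewrite /e [L ^+ 2 / 2 / _]mulrAC mulrC divfK.
have eL k : 2 * e k <= L ^+ 2.
  rewrite e2 ler_pdivrMr//; apply: ler_peMr; [exact: ltW|by rewrite ler1n].
pose F k := [set x : plane R | 2 * e k <= nc (pt x) ^+ 2 /\ nc (pt x) <= L].
have mF k : measurable (F k).
  have -> : F k = (fun x : plane R => nc (pt x) ^+ 2) @^-1` `[2 * e k, +oo[ `&`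
      (fun x : plane R => nc (pt x)) @^-1` `]-oo, L].
    by apply/seteqP; split => x /=; rewrite !in_itv/= ?andbT.
  apply: measurableI; rewrite -[X in measurable X]setTI.
    by apply: measurable_funX => //; apply: measurable_nc; exact: cmeas_pt.
  by apply: (measurable_nc (@cmeas_pt R)) => //; exact: measurable_itv.
have ndF : {homo F : n m / (n <= m)%N >-> (n <= m)%O}.
  move=> k m km; apply/subsetPset => x [x1 x2]; split => //.
  apply: le_trans x1; rewrite !e2 ler_pM2l//.
  by rewrite lef_pV2 ?posrE ?ltr0n// ler_nat ltnS.
have minv := measurable_inv_nc.
have minv' : measurable_fun setT (fun x : plane R => ((nc (pt x))^-1)%:E).
  exact/measurable_EFinP.
have inv0 (x : plane R) : (0 <= ((nc (pt x))^-1)%:E)%E by rewrite lee_fin invr_ge0 nc_ge0.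
have bF k : (\int[@lam2 R]_(x in F k) ((nc (pt x))^-1)%:E <= (2 * L * omega R)%:E)%E.
  rewrite integral_mkcond.
  have -> : ((fun x => ((nc (pt x))^-1)%:E) \_ (F k)) =
      (fun x => (\1_(F k) x / nc (pt x))%:E).
    apply/funext => x; rewrite /patch indicE; case: ifP => _; first by rewrite mul1r.
    by rewrite mul0r.
  have IF : rintegrable (@lam2 R) (fun x => \1_(F k) x / nc (pt x)).
    apply: (rintegrable_le (h' := fun x => (2 * e k / L)^-1 * \1_(disc (L + 1)) x)).
    - by apply: measurable_funM.
    - exact: disc_integrable.
    - move=> x; rewrite ger0_norm; last by rewrite divr_ge0 ?nc_ge0// indicE.
      have c0 : 0 < (2 * e k / L)^-1 by rewrite invr_gt0 divr_gt0// mulr_gt0.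
      rewrite indicE; case: (boolP (x \in F k)) => [|_]; last first.
        by rewrite mul0r mulr_ge0 ?(ltW c0)// indicE.
      rewrite inE => -[x1 x2]; rewrite indicE mem_set ?mul1r ?mulr1; last first.
        by rewrite /disc/= (le_lt_trans x2)// ltrDl.
      have x0 : 0 < nc (pt x).
        rewrite lt_neqAle nc_ge0 andbT eq_sym; apply/eqP => x0.
        by move: x1; rewrite x0 expr0n/= leNgt mulr_gt0.
      rewrite lef_pV2 ?posrE ?divr_gt0 ?mulr_gt0// ler_pdivrMr//.
      by apply: le_trans x1 _; rewrite expr2 ler_wpM2l// ltW.
  have := int_inv_annulus (e0 k) (eL k) L0; rewrite -/(F k) -lee_fin.
  rewrite /Rintegral fineK//; exact: integrable_fin_num.
have cvF := ge0_nondecreasing_set_cvg_integral (mu := @lam2 R) ndF mF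
  (fun k => measurable_funTS minv') (fun k x _ => inv0 x).
have bU : (\int[@lam2 R]_(x in \bigcup_k F k) ((nc (pt x))^-1)%:E <= (2 * L * omega R)%:E)%E.
  by apply: (cvge_to_le cvF); apply: nearW => k; exact: bF.
have bD : (\int[@lam2 R]_x (\1_(disc L) x / nc (pt x))%:E <= (2 * L * omega R)%:E)%E.
  apply: le_trans bU; rewrite [leRHS]integral_mkcond.
  apply: ge0_le_integral => //.
  - by move=> x _; rewrite lee_fin divr_ge0 ?nc_ge0// indicE.
  - apply/measurable_EFinP; apply: measurable_funM => //.
    by apply: measurable_indic; exact: measurable_disc.
  - apply/(measurable_restrictT _ _).1; first exact: bigcup_measurable.
    exact: measurable_funTS.
  - move=> x _; rewrite /patch indicE; case: (boolP (x \in disc L)) => [|_]; last first.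
      by rewrite mul0r; case: ifP.
    rewrite inE mul1r => xL.
    (* The origin lies in no annulus, but there the integrand is 0 by the convention [0^-1 = 0]. *)
    have [x0|x0] := eqVneq (nc (pt x)) 0.
      by rewrite x0 invr0; case: ifP.
    rewrite mem_set//.
    have xx0 : 0 < nc (pt x) ^+ 2 by rewrite exprn_gt0// lt_neqAle eq_sym x0 nc_ge0.
    exists (Num.truncn (L ^+ 2 / nc (pt x) ^+ 2)) => //; split; last exact: ltW.
    rewrite e2 ler_pdivrMr// mulrC -ler_pdivrMr//.
    by apply/ltW; exact: truncnS_gt.
have ID : rintegrable (@lam2 R) (fun x => \1_(disc L) x / nc (pt x)).
  apply/integrableP; split.
    apply/measurable_EFinP; apply: measurable_funM => //.
    by apply: measurable_indic; exact: measurable_disc.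
  apply: (@le_lt_trans _ _ (2 * L * omega R)%:E); last exact: ltry.
  apply: le_trans bD; rewrite le_eqVlt; apply/orP; left; apply/eqP.
  by apply: eq_integral => x _; rewrite gee0_abs// lee_fin divr_ge0 ?nc_ge0.
split => //; rewrite -lee_fin; apply: le_trans bD.
by rewrite /Rintegral fineK//; exact: integrable_fin_num.
Qed.

(** Otherwise 1/|zeta| would have integral at most 0 over the unit disc, although it is at least 1
    on a square of area 1/4 inside it. *)
Lemma omega_gt0 : 0 < @omega R.
Proof.
rewrite lt_neqAle omega_ge0 andbT; apply/eqP => o0.
have [I1] := inv_integrable (ltr01 : 0 < 1 :> R); rewrite -o0 mulr0.
apply/negP; rewrite -ltNge.
pose J : set (measurableTypeR R) := `]0, 2^-1[%classic.
have mJ : measurable J by exact: measurable_itv.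
have lJ : lebesgue_measure J = (2^-1)%:E.
  by rewrite lebesgue_measure_itv/= lte_fin invr_gt0 ltr0n -EFinB subr0.
have JJ := lam2_rect mJ mJ.
have mJJ : measurable (J `*` J) by exact: measurableX.
have e4 : lam2 R (J `*` J) = (2^-1 * 2^-1)%:E by rewrite JJ lJ.
have fJJ : (lam2 R (J `*` J) < +oo)%E by rewrite e4 ltry.
apply: (@lt_le_trans _ _ (\int2 (fun x => \1_(J `*` J) x))).
  by rewrite (Rintegral_indic _ mJJ) e4/= mulr_gt0 ?invr_gt0.
apply: Rintegral_le => //; first exact: rintegrable_indic.
move=> x; rewrite indicE; case: (boolP (x \in _)) => [|_]; last first.
  by rewrite divr_ge0 ?nc_ge0// indicE.
rewrite inE => -[]; rewrite /J/= !in_itv/= => /andP[a0 a1] /andP[b0 b1].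
have nx : nc (pt x) < 1.
  apply: le_lt_trans (nc_le_ReIm _) _; rewrite /= !gtr0_norm//.
  by rewrite [ltRHS](splitr 1) div1r ltrD.
have x0 : 0 < nc (pt x).
  by rewrite nc_gt0; apply/eqP => /(congr1 (@complex.Re R))/= x0; rewrite x0 ltxx in a0.
by rewrite indicE mem_set// mul1r invf_ge1// ltW.
Qed.

Definition ckern L p : R[i] := (\1_(disc L) p)%:C / pt p.

Lemma cmeas_ckern L : cmeas (ckern L).
Proof.
have mi : measurable_fun setT (fun p : plane R => \1_(disc L) p * (nc (pt p) ^+ 2)^-1).
  apply: measurable_funM; first by apply: measurable_indic; exact: measurable_disc.
  apply: (measurableT_comp (@measurable_invr R)).
  by apply: measurable_funX; apply: measurable_nc; exact: cmeas_pt.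
have -> : ckern L = (fun p => (\1_(disc L) p * (nc (pt p) ^+ 2)^-1)%:C * (pt p)^*%C).
  apply/funext => p; rewrite /ckern.
  have [->|p0] := eqVneq (pt p) 0.
    by rewrite invr0 nc0 expr0n/= invr0 !mulr0 mul0r.
  have c0 : (pt p)^*%C != 0 by rewrite conjc_eq0.
  have e : (pt p)^-1 = ((nc (pt p) ^+ 2)%:C)^-1 * (pt p)^*%C.
    by rewrite -conj_nc invfM -mulrA mulVf// mulr1.
  by rewrite e -fmorphV rmorphM mulrA.
by apply: cmeasM; [exact: cmeas_real|apply: cmeas_conj; exact: cmeas_pt].
Qed.

Lemma nc_ckern L p : nc (ckern L p) = \1_(disc L) p / nc (pt p).
Proof. by rewrite /ckern ncM ncV nc_real ger0_norm// indicE. Qed.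

Lemma ckern_integrable L : 0 < L -> cintegrable (@lam2 R) (ckern L).
Proof.
move=> L0; apply: cintegrable_nc; first exact: cmeas_ckern.
under [X in rintegrable _ X]eq_fun do rewrite nc_ckern.
by have [] := inv_integrable L0.
Qed.

Lemma kern_ckern L (c : R[i]) : 0 < L -> kern (fun p => c * ckern L p).
Proof.
move=> L0; split; first by apply: cintegrableZ; exact: ckern_integrable.
exists L => [|p pL]; first exact: ltW.
rewrite /ckern indicE memNset ?mul0r ?mulr0//.
by rewrite /disc/= => /lt_gtF; rewrite pL.
Qed.

(* [conj zeta * invs e (|zeta|^2)] is a smooth kernel, equal to [1/zeta] for
   [|zeta|^2 >= 2 e]. *)
Definition invs (e s : R) : R := stp e e s / clamp e s.

Lemma smoothR_invs e : 0 < e -> smoothR (invs e).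
Proof.
move=> e0; apply: smoothR_mul; first exact: smoothR_stp.
by apply: smoothR_inv; [exact: smoothR_clamp|move=> s; exact: clamp_gt0].
Qed.

Lemma invsE e s : 0 < e -> s * invs e s = stp e e s.
Proof.
move=> e0; rewrite /invs mulrCA; have [es|se] := leP e s.
  by rewrite clamp_id// divff ?mulr1// gt_eqF// (lt_le_trans e0).
by rewrite stp_le ?mul0r// ltW.
Qed.

Lemma invs_ge0 e s : 0 < e -> 0 <= invs e s.
Proof. by move=> e0; rewrite divr_ge0 ?stp_ge0// ltW// clamp_gt0. Qed.

(** [F] and [D] stand for a function and its d-bar derivative on a slice, [f0] for the value at the
    centre. The last hypothesis is Stokes' formula for [F] times the regularised kernel; as [e]
    tends to 0 its first term tends to [omega * f0] and its second to the integral against the true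
    kernel. *)
Lemma cauchy_pompeiu_aux (F D : plane R -> R[i]) (f0 : R[i]) A B M : 0 <= A -> 0 <= B -> 0 < M ->
  cmeas F -> cmeas D ->
  (forall p, nc (D p) <= B) -> (forall p, M <= nc (pt p) -> D p = 0) ->
  (forall p, nc (pt p) <= 1 -> nc (F p - f0) <= A * nc (pt p)) ->
  (forall e, 0 < e -> cint (@lam2 R) (fun p => F p * (dstp e e (nc (pt p) ^+ 2))%:C +
     D p * ((pt p)^*%C * (invs e (nc (pt p) ^+ 2))%:C)) = 0) ->
  cint (@lam2 R) (fun p => D p * ckern M p) = - (omega R)%:C * f0.
Proof.
move=> A0 B0 M0 mF mD DB D0 FA H.
have o0 := omega_gt0.
apply/eqP; rewrite -subr_eq0 -nc_eq0 eq_le nc_ge0 andbT.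
apply: (@le0_small _ _ ((A + 4 * B) * omega R)).
  by rewrite mulr_ge0 ?(ltW o0)// addr_ge0// mulr_ge0.
(* The regularisation ends at |zeta|^2 = 2 e, so with this [e] it is confined to |zeta| < t. *)
move=> t t0 t1; pose e := t ^+ 2 / 2.
have e0 : 0 < e by rewrite divr_gt0// exprn_gt0.
have ee : e + e = t ^+ 2 by rewrite -splitr.
have t21 : t ^+ 2 <= 1 by rewrite expr_le1// ltW.
have mdst : cmeas (fun p : plane R => (dstp e e (nc (pt p) ^+ 2))%:C).
  apply: cmeas_real; apply: measurableT_comp.
    by apply: continuous_measurable_fun; apply: smoothR_continuous; exact: smoothR_dstp.
  by apply: measurable_funX; apply: measurable_nc; exact: cmeas_pt.
have minv : cmeas (fun p : plane R => (pt p)^*%C * (invs e (nc (pt p) ^+ 2))%:C).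
  apply: cmeasM; first by apply: cmeas_conj; exact: cmeas_pt.
  apply: cmeas_real; apply: measurableT_comp.
    by apply: continuous_measurable_fun; apply: smoothR_continuous; exact: smoothR_invs.
  by apply: measurable_funX; apply: measurable_nc; exact: cmeas_pt.
have dout p : t <= nc (pt p) -> dstp e e (nc (pt p) ^+ 2) = 0.
  by move=> tp; rewrite dstp_out// ee nc_sqr_ge ?nc_ge0 ?tp ?orbT// ltW.
have [Bd HBd] := dstp_bound e0 e0.
have Bd0 : 0 <= Bd by apply: le_trans (HBd 0 (lexx _)).
have I1 : cintegrable (@lam2 R) (fun p => F p * (dstp e e (nc (pt p) ^+ 2))%:C).
  apply: (@supp_integrable _ _ ((nc f0 + A) * Bd) t).
  - exact: cmeasM.
  - move=> p pt'; rewrite ncM nc_real ler_pM ?nc_ge0 ?HBd ?sqr_ge0//.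
    rewrite -[F p](subrK f0) addrC (le_trans (ncD _ _))// lerD2l.
    have p1 : nc (pt p) <= 1 by rewrite (le_trans (ltW pt')).
    by apply: le_trans (FA _ p1) _; rewrite ler_piMr.
  - by move=> p tp; rewrite dout// mulr0.
have [Bi Bi0 HBi] := smoothR_bounded 0 (M ^+ 2) (smoothR_invs e0).
have I2 : cintegrable (@lam2 R) (fun p => D p * ((pt p)^*%C * (invs e (nc (pt p) ^+ 2))%:C)).
  apply: (@supp_integrable _ _ (B * (M * Bi)) M).
  - exact: cmeasM.
  - move=> p pM; rewrite ncM ler_pM ?nc_ge0//.
    rewrite ncM nc_conj nc_real ler_pM ?nc_ge0//; first exact: ltW.
    by apply: HBi; rewrite sqr_ge0 nc_sqr_ge ?nc_ge0// ltW.
  - by move=> p Mp; rewrite D0// mul0r.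
have IK := ckern_integrable M0.
have I3 : cintegrable (@lam2 R) (fun p => D p * ckern M p) := cintegrable_bM mD DB IK.
have I4 : cintegrable (@lam2 R) (fun p : plane R => (dstp e e (nc (pt p) ^+ 2))%:C).
  by apply: cintegrable_real; exact: dstp_integrable.
have I5 := cintegrableZ f0 I4.
have e1 : cint (@lam2 R) (fun p => f0 * (dstp e e (nc (pt p) ^+ 2))%:C) = (omega R)%:C * f0.
  by rewrite (cintZ f0 I4) cint_real int_dstp// mulrC.
have := H e e0; rewrite (cintD I1 I2) => HH.
(* On the support of the radial step [F] differs from [f0] by at most [A * t]. *)
have b1 : nc (cint (@lam2 R) (fun p => F p * (dstp e e (nc (pt p) ^+ 2))%:C) -
    (omega R)%:C * f0) <= A * omega R * t.
  rewrite -e1 -(cintB I1 I5).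
  rewrite [leRHS]mulrAC -(int_dstp e0 e0) -RintegralZl//; last exact: dstp_integrable.
  apply: nc_cint_le; [exact: cintegrableB|by apply: rintegrableZ; exact: dstp_integrable|].
  move=> p; rewrite -mulrBl ncM nc_real ger0_norm ?dstp_ge0//.
  have [tp|tp] := leP t (nc (pt p)); first by rewrite dout// !mulr0.
  rewrite ler_wpM2r ?dstp_ge0//.
  have p1 : nc (pt p) <= 1 by rewrite (le_trans (ltW tp)).
  by apply: le_trans (FA _ p1) _; rewrite ler_wpM2l// ltW.
have [It It_le] := inv_integrable t0.
(* The two kernels agree for [t <= |zeta| < M], and inside the disc of radius [t] both are at most
   1/|zeta|, whose integral there is at most [2 * t * omega]. *)
have b2 : nc (cint (@lam2 R) (fun p => D p * ckern M p) -
    cint (@lam2 R) (fun p => D p * ((pt p)^*%C * (invs e (nc (pt p) ^+ 2))%:C)))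
    <= 4 * B * omega R * t.
  rewrite -(cintB I3 I2).
  apply: (@le_trans _ _ (\int2 (fun x => (2 * B) * (\1_(disc t) x / nc (pt x))))); last first.
    rewrite RintegralZl//; apply: le_trans (ler_wpM2l _ It_le) _.
      by rewrite mulr_ge0.
    by rewrite le_eqVlt; apply/orP; left; apply/eqP; ring.
  apply: nc_cint_le; [exact: cintegrableB|exact: rintegrableZ|].
  move=> p; rewrite -mulrBr ncM.
  have [p0|p0] := eqVneq (pt p) 0.
    rewrite /ckern p0 invr0 mulr0 rmorph0 mul0r subrr nc0 mulr0.
    by rewrite invr0 !mulr0.
  have np : 0 < nc (pt p) by rewrite nc_gt0.
  have [tp|tp] := leP t (nc (pt p)).
    rewrite [\1_(disc t) p]indicE memNset ?mul0r ?mulr0; last first.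
      by rewrite /disc/= => /lt_geF; rewrite tp.
    have [Mp|Mp] := leP M (nc (pt p)); first by rewrite D0// nc0 mul0r.
    rewrite /ckern indicE mem_set// mul1r.
    rewrite [X in nc (_ - X)](_ : _ = (pt p)^-1) ?subrr ?nc0 ?mulr0//.
    apply: (mulfI p0); rewrite mulrA conj_nc -rmorphM/= invsE// divff//.
    by rewrite stp_ge// ee nc_sqr_ge// ?nc_ge0// ltW.
  rewrite [\1_(disc t) p]indicE mem_set// mul1r [2 * B]mulrC -mulrA.
  apply: ler_pM; rewrite ?nc_ge0//.
  apply: le_trans (ncB _ _) _; rewrite mulr_natl mulr2n lerD//.
    rewrite nc_ckern indicE; case: (_ \in _); first by rewrite mul1r.
    by rewrite mul0r invr_ge0 ltW.
  rewrite ncM nc_conj nc_real ger0_norm ?invs_ge0//.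
  rewrite -[leRHS]div1r ler_pdivlMr// mulrAC -expr2 invsE//.
  exact: stp_le1.
rewrite (_ : _ - _ = (cint (@lam2 R) (fun p => D p * ckern M p) -
    cint (@lam2 R) (fun p => D p * ((pt p)^*%C * (invs e (nc (pt p) ^+ 2))%:C))) -
    (cint (@lam2 R) (fun p => F p * (dstp e e (nc (pt p) ^+ 2))%:C) -
    (omega R)%:C * f0)); last first.
  move/eqP: HH; rewrite addr_eq0 => /eqP ->; ring.
apply: le_trans (ncB _ _) _.
have -> : (A + 4 * B) * omega R * t = 4 * B * omega R * t + A * omega R * t by ring.
exact: lerD.
Qed.

End cauchy_pompeiu.

Section cauchy_pompeiu_Cn.
Variables (R : realType) (n : nat).
Local Notation E := (Cn R n).
Implicit Types (z v : E) (f g : E -> R[i]) (L : R) (j : 'I_n).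
Local Notation db j f := (dbar j (f : E -> R[i]^o) : E -> R[i]).

Lemma slide_lip j f z : Sm f -> exists2 A, 0 <= A & forall p, nc (pt p) <= 1 ->
  nc (f (slide j z p) - f z) <= A * nc (pt p).
Proof.
move=> sf; have [bf df] := Sm_spec sf.
have [gx [_ dx]] := df _ (isdir_x R j); have [gy [_ dy]] := df _ (isdir_y R j).
have [r r0 rz] := cbnd_ex z.
have [A A0 HA] := dd_lip (r + 1) (isdir_x R j) bf dx.
have [B B0 HB] := dd_lip (r + 1) (isdir_y R j) bf dy.
exists (A + B) => [|p p1]; first exact: addr_ge0.
have p1x : `|p.1 : R| <= 1 := le_trans (nc_ge_Re (pt p)) p1.
have p1y : `|p.2 : R| <= 1 := le_trans (nc_ge_Im (pt p)) p1.
have rz' : cbnd (r + 1) z by move=> i; rewrite (le_trans (rz i))// lerDl.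
have zx := cbnd_step (isdir_x R j) p1x rz.
have -> : slide j z p = (z + (p.1 : R)%:C *: dir_x R j) + (p.2 : R)%:C *: dir_y R j.
  rewrite /slide -addrA; congr (_ + _); rewrite /dir_y scalerA -scalerDl; congr (_ *: _).
  by apply: complex_ext; rewrite !(creD, cimD, creM, cimM)/=; ring.
rewrite -[f _ - f z](subrKA (f (z + (p.1 : R)%:C *: dir_x R j))).
apply: le_trans (ncD _ _) _; rewrite addrC mulrDl lerD//.
  by apply: le_trans (HA _ _ rz' p1x) _; rewrite ler_wpM2l// (nc_ge_Re (pt p)).
by apply: le_trans (HB _ _ zx p1y) _; rewrite ler_wpM2l// (nc_ge_Im (pt p)).
Qed.

(** The margin 1 is the length of the segment on which [dd_vanish] wants the function to vanish; it
    is the origin of the summands 1 in the truncation radii below. *)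
Lemma dbar_slide_out j f z L p : Sm f -> (forall q, L <= nc (pt q) -> f (slide j z q) = 0) ->
  L + 1 <= nc (pt p) -> db j f (slide j z p) = 0.
Proof.
move=> sf f0 pL; have [gx [gy [_ _ dx dy ->]]] := dbar_ddP j sf.
have far v (a : R[i]) g : dd v f g -> v = a *: dir_x R j -> nc a <= 1 -> g (slide j z p) = 0.
  move=> dg va a1; apply: (dd_vanish dg) => t t0 t1.
  pose q : plane R := (complex.Re (t%:C * a), complex.Im (t%:C * a)).
  have qE : pt q = t%:C * a by exact: complex_ext.
  have -> : slide j z p + t%:C *: v = slide j z (shift2 q p).
    by rewrite /slide pt_shift2 scalerDl addrA qE va scalerA.
  apply: f0; rewrite pt_shift2 qE.
  have h : nc (t%:C * a) <= 1 by rewrite ncM nc_real mulr_ile1 ?nc_ge0// ger0_norm.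
  have := ncB (pt p + t%:C * a) (t%:C * a); rewrite addrK; lra.
rewrite (far (dir_x R j) 1 gx dx) ?scale1r ?nc1//.
by rewrite (far (dir_y R j) 'i gy dy) ?nc_i// mulr0 addr0 mulr0.
Qed.

Lemma cauchy_pompeiu j f z L M : Sm f -> 0 < M -> L + 1 <= M ->
  (forall p, L <= nc (pt p) -> f (slide j z p) = 0) ->
  cint (@lam2 R) (fun p => db j f (slide j z p) * ckern M p) = - (omega R)%:C * f z.
Proof.
move=> sf M0 LM f0; have sdf := Sm_dbar j sf.
have [A A0 HA] := slide_lip j z sf.
have [r r0 rz] := cbnd_ex z.
have [B B0 HB] := Sm_locbounded sdf (r + M).
have out p : M <= nc (pt p) -> db j f (slide j z p) = 0.
  by move=> pM; apply: (dbar_slide_out sf f0); exact: le_trans pM.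
apply: (@cauchy_pompeiu_aux R (fun p => f (slide j z p)) (fun p => db j f (slide j z p))
  (f z) A B M A0 B0 M0) => //.
- by apply: cmeas_slide; exact: Sm_cmeas.
- by apply: cmeas_slide; exact: Sm_cmeas.
- move=> p; have [pM|pM] := leP (nc (pt p)) M.
    by apply: HB; exact: cbnd_slide.
  by rewrite out ?nc0// ltW.
(* The centre of the kernel is frozen at the coordinate of [z], so that the kernel becomes a
   function in [Sm]. *)
move=> e e0; pose a := z 0 j.
pose K : E -> R[i] := fun y => (y 0 j - a)^*%C * (invs e (nc (y 0 j - a) ^+ 2))%:C.
have sK : Sm K.
  by apply: Sm_mul; [apply: Sm_conj; exact: Sm_coordB|apply: Sm_radial; exact: smoothR_invs].
have dK : db j K = fun y => (dstp e e (nc (y 0 j - a) ^+ 2))%:C.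
  by apply: dbar_conj_radial; [exact: smoothR_invs|move=> s; exact: invsE|move=> s; exact: is_derive_stp].
have sfK := Sm_mul sf sK.
have fK0 p : L <= nc (pt p) -> f (slide j z p) * K (slide j z p) = 0.
  by move=> pL; rewrite f0// mul0r.
have := int_dbar0 sfK fK0; rewrite (dbar_mul j sf sK) dK => <-.
congr cint; apply/funext => p; rewrite /K.
by rewrite slideE eqxx addrAC subrr add0r.
Qed.

End cauchy_pompeiu_Cn.

(** * Differences of translated Cauchy kernels *)

Section kernel_difference.
Variable R : realType.
Local Notation "\int2 h" := (Rintegral (@lam2 R) setT h) (at level 50).
Implicit Types (L : R) (p : plane R) (d : R[i]).

Lemma cmeas_inv (di : measure_display) (T : measurableType di) (f : T -> R[i]) :
  cmeas f -> cmeas (fun x => (f x)^-1).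
Proof.
move=> mf.
have -> : (fun x => (f x)^-1) = (fun x => ((nc (f x) ^+ 2)^-1)%:C * (f x)^*%C).
  apply/funext => x; have [->|f0] := eqVneq (f x) 0.
    by rewrite invr0 nc0 expr0n/= invr0 mul0r.
  have e : (f x)^-1 = ((nc (f x) ^+ 2)%:C)^-1 * (f x)^*%C.
    by rewrite -conj_nc invfM -mulrA mulVf ?mulr1// conjc_eq0.
  by rewrite {1}e -fmorphV.
apply: cmeasM; last exact: cmeas_conj.
apply: cmeas_real; apply: (measurableT_comp (@measurable_invr R)).
by apply: measurable_funX; exact: measurable_nc.
Qed.

(* Splitting according to whether p or p - d is within rho of 0. *)
Lemma inv_diff_le (w d : R[i]) (rho : R) : 0 < rho ->
  nc (w^-1 - (w - d)^-1) <=
    ((nc w < rho)%R%:R + nc d / rho) / nc w + ((nc (w - d) < rho)%R%:R + nc d / rho) / nc (w - d).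
Proof.
move=> rho0.
have [w0|w0] := eqVneq w 0.
  rewrite w0 invr0 nc0 invr0 mulr0 !add0r invrN opprK ncV !ncN.
  have [->|d0] := eqVneq d 0; first by rewrite nc0 invr0 mulr0.
  have nd : 0 < nc d by rewrite nc_gt0.
  rewrite ler_peMl ?invr_ge0 ?nc_ge0//; case: ltP => [_|dr']; first by rewrite lerDl divr_ge0// ltW.
  by rewrite add0r ler_pdivlMr// mul1r.
have [wd|wd] := eqVneq (w - d) 0.
  have dw : d = w by move/eqP: wd; rewrite subr_eq0 => /eqP.
  rewrite wd invr0 nc0 invr0 mulr0 addr0 subr0 ncV dw.
  have nw : 0 < nc w by rewrite nc_gt0.
  rewrite ler_peMl ?invr_ge0 ?nc_ge0//; case: ltP => [_|dr']; first by rewrite lerDl divr_ge0// ltW.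
  by rewrite add0r ler_pdivlMr// mul1r.
have nw : 0 < nc w by rewrite nc_gt0.
have nwd : 0 < nc (w - d) by rewrite nc_gt0.
have E : nc (w^-1 - (w - d)^-1) = nc d / (nc w * nc (w - d)).
  rewrite (_ : _ - _ = - d / (w * (w - d))); last by field; rewrite w0 wd.
  by rewrite ncM ncN ncV ncM.
have far x y : 0 < nc x -> 0 < nc y -> rho <= nc y ->
    nc d / (nc x * nc y) <= ((nc x < rho)%R%:R + nc d / rho) / nc x.
  move=> x0 y0 ry; rewrite mulrC invfM -mulrA mulrC ler_wpM2r ?invr_ge0 ?nc_ge0//.
  apply: (@le_trans _ _ (nc d / rho)); last by rewrite lerDr.
  by rewrite mulrC ler_wpM2l ?nc_ge0// lef_pV2 ?posrE.
have [wr|wr] := ltP (nc w) rho; have [wdr|wdr] := ltP (nc (w - d)) rho.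
- apply: le_trans (ncB _ _) _; rewrite !ncV lerD//.
    by rewrite ler_peMl ?invr_ge0 ?nc_ge0// lerDl divr_ge0 ?nc_ge0// ltW.
  by rewrite ler_peMl ?invr_ge0 ?nc_ge0// lerDl divr_ge0 ?nc_ge0// ltW.
- rewrite E; apply: le_trans (far w (w - d) nw nwd wdr) _; rewrite wr lerDl.
  by rewrite divr_ge0 ?nc_ge0// addr_ge0// divr_ge0 ?nc_ge0// ltW.
- rewrite E [nc w * _]mulrC; apply: le_trans (far (w - d) w nwd nw wr) _; rewrite wdr lerDr.
  by rewrite divr_ge0 ?nc_ge0// addr_ge0// divr_ge0 ?nc_ge0// ltW.
- rewrite E; apply: le_trans (far w (w - d) nw nwd wdr) _; rewrite ltNge wr/= lerDl.
  by rewrite divr_ge0 ?nc_ge0// addr_ge0// divr_ge0 ?nc_ge0// ltW.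
Qed.

Lemma shift_opp d p : pt (shift2 (- complex.Re d, - complex.Im d) p) = pt p - d.
Proof. by apply: complex_ext; rewrite ?(creD, cimD, creN, cimN). Qed.

(** [inv_diff_le] is integrated; a translation brings the terms centred at [d] to the disc of radius
    [L + nc d] around 0. For bounded [d] and [rho] of order sqrt L the bound is O(sqrt L), the
    source of every sqrt S in the gauge. *)
Lemma inv_diff_int d (rho L : R) : 0 < rho -> 0 < L ->
  rintegrable (@lam2 R) (fun p => \1_(disc L) p * nc ((pt p)^-1 - (pt p - d)^-1)) /\
  \int2 (fun p => \1_(disc L) p * nc ((pt p)^-1 - (pt p - d)^-1)) <=
  omega R * (4 * rho + 4 * nc d * (L + nc d) / rho).
Proof.
move=> rho0 L0.
have o0 := @omega_gt0 R.
pose a : plane R := (- complex.Re d, - complex.Im d).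
pose e (Q : R) (p : plane R) : R := \1_(disc rho) p / nc (pt p) + nc d / rho * (\1_(disc Q) p / nc (pt p)).
have Ie Q : 0 < Q -> rintegrable (@lam2 R) (e Q) /\
    \int2 (e Q) <= omega R * (2 * rho + 2 * nc d * Q / rho).
  move=> Q0; have [i1 b1] := inv_integrable rho0; have [i2 b2] := inv_integrable Q0.
  have i3 := rintegrableZ (nc d / rho) i2.
  split; first exact: rintegrableD.
  rewrite RintegralD// RintegralZl//.
  have h0 : 0 <= nc d / rho by rewrite divr_ge0 ?nc_ge0// ltW.
  apply: le_trans (lerD b1 (ler_wpM2l h0 b2)) _.
  by rewrite le_eqVlt; apply/orP; left; apply/eqP; field; rewrite gt_eqF.
have L'0 : 0 < L + nc d by rewrite ltr_pwDl ?nc_ge0.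
have [i1 b1] := Ie _ L0; have [i2 b2] := Ie _ L'0.
have [i2' e2'] := integrable_shift a i2.
have pw p : \1_(disc L) p * nc ((pt p)^-1 - (pt p - d)^-1) <= e L p + e (L + nc d) (shift2 a p).
  have e0 Q q : 0 <= e Q q.
    have h0 : 0 <= nc d / rho by rewrite divr_ge0 ?nc_ge0// ltW.
    by rewrite addr_ge0// ?(mulr_ge0 h0)// divr_ge0 ?nc_ge0.
  rewrite indicE; case: (boolP (p \in disc L)) => [|_]; last by rewrite mul0r addr_ge0.
  rewrite inE mul1r => pL.
  have pd : nc (pt p - d) < L + nc d by rewrite (le_lt_trans (ncB _ _))// ltrD2r.
  apply: le_trans (inv_diff_le _ _ rho0) _.
  rewrite /e shift_opp !indicE.
  have -> : (p \in disc L) = true by rewrite mem_set.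
  have -> : (shift2 a p \in disc (L + nc d)) = true by rewrite mem_set//; move: pd; rewrite -shift_opp.
  have inD q : (q \in disc rho) = (nc (pt q) < rho).
    by apply/idP/idP => [|h]; [rewrite inE|rewrite inE].
  by rewrite !inD shift_opp !mul1r lerD// mulrDl lerD.
have mf : measurable_fun setT (fun p => \1_(disc L) p * nc ((pt p)^-1 - (pt p - d)^-1)).
  apply: measurable_funM; first by apply: measurable_indic; exact: measurable_disc.
  apply: measurable_nc; apply: cmeasB; apply: cmeas_inv; first exact: cmeas_pt.
  by apply: cmeasB; [exact: cmeas_pt|exact: cmeas_cst].
have I0 : rintegrable (@lam2 R) (fun p => \1_(disc L) p * nc ((pt p)^-1 - (pt p - d)^-1)).
  apply: (rintegrable_le mf (rintegrableD i1 i2')) => p.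
  by rewrite ger0_norm ?pw// mulr_ge0 ?nc_ge0.
split => //.
apply: le_trans (Rintegral_le I0 (rintegrableD i1 i2') pw) _.
rewrite RintegralD// e2'; apply: le_trans (lerD b1 b2) _.
rewrite -mulrDr ler_wpM2l ?(ltW o0)//.
rewrite [leRHS](_ : _ = 2 * rho + 2 * nc d * (L + nc d) / rho + (2 * rho + 2 * nc d * (L + nc d) / rho)); last by ring.
rewrite lerD2r lerD2l ler_wpM2r ?invr_ge0 ?(ltW rho0)// ler_wpM2l ?lerDl ?nc_ge0//.
by rewrite mulr_ge0 ?nc_ge0.
Qed.

End kernel_difference.

(** * The gauge *)

Section complex_integral_more.
Context d (T : measurableType d) (R : realType).
Variable mu : {measure set T -> \bar R}.

Lemma cint_conj (f : T -> R[i]) : cintegrable mu f ->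
  cint mu (fun x => (f x)^*%C) = (cint mu f)^*%C.
Proof.
move=> [i1 i2]; apply: complex_ext => /=.
  by rewrite /cint/=; congr Rintegral; apply/funext => x; rewrite cre_conj.
rewrite /cint/= -mulN1r -RintegralZl//; congr Rintegral; apply/funext => x.
by rewrite cim_conj mulN1r.
Qed.

Lemma cintegrable_conj (f : T -> R[i]) : cintegrable mu f ->
  cintegrable mu (fun x => (f x)^*%C).
Proof.
move=> If; apply: cintegrable_le (rintegrable_nc If) _.
  by apply: cmeas_conj; exact: cintegrable_meas If.
by move=> x; rewrite nc_conj.
Qed.

Lemma cint_sum (N : nat) (F : nat -> T -> R[i]) : (forall m, cintegrable mu (F m)) ->
  cintegrable mu (fun x => \sum_(m < N) F m x) /\
  cint mu (fun x => \sum_(m < N) F m x) = \sum_(m < N) cint mu (F m).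
Proof.
move=> IF; elim: N => [|N [IH1 IH2]].
  under [X in cintegrable _ X]eq_fun do rewrite big_ord0.
  under [X in cint _ X]eq_fun do rewrite big_ord0.
  rewrite big_ord0; split.
    by split => /=; exact: integrable0.
  by apply: complex_ext; rewrite /cint/= /Rintegral integral0.
under [X in cintegrable _ X]eq_fun do rewrite big_ord_recr.
under [X in cint _ X]eq_fun do rewrite big_ord_recr.
rewrite big_ord_recr/=; split; first exact: cintegrableD.
by rewrite cintD// IH2.
Qed.

End complex_integral_more.

Lemma conj_sum (R : rcfType) (N : nat) (F : 'I_N -> R[i]) :
  (\sum_(m < N) F m)^*%C = \sum_(m < N) (F m)^*%C.
Proof. exact: (rmorph_sum (@conjc R)). Qed.

Lemma conjX (R : rcfType) (x : R[i]) (N : nat) : (x ^+ N)^*%C = x^*%C ^+ N.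
Proof. exact: (rmorphXn (@conjc R)). Qed.

Section geometric.
Variable R : realType.
Implicit Types (y z : R[i]).

(* Truncated expansion of 1/(y^-1 - z). *)
Definition rker (N : nat) y z : R[i] := \sum_(m < N) y ^+ m.+1 * z ^+ m.

Lemma rkerE N y z : y != 0 -> y^-1 - z != 0 ->
  rker N y z = (y^-1 - z)^-1 * (1 - (y * z) ^+ N).
Proof.
move=> y0 yz; apply: (mulfI yz); rewrite mulrA divff// mul1r.
elim: N => [|N IH]; first by rewrite /rker big_ord0 mulr0 expr0 subrr.
rewrite /rker big_ord_recr/= mulrDr -/(rker N y z) IH.
by rewrite exprS [in RHS]exprS !exprMn mulrBl; field.
Qed.

Lemma nc_rker_le N y z (s t : R) : nc y <= s -> nc z <= t -> s * t <= 1 ->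
  nc (rker N y z) <= N%:R * s.
Proof.
move=> ys zt st; have s0 := le_trans (nc_ge0 _) ys; have t0 := le_trans (nc_ge0 _) zt.
rewrite /rker; elim: N => [|N IH]; first by rewrite big_ord0 nc0 mul0r.
rewrite big_ord_recr/= (le_trans (ncD _ _))// -natr1 mulrDl mul1r lerD//.
rewrite exprS -mulrA ncM -[leRHS]mulr1 ler_pM ?nc_ge0//.
rewrite -exprMn ncX ncM; apply: exprn_ile1; first by rewrite mulr_ge0 ?nc_ge0.
by apply: le_trans st; rewrite ler_pM ?nc_ge0.
Qed.

(** A geometric series of ratio 1/2 gives a bound free of [N], as needed for bounded |z_j|. The
    bound of [nc_rker_le], which grows with [N], only enters the constant [B] of [gauge]. *)
Lemma nc_rker_le2 N y z (s t : R) : nc y <= s -> nc z <= t -> s * t <= 2^-1 ->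
  nc (rker N y z) <= 2 * s.
Proof.
move=> ys zt st; have s0 := le_trans (nc_ge0 _) ys; have t0 := le_trans (nc_ge0 _) zt.
suff H : nc (rker N y z) <= s * (2 - 2 * (2^-1) ^+ N).
  apply: le_trans H _; rewrite mulrC ler_wpM2r// gerBl.
  by rewrite mulr_ge0// exprn_ge0.
rewrite /rker; elim: N => [|N IH]; first by rewrite big_ord0 nc0 expr0 mulr1 subrr mulr0.
rewrite big_ord_recr/= (le_trans (ncD _ _))//.
have -> : s * (2 - 2 * 2^-1 ^+ N.+1) = s * (2 - 2 * 2^-1 ^+ N) + s * 2^-1 ^+ N.
  by rewrite exprS; field.
rewrite lerD// exprS -mulrA ncM ler_pM ?nc_ge0//.
rewrite -exprMn ncX; apply: lerXn2r; rewrite ?nnegrE ?nc_ge0//.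
by rewrite ncM; apply: le_trans st; rewrite ler_pM ?nc_ge0.
Qed.

End geometric.

Lemma Sm_sum (R : realType) (n N : nat) (F : nat -> Cn R n -> R[i]) :
  (forall m, Sm (F m)) -> Sm (fun z => \sum_(m < N) F m z).
Proof.
move=> sF; elim: N => [|N IH].
  by under [X in Sm X]eq_fun do rewrite big_ord0; exact: Sm_cst.
by under [X in Sm X]eq_fun do rewrite big_ord_recr; exact: Sm_add.
Qed.

Lemma dbar_sum0 (R : realType) (n N : nat) (j : 'I_n) (F : nat -> Cn R n -> R[i]) z :
  (forall m, Sm (F m)) -> (forall m, dbar j (F m : Cn R n -> R[i]^o) z = 0) ->
  dbar j (fun z => \sum_(m < N) F m z) z = 0.
Proof.
move=> sF dF; elim: N => [|N IH].
  by under [X in dbar j X]eq_fun do rewrite big_ord0; rewrite dbar_cst.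
under [X in dbar j X]eq_fun do rewrite big_ord_recr.
by rewrite (dbar_add j (Sm_sum N sF) (sF N)) dF addr0; exact: IH.
Qed.

Section solve.
Variables (R : realType) (n : nat) (j : 'I_n) (L : R).
Hypothesis L0 : 0 < L.
Local Notation E := (Cn R n).
Implicit Types (z : E) (s : E -> R[i]).

Let c : R := (omega R)^-1.
Let c0 : 0 < c. Proof. by rewrite invr_gt0 omega_gt0. Qed.

(* The Cauchy transform in the [j]-th variable. *)
Definition solve s : E -> R[i] := cconv j (fun p => - c%:C * ckern L p) s.

Let kL : kern (fun p => - c%:C * ckern L p). Proof. exact: kern_ckern. Qed.

Lemma Sm_solve s : Sm s -> Sm (solve s).
Proof. by move=> ss; exact: Sm_cconv. Qed.

(** The derivative falls on [s] and the Cauchy-Pompeiu formula returns [s z]; the sign in the kernel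
    compensates for translating by [+ p]. The truncation at [L] is not felt where the source lies
    within [L - 1] of [z] on the slice. *)
Lemma dbar_solve s z : Sm s -> (forall p, L - 1 <= nc (pt p) -> s (slide j z p) = 0) ->
  dbar j (solve s : E -> R[i]^o) z = s z.
Proof.
move=> ss s0; rewrite /solve (dbar_cconv j j kL ss) /cconv.
have LL : L - 1 + 1 <= L by rewrite subrK.
have := cauchy_pompeiu ss L0 LL s0.
have sds := Sm_dbar j ss.
have kc : kern (ckern L).
  have := kern_ckern 1 L0; congr kern; apply/funext => p; by rewrite mul1r.
have ID := cconv_integrable j z kc (Sm_locbounded sds) (Sm_cmeas sds).
move: ID; move: (dbar j (s : E -> R[i]^o) : E -> R[i]) => g ID.
have -> : (fun p => g (slide j z p) * (- c%:C * ckern L p)) =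
    (fun p => - c%:C * (g (slide j z p) * ckern L p)).
  by apply/funext => p; rewrite mulrCA.
rewrite (cintZ _ ID) => ->.
rewrite mulrA mulrNN -rmorphM/= mulVf ?mul1r//.
by rewrite gt_eqF// omega_gt0.
Qed.

Lemma solve0 s z : (forall p, s (slide j z p) = 0) -> solve s z = 0.
Proof.
move=> s0; rewrite /solve /cconv.
rewrite [X in cint _ X](_ : _ = fun=> (0 : R)%:C); first by rewrite cint_real /Rintegral integral0.
by apply/funext => p; rewrite s0 mul0r.
Qed.

Lemma nc_solve s z (B : R) : Sm s -> 0 <= B -> (forall p, nc (s (slide j z p)) <= B) ->
  nc (solve s z) <= 2 * L * B.
Proof.
move=> ss B0 sB; have [Id bd] := inv_integrable L0.
have Ih := rintegrableZ (B * c) Id.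
have Is := cconv_integrable j z kL (Sm_locbounded ss) (Sm_cmeas ss).
apply: le_trans (nc_cint_le Is Ih _) _.
  move=> p; rewrite ncM ncM ncN nc_real (gtr0_norm c0) nc_ckern -[leRHS]mulrA.
  by rewrite ler_wpM2r// mulr_ge0 ?(ltW c0)// divr_ge0 ?nc_ge0.
rewrite RintegralZl//; apply: le_trans (ler_wpM2l (mulr_ge0 B0 (ltW c0)) bd) _.
rewrite le_eqVlt; apply/orP; left; apply/eqP.
rewrite /c; field; by rewrite gt_eqF// omega_gt0.
Qed.

End solve.

Section gauge.
Variables (R : realType) (n : nat) (j : 'I_n).
Local Notation E := (Cn R n).
Local Notation "\int2 h" := (Rintegral (@lam2 R) setT h) (at level 50).
Local Notation db f := (dbar j (f : E -> R[i]^o) : E -> R[i]).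
Implicit Types (z : E) (p : plane R).

(** It labels the complex line through [z] in the [j]-th direction: functions of [zero_at z] are
    functions of the other variables. *)
Definition zero_at z : E := z - z 0 j *: dir_x R j.

Lemma zero_atE z : zero_at z 0 j = 0.
Proof. by rewrite /zero_at /dir_x !mxE !eqxx/= mulr1 subrr. Qed.

Variables (M R2 : R) (V : E -> R[i]).
Hypotheses (M0 : 0 <= M) (R2_1 : 1 <= R2) (sV : Sm V) (VM : forall z, nc (V z) <= M).
Hypothesis V0 : forall z, R2 <= nc (z 0 j) -> V z = 0.

Let c : R := (omega R)^-1.
(** For |z_j| <= R2 the source seen from [z] lies within [2 * R2], to which the unit margin is
    added. The radius [S] of the reflecting circle exceeds [R2] by 1, so that the reflected pole
    keeps distance at least 1 from the support of [V]. *)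
Let Mk : R := 2 * R2 + 1.
Let S : R := R2 + 1.

Let c0 : 0 < c. Proof. by rewrite invr_gt0 omega_gt0. Qed.
Let Mk0 : 0 < Mk. Proof. by rewrite /Mk; move: R2_1; lra. Qed.
Let S0 : 0 < S. Proof. by rewrite /S; move: R2_1; lra. Qed.

Definition gauge1 : E -> R[i] := solve j Mk V.

Let k1 : kern (fun p => - c%:C * ckern Mk p). Proof. exact: kern_ckern. Qed.

Lemma Sm_gauge1 : Sm gauge1.
Proof. exact: Sm_solve. Qed.

Lemma slide_coord z p : slide j z p 0 j = z 0 j + pt p.
Proof. by rewrite slideE eqxx. Qed.

Let Vfar z p : nc (z 0 j) <= R2 -> 2 * R2 <= nc (pt p) -> V (slide j z p) = 0.
Proof.
move=> zR pR; apply: V0; rewrite slide_coord.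
have := ncB (z 0 j + pt p) (z 0 j); rewrite addrAC subrr add0r; lra.
Qed.

Lemma dbar_gauge1 z : nc (z 0 j) <= R2 -> db gauge1 z = V z.
Proof.
move=> zR; apply: dbar_solve => // p; rewrite /Mk addrK; exact: Vfar.
Qed.

Let k2 : kern (fun p => (c * \1_(disc Mk) p)%:C).
Proof.
split; first by apply: cintegrable_real; exact: disc_integrable.
exists Mk => [|p pM]; first exact: ltW.
rewrite indicE memNset ?mulr0//.
by rewrite /disc/= => /lt_gtF; rewrite pM.
Qed.

(** Integrated over a slice, these are the conjugated moments of [V]. For |z_j| <= R2 they depend on
    the other variables only, which makes [gauge2] a polynomial in z_j there. *)
Let g (m : nat) : E -> R[i] := fun z => (V z * z 0 j ^+ m)^*%C.

Let sg m : Sm (g m).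
Proof.
by apply: Sm_conj; apply: Sm_mul => //; apply: Sm_exp; exact: Sm_coord.
Qed.

(* On [|z_j| = R2] this has almost the real part of [gauge1]: expanding
   [1 / (y^-1 - x)] with [y^-1] the reflection of [z_j] in the circle [|z_j| = S]
   gives its conjugate, up to a truncation error. *)
Definition gauge2 (N : nat) : E -> R[i] := fun z =>
  \sum_(m < N) (z 0 j / (S ^+ 2)%:C) ^+ m.+1 *
    cconv j (fun p => (c * \1_(disc Mk) p)%:C) (g m) z.

Let sterm m : Sm (fun z => (z 0 j / (S ^+ 2)%:C) ^+ m.+1 *
    cconv j (fun p => (c * \1_(disc Mk) p)%:C) (g m) z).
Proof.
apply: Sm_mul; last exact: Sm_cconv.
by apply: Sm_exp; apply: Sm_mul; [exact: Sm_coord|exact: Sm_cst].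
Qed.

Lemma Sm_gauge2 N : Sm (gauge2 N).
Proof. exact: (Sm_sum N sterm). Qed.

(** The convolution kernel is constant on a disc containing the support of the differentiated
    source, so the derivative of each moment is the integral of a d-bar derivative with compact
    support. *)
Lemma dbar_gauge2 N z : nc (z 0 j) <= R2 -> db (gauge2 N) z = 0.
Proof.
move=> zR; apply: (dbar_sum0 N sterm) => m.
have scl : Sm (fun z : E => z 0 j / (S ^+ 2)%:C).
  by apply: Sm_mul; [exact: Sm_coord|exact: Sm_cst].
have dcl : db (fun z : E => z 0 j / (S ^+ 2)%:C) z = 0.
  by rewrite (dbar_mul j (Sm_coord _ j) (Sm_cst _ _)) dbar_coord dbar_cst mulr0 mul0r addr0.
rewrite (dbar_mul j (Sm_exp m.+1 scl) (Sm_cconv j k2 (sg m))).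
rewrite (dbar_expn0 m.+1 scl dcl) mul0r addr0 (dbar_cconv j j k2 (sg m)) /cconv.
have gfar p : 2 * R2 <= nc (pt p) -> g m (slide j z p) = 0.
  by move=> pR; rewrite /g Vfar// mul0r conjc0.
have dgfar p : Mk <= nc (pt p) -> db (g m) (slide j z p) = 0.
  by move=> pM; exact: (dbar_slide_out (sg m) gfar pM).
have := int_dbar0 (sg m) gfar.
have -> : (fun p => db (g m) (slide j z p) * (c * \1_(disc Mk) p)%:C) =
    (fun p => c%:C * db (g m) (slide j z p)).
  apply/funext => p; rewrite mulrC; have [pM|pM] := ltP (nc (pt p)) Mk.
    by rewrite indicE mem_set// mulr1.
  by rewrite dgfar// !mulr0.
move=> e; have Ig := Sm_supp_integrable (Sm_dbar j (sg m)) dgfar.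
by rewrite (cintZ _ Ig) e !mulr0.
Qed.

Let y z : R[i] := (z 0 j)^*%C / (S ^+ 2)%:C.

Let q N z p : R[i] := V (slide j z p) *
  ((c * \1_(disc Mk) p)%:C * rker N (y z) (z 0 j + pt p)).

(** Conjugation turns the powers of z_j / S^2 into powers of [y z] and the moments into those of [V]
    itself; under the integral sign the sum is then [rker]. *)
Lemma conj_gauge2 N z : cintegrable (@lam2 R) (q N z) /\
  (gauge2 N z)^*%C = cint (@lam2 R) (q N z).
Proof.
pose F m p : R[i] := V (slide j z p) * (z 0 j + pt p) ^+ m * (c * \1_(disc Mk) p)%:C.
have I0 m := cconv_integrable j z k2 (Sm_locbounded (sg m)) (Sm_cmeas (sg m)).
have FE m : F m = (fun p => (g m (slide j z p) * (c * \1_(disc Mk) p)%:C)^*%C).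
  by apply/funext => p; rewrite /g slide_coord conjM conjcK conjc_real.
have IF m : cintegrable (@lam2 R) (fun p => y z ^+ m.+1 * F m p).
  by apply: cintegrableZ; rewrite FE; apply: cintegrable_conj; exact: I0.
have [Is es] := cint_sum N IF.
have qE : q N z = (fun p => \sum_(m < N) y z ^+ m.+1 * F m p).
  apply/funext => p; rewrite /q /rker 2!mulr_sumr; apply: eq_bigr => m _.
  by rewrite /F; ring.
rewrite qE; split => //; rewrite es /gauge2 conj_sum; apply: eq_bigr => m _.
have yz : (z 0 j / (S ^+ 2)%:C)^*%C = y z by rewrite conjM conjc_inv conjc_real.
rewrite conjM conjX yz.
rewrite (cintZ _ _) ?FE; last by apply: cintegrable_conj; exact: I0.
by rewrite (cint_conj (I0 m)).
Qed.

Let nc_y z : nc (z 0 j) <= R2 -> nc (y z) <= S^-1.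
Proof.
move=> zR; rewrite /y ncM ncV nc_conj nc_real ger0_norm ?exprn_ge0 ?(ltW S0)//.
rewrite ler_pdivrMr ?exprn_gt0// expr2 mulKf ?gt_eqF//.
by apply: le_trans zR _; rewrite /S lerDl.
Qed.

Let t1 z p : R[i] := V (slide j z p) * (- c%:C * ckern Mk p).

Let It1 z : cintegrable (@lam2 R) (t1 z).
Proof. exact: (cconv_integrable j z k1 (Sm_locbounded sV) (Sm_cmeas sV)). Qed.

(** Real parts do not distinguish [gauge2] from its conjugate, which is an integral against the same
    [V] as [gauge1], so the two kernels can be subtracted. *)
Lemma Re_gauge N z : complex.Re (gauge1 z - gauge2 N z) =
  complex.Re (cint (@lam2 R) (fun p => t1 z p - q N z p)).
Proof.
have [Iq e] := conj_gauge2 N z.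
by rewrite (cintB (It1 z) Iq) -e !(creD, creN) cre_conj.
Qed.

Lemma int_disc (L : R) : 0 < L -> \int2 (fun p => \1_(disc L) p) <= (2 * L) ^+ 2.
Proof.
move=> L0; rewrite (Rintegral_indic _ (measurable_disc L)) -lee_fin fineK.
  exact: lam2_disc_le.
by rewrite ge0_fin_numE//; exact: lam2_disc_fin.
Qed.

(** [d] is the vector from z_j to its reflection. Up to the truncation factor, [rker] is -1/(p - d),
    so what is integrated against [V] is a difference of translated kernels, as in [inv_diff_int].
    The condition on [N] reduces the truncation to the final summand 1. *)
Lemma gauge_outer N z (rho d0 : R) : 0 < rho -> 0 < nc (z 0 j) -> nc (z 0 j) <= R2 ->
  let d := (S ^+ 2)%:C / (z 0 j)^*%C - z 0 j in nc d <= d0 ->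
  (R2 / S) ^+ N * (c * (2 * Mk) ^+ 2) <= 1 ->
  `|complex.Re (gauge1 z - gauge2 N z)| <= M * (4 * rho + 4 * d0 * (Mk + d0) / rho + 1).
Proof.
move=> rho0 z0 zR d dd0 HN; rewrite Re_gauge; apply: le_trans (nc_ge_Re _) _.
have [Iq _] := conj_gauge2 N z.
have [Id bd] := inv_diff_int d rho0 Mk0.
have o0 := @omega_gt0 R.
pose th := (R2 / S) ^+ N.
have th0 : 0 <= th by rewrite exprn_ge0// divr_ge0 ?(ltW S0)//; move: R2_1; lra.
pose h p := M * c * (\1_(disc Mk) p * nc ((pt p)^-1 - (pt p - d)^-1)) + M * c * th * \1_(disc Mk) p.
have Ih : rintegrable (@lam2 R) h.
  by apply: rintegrableD; [exact: rintegrableZ|exact: disc_integrable].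
have pw p : nc (t1 z p - q N z p) <= h p.
  have hp : 0 <= h p.
    by rewrite /h addr_ge0// ?mulr_ge0 ?nc_ge0 ?(ltW c0).
  have [far|near] := leP R2 (nc (slide j z p 0 j)).
    by rewrite /t1 /q V0// !mul0r subrr nc0.
  rewrite slide_coord in near.
  have pM : nc (pt p) < Mk.
    have := ncB (z 0 j + pt p) (z 0 j); rewrite addrAC subrr add0r /Mk; move: near zR; lra.
  have zj0 : z 0 j != 0 by rewrite -nc_gt0.
  have cz0 : (z 0 j)^*%C != 0 by rewrite conjc_eq0.
  have SC : (S ^+ 2)%:C != 0 :> R[i].
    by rewrite -nc_eq0 nc_real normr_eq0 expf_neq0// gt_eqF.
  have yV : (y z)^-1 = (S ^+ 2)%:C / (z 0 j)^*%C by rewrite /y invf_div.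
  have nzs : S <= nc ((S ^+ 2)%:C / (z 0 j)^*%C).
    rewrite ncM nc_real ncV nc_conj ger0_norm ?exprn_ge0 ?(ltW S0)//.
    rewrite ler_pdivlMr// expr2 ler_wpM2l ?(ltW S0)//.
    by apply: le_trans zR _; rewrite /S lerDl.
  have pdE : pt p - d = - ((y z)^-1 - (z 0 j + pt p)) by rewrite yV /d; ring.
  have pd1 : 1 <= nc (pt p - d).
    rewrite pdE ncN; have := nc_dist ((y z)^-1) (z 0 j + pt p).
    move=> /(le_trans (ler_norm _)); apply: le_trans.
    by rewrite yV; move: nzs near; rewrite /S; lra.
  have pd0 : (y z)^-1 - (z 0 j + pt p) != 0.
    by rewrite -nc_gt0 -ncN -pdE (lt_le_trans ltr01).
  have y0 : y z != 0 by rewrite mulf_neq0// invr_neq0.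
  rewrite /t1 /q (rkerE N y0 pd0) /ckern indicE mem_set// mulr1.
  have -> : ((y z)^-1 - (z 0 j + pt p))^-1 = - (pt p - d)^-1.
    by rewrite pdE invrN opprK.
  set Y := (_ ^+ N).
  have -> : V (slide j z p) * (- c%:C * (1 / pt p)) -
     V (slide j z p) * (c%:C * (- (pt p - d)^-1 * (1 - Y))) =
    - (V (slide j z p) * c%:C) * (((pt p)^-1 - (pt p - d)^-1) + (pt p - d)^-1 * Y).
    by rewrite div1r; ring.
  rewrite ncM ncN ncM nc_real gtr0_norm//.
  have nY : nc Y <= th.
    rewrite ncX /th; apply: lerXn2r; rewrite ?nnegrE ?nc_ge0//.
      by rewrite divr_ge0 ?(ltW S0)//; move: R2_1; lra.
    rewrite ncM mulrC ler_pM ?nc_ge0//; first exact: ltW.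
    by apply: le_trans (nc_y zR) _.
  apply: le_trans (ler_wpM2l _ (ncD _ _)) _.
    by rewrite mulr_ge0 ?nc_ge0// ltW.
  rewrite mulrDr /h indicE mem_set// !mul1r mulr1 lerD//.
    by rewrite ler_wpM2r ?nc_ge0// ler_wpM2r ?(ltW c0).
  rewrite ler_pM ?mulr_ge0 ?nc_ge0 ?(ltW c0)//; first by rewrite ler_wpM2r ?(ltW c0).
  rewrite ncM ncV -[th]mul1r ler_pM ?invr_ge0 ?nc_ge0//.
  by rewrite invf_le1// (lt_le_trans ltr01).
have Itq : cintegrable (@lam2 R) (fun p => t1 z p - q N z p) by exact: cintegrableB.
apply: le_trans (nc_cint_le Itq Ih pw) _.
rewrite /h RintegralD//; [|exact: rintegrableZ|exact: disc_integrable].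
rewrite !RintegralZl//; last exact: rintegrable_indic (measurable_disc _) (lam2_disc_fin _).
have Mc0 : 0 <= M * c by rewrite mulr_ge0// ltW.
apply: le_trans (lerD (ler_wpM2l Mc0 bd) (ler_wpM2l (mulr_ge0 Mc0 th0) (int_disc Mk0))) _.
rewrite [leRHS]mulrDr mulr1; apply: lerD.
  have E x : M * c * (omega R * x) = M * x.
    by rewrite mulrA -[M * c * _]mulrA mulVf ?mulr1// gt_eqF.
  rewrite E ler_wpM2l// lerD2l.
  rewrite ler_wpM2r ?invr_ge0 ?(ltW rho0)//.
  have dn := nc_ge0 d; have d00 := le_trans dn dd0.
  apply: ler_pM; [by rewrite mulr_ge0|by rewrite addr_ge0 ?(ltW Mk0)| |].
    by rewrite ler_wpM2l.
  by rewrite lerD2l.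
rewrite -[leRHS]mulr1 -!mulrA ler_wpM2l//; apply: le_trans HN.
by rewrite le_eqVlt; apply/orP; left; apply/eqP; rewrite -/th; ring.
Qed.

Let far0 z p : R2 <= nc (pt p) -> V (slide j (zero_at z) p) = 0.
Proof. by move=> pR; apply: V0; rewrite slide_coord zero_atE add0r. Qed.

Let R20 : 0 < R2. Proof. exact: lt_le_trans R2_1. Qed.
Let R2Mk : R2 <= Mk. Proof. by rewrite /Mk; move: R2_1; lra. Qed.
Let Mc0 : 0 <= M * c. Proof. by rewrite mulr_ge0// ltW. Qed.

Let in_disc (L : R) p : nc (pt p) < L -> \1_(disc L) p = 1 :> R.
Proof. by move=> pL; rewrite indicE mem_set. Qed.

Let MoE x : M * c * (omega R * x) = M * x.
Proof. by rewrite mulrA -[M * c * _]mulrA mulVf ?mulr1// gt_eqF// omega_gt0. Qed.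

(** Seen from z_j = 0 the source lies in the disc of radius [R2]; integrating the kernel over its
    full disc, of radius [Mk], would more than double the constant. *)
Lemma gauge1_proj z : nc (gauge1 (zero_at z)) <= 2 * M * R2.
Proof.
have [Id bd] := inv_integrable R20.
have Ih := rintegrableZ (M * c) Id.
apply: le_trans (nc_cint_le (It1 (zero_at z)) Ih _) _.
  move=> p; have [pR|pR] := ltP (nc (pt p)) R2; last first.
    by rewrite /t1 far0// mul0r nc0 mulr_ge0// divr_ge0 ?nc_ge0.
  rewrite /t1 ncM ncM ncN nc_real (gtr0_norm c0) nc_ckern -[leRHS]mulrA.
  rewrite (in_disc pR) (in_disc (lt_le_trans pR R2Mk)) ler_wpM2r//.
  by rewrite mulr_ge0 ?(ltW c0)// divr_ge0 ?nc_ge0.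
rewrite RintegralZl//; apply: le_trans (ler_wpM2l Mc0 bd) _.
by rewrite [_ * omega R]mulrC MoE le_eqVlt; apply/orP; left; apply/eqP; ring.
Qed.

Lemma gauge1_crude z : nc (gauge1 z) <= 2 * M * Mk.
Proof.
by apply: le_trans (nc_solve Mk0 sV M0 (fun p => VM _)) _; rewrite mulrAC.
Qed.

(** Shifting the integration variable by z_j makes both integrals run over the same values of [V];
    their kernels are then translates of each other by z_j. *)
Lemma gauge1_diff z (rho : R) : 0 < rho -> nc (z 0 j) <= R2 ->
  nc (gauge1 z - gauge1 (zero_at z)) <=
    M * (4 * rho + 4 * nc (z 0 j) * (R2 + nc (z 0 j)) / rho).
Proof.
move=> rho0 zR.
pose a : plane R := (- complex.Re (z 0 j), - complex.Im (z 0 j)).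
have [Is es] := cint_shift a (It1 z).
rewrite -[gauge1 z]/(cint (@lam2 R) (t1 z)) -es -[gauge1 (zero_at z)]/(cint (@lam2 R) (t1 (zero_at z))).
rewrite -(cintB Is (It1 (zero_at z))).
have [Id bd] := inv_diff_int (z 0 j) rho0 R20.
have Ih := rintegrableZ (M * c) Id.
apply: le_trans (nc_cint_le (cintegrableB Is (It1 (zero_at z))) Ih _) _; last first.
  by rewrite RintegralZl//; apply: le_trans (ler_wpM2l Mc0 bd) _; rewrite MoE.
move=> p; have pa : pt (shift2 a p) = pt p - z 0 j by exact: shift_opp.
have sE : slide j z (shift2 a p) = slide j (zero_at z) p.
  rewrite /slide pa scalerBl /zero_at.
  by rewrite addrA addrAC.
move: (shift2 a p) pa sE => p' pa sE; rewrite /t1 {}sE.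
have [pR|pR] := ltP (nc (pt p)) R2; last first.
  by rewrite far0// !mul0r subrr nc0 mulr_ge0// mulr_ge0 ?nc_ge0.
have pd : nc (pt p') < Mk.
  rewrite pa (le_lt_trans (ncB _ _))// /Mk; move: pR zR; lra.
rewrite /ckern (in_disc pd) (in_disc pR) (in_disc (lt_le_trans pR R2Mk)) pa !mul1r.
rewrite (_ : _ - _ = V (slide j (zero_at z) p) * (c%:C * ((pt p)^-1 - (pt p - z 0 j)^-1))); last by ring.
rewrite ncM ncM nc_real (gtr0_norm c0) -[leRHS]mulrA ler_wpM2r//.
by rewrite mulr_ge0 ?nc_ge0// ltW.
Qed.

Lemma gauge2_le N z (K : R) : nc (z 0 j) <= R2 -> 0 <= K ->
  (forall x, nc x <= R2 -> nc (rker N (y z) x) <= K) ->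
  nc (gauge2 N z) <= M * c * K * (2 * Mk) ^+ 2.
Proof.
move=> zR K0 HK; rewrite -nc_conj; have [Iq ->] := conj_gauge2 N z.
have Ih := disc_integrable Mk (M * c * K).
apply: le_trans (nc_cint_le Iq Ih _) _.
  move=> p; have [far|near] := leP R2 (nc (slide j z p 0 j)).
    by rewrite /q V0// mul0r nc0 mulr_ge0// mulr_ge0.
  rewrite slide_coord in near.
  rewrite /q ncM ncM nc_real ger0_norm; last by rewrite mulr_ge0// ltW.
  rewrite -!mulrA ler_pM ?nc_ge0//.
    by rewrite mulr_ge0 ?(ltW c0)// mulr_ge0 ?nc_ge0.
  rewrite ler_wpM2l ?(ltW c0)// mulrC ler_wpM2r//.
  by apply: HK; exact: ltW.
rewrite RintegralZl//; last exact: rintegrable_indic (measurable_disc _) (lam2_disc_fin _).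
by rewrite ler_wpM2l ?mulr_ge0// ?(ltW c0)//; exact: int_disc.
Qed.

End gauge.

Lemma expn_small (R : realType) (x e : R) : 0 <= x -> x < 1 -> 0 < e ->
  exists N, x ^+ N <= e.
Proof.
move=> x0 x1 e0.
have h : `|x| < 1 by rewrite ger0_norm.
have /cvgrPdist_le /(_ e e0)[N _ HN] := cvg_expr h.
exists N; have := HN N (leqnn _); rewrite /= sub0r normrN ger0_norm// exprn_ge0//.
Qed.

(* The factor 2 of the decay hypothesis comes from the last bound. *)
Lemma gauge (R : realType) (n : nat) (j : 'I_n) (r : R) : 0 <= r ->
  exists2 K : R, 0 <= K & forall R2 : R, 4 * (r + 2) <= R2 -> forall M : R, 0 <= M ->
  exists B : R, forall V : Cn R n -> R[i], Sm V -> (forall z : Cn R n, nc (V z) <= M) ->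
    (forall z : Cn R n, R2 <= nc (z 0 j) -> V z = 0) ->
  exists w : Cn R n -> R[i], exists g : Cn R n -> R,
  [/\ Sm w,
     forall z : Cn R n, nc (z 0 j) <= R2 -> dbar j (w : Cn R n -> R[i]^o) z = V z,
     forall z : Cn R n, nc (z 0 j) <= R2 -> `|complex.Re (w z)| <= B,
     forall z : Cn R n, R2 - 2 <= nc (z 0 j) -> nc (z 0 j) <= R2 - 1 ->
       `|complex.Re (w z)| <= K * M * Num.sqrt R2 &
     forall z : Cn R n, nc (z 0 j) <= r ->
       `|complex.Re (w z) - g (zero_at j z)| <= K * M * Num.sqrt R2 /\
       `|g (zero_at j z)| <= 2 * M * R2].
Proof.
move=> r0; pose c : R := (omega R)^-1.
have c0 : 0 < c by rewrite invr_gt0 omega_gt0.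
(* The outer bound needs 197 = 4 + 192 + 1, with 192 controlling [4 * 12 * (Mk + 12) / rho]; the
   other two terms bound, for |z_j| <= r, the variation of [gauge1] and the size of [gauge2]. *)
exists (197 + 8 * r + 32 * r * c).
  by rewrite !addr_ge0// !mulr_ge0// ltW.
move=> R2 rR2 M M0.
have R28 : 8 <= R2 by lra.
have R2_1 : 1 <= R2 by lra.
have R20 : 0 < R2 by lra.
pose S := R2 + 1; have S0 : 0 < S by rewrite /S; lra.
pose Mk := 2 * R2 + 1; have Mk0 : 0 < Mk by rewrite /Mk; lra.
(* This choice balances the two terms of [inv_diff_int]. *)
pose rho := Num.sqrt R2; have rho0 : 0 < rho by rewrite sqrtr_gt0.
have rr : rho ^+ 2 = R2 by rewrite sqr_sqrtr// ltW.
have rho1 : 1 <= rho by rewrite -[leLHS]sqrtr1 ler_wsqrtr.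
(* [N] depends on [R2] alone, hence the constant [B] below, in which it occurs, does not depend on
   [V]. *)
have [N HN] : exists N, (R2 / S) ^+ N <= (c * (2 * Mk) ^+ 2)^-1.
  apply: expn_small; first by rewrite divr_ge0 ?ltW.
    by rewrite ltr_pdivrMr// mul1r /S ltrDl.
  by rewrite invr_gt0 mulr_gt0// exprn_gt0// mulr_gt0.
have HN' : (R2 / S) ^+ N * (c * (2 * Mk) ^+ 2) <= 1.
  by rewrite -ler_pdivlMr ?div1r// mulr_gt0// exprn_gt0// mulr_gt0.
exists (2 * M * Mk + M * c * (N%:R * S^-1) * (2 * Mk) ^+ 2) => V sV VM V0.
have ny (z : Cn R n) : nc ((z 0 j)^*%C / (S ^+ 2)%:C) = nc (z 0 j) / S ^+ 2.
  by rewrite ncM ncV nc_conj nc_real ger0_norm ?exprn_ge0 ?(ltW S0).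
pose w z := gauge1 j R2 V z - gauge2 j R2 V N z.
pose g z := complex.Re (gauge1 j R2 V z).
have s1 := Sm_gauge1 j R2_1 sV; have s2 := Sm_gauge2 j R2_1 sV N.
have SS : S ^+ 2 = R2 ^+ 2 + 2 * R2 + 1 by rewrite /S; ring.
have S20 : 0 < S ^+ 2 by rewrite exprn_gt0.
exists w, g; split.
- by apply: Sm_add => //; exact: Sm_opp.
- move=> z zR; rewrite (dbar_add j s1 (Sm_opp s2)).
  have -> : (fun z => - gauge2 j R2 V N z) = (fun z => -1 * gauge2 j R2 V N z).
    by apply/funext => x; rewrite mulN1r.
  rewrite (dbar_mul j (Sm_cst _ (-1)) s2) dbar_cst mul0r addr0.
  by rewrite (dbar_gauge1 R2_1 sV V0 zR) (dbar_gauge2 R2_1 sV V0 N zR) mulr0 addr0.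
- move=> z zR; apply: le_trans (nc_ge_Re _) _; apply: le_trans (ncB _ _) _.
  apply: lerD; first exact: (gauge1_crude j M0 R2_1 sV VM z).
  apply: (gauge2_le M0 R2_1 sV VM V0 zR).
    by rewrite mulr_ge0// invr_ge0 ltW.
  move=> x xR; apply: (@nc_rker_le _ _ _ _ S^-1 R2) => //.
    rewrite ny ler_pdivrMr// expr2 mulKf ?gt_eqF//.
    by apply: le_trans zR _; rewrite /S lerDl.
  by rewrite mulrC ler_pdivrMr// mul1r /S lerDl.
- move=> z z1 z2.
  have z0 : 0 < nc (z 0 j) by lra.
  have zR : nc (z 0 j) <= R2 by lra.
  (* The modulus is (S^2 - |z_j|^2) / |z_j|, where S - |z_j| <= 3 and S + |z_j| is at most four
     times |z_j|. *)
  have d12 : nc ((S ^+ 2)%:C / (z 0 j)^*%C - z 0 j) <= 12.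
    have zj0 : (z 0 j)^*%C != 0 by rewrite conjc_eq0 -nc_gt0.
    have -> : (S ^+ 2)%:C / (z 0 j)^*%C - z 0 j = (S ^+ 2 - nc (z 0 j) ^+ 2)%:C / (z 0 j)^*%C.
      by rewrite rmorphB/= -conj_nc mulrBl -mulrA divff ?mulr1.
    rewrite ncM ncV nc_conj nc_real ger0_norm; last first.
      by rewrite subr_ge0 ler_sqr ?nnegrE ?(ltW S0) ?nc_ge0// /S; lra.
    rewrite ler_pdivrMr// /S; move: (nc (z 0 j)) z1 z2 => a a1 a2.
    by nra.
  have H := gauge_outer M0 R2_1 sV VM V0 rho0 z0 zR d12 HN'.
  apply: le_trans H _; rewrite [leRHS]mulrAC mulrC ler_wpM2r//.
  apply: (@le_trans _ _ (197 * rho)); last first.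
    by rewrite ler_wpM2r ?(ltW rho0)// -addrA lerDl addr_ge0// !mulr_ge0// ltW.
  have h1 : 4 * 12 * (Mk + 12) / rho <= 192 * rho.
    rewrite ler_pdivrMr// -[leRHS]mulrA -expr2 rr /Mk.
    rewrite (_ : 4 * 12 * _ = 96 * R2 + 624); last by ring.
    by move: R28; lra.
  move: h1 rho1; rewrite -/rho -/S -/Mk; move: (4 * 12 * (Mk + 12) / rho) => X; lra.
- move=> z zr.
  have zR : nc (z 0 j) <= R2 by lra.
  split; last first.
    by apply: le_trans (nc_ge_Re _) _; exact: (gauge1_proj M0 R2_1 sV VM V0 z).
  have -> : complex.Re (w z) - g (zero_at j z) =
      complex.Re ((gauge1 j R2 V z - gauge1 j R2 V (zero_at j z)) - gauge2 j R2 V N z).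
    by rewrite /w /g !(creD, creN); ring.
  apply: le_trans (nc_ge_Re _) _; apply: le_trans (ncB _ _) _.
  have H1 := gauge1_diff M0 R2_1 sV VM V0 rho0 zR.
  (* Here |y| <= r / S^2, and [R2 >= 4 * r] puts the geometric series in the range of
     [nc_rker_le2]. *)
  have H2 : nc (gauge2 j R2 V N z) <= M * c * (2 * (r / S ^+ 2)) * (2 * Mk) ^+ 2.
    apply: (gauge2_le M0 R2_1 sV VM V0 zR); first by rewrite mulr_ge0 ?divr_ge0 ?(ltW S20).
    move=> x xR; apply: (@nc_rker_le2 _ _ _ _ _ R2) => //.
      by rewrite ny ler_wpM2r ?invr_ge0 ?(ltW S20).
    rewrite mulrAC ler_pdivrMr// SS; nra.
  apply: le_trans (lerD H1 H2) _.
  have e1 : 4 * nc (z 0 j) * (R2 + nc (z 0 j)) / rho <= 8 * r * rho.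
    rewrite ler_pdivrMr// -[leRHS]mulrA -expr2 rr.
    have n0 := nc_ge0 (z 0 j).
    rewrite (_ : 8 * r * R2 = 4 * r * (2 * R2)); last by ring.
    by apply: ler_pM; rewrite ?mulr_ge0 ?addr_ge0 ?(ltW R20)//; lra.
  (* The powers of [R2] cancel since [Mk <= 2 * S]. *)
  have e2 : c * (2 * (r / S ^+ 2)) * (2 * Mk) ^+ 2 <= 32 * r * c.
    rewrite (_ : _ * _ * _ = (2 * r * c) * ((2 * Mk) ^+ 2 / S ^+ 2)); last by field; rewrite gt_eqF.
    rewrite (_ : 32 * r * c = (2 * r * c) * 16); last by ring.
    rewrite ler_wpM2l ?mulr_ge0 ?(ltW c0)// ler_pdivrMr// SS /Mk.
    by nra.
  have -> : M * (4 * rho + 4 * nc (z 0 j) * (R2 + nc (z 0 j)) / rho) +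
      M * c * (2 * (r / S ^+ 2)) * (2 * Mk) ^+ 2 =
    M * (4 * rho + 4 * nc (z 0 j) * (R2 + nc (z 0 j)) / rho +
      c * (2 * (r / S ^+ 2)) * (2 * Mk) ^+ 2) by ring.
  rewrite -/rho (_ : _ * M * rho = M * ((197 + 8 * r + 32 * r * c) * rho)); last by ring.
  rewrite ler_wpM2l//; apply: le_trans (lerD (lerD (lexx _) e1) e2) _.
  have : 32 * r * c <= 32 * r * c * rho by rewrite ler_peMr// !mulr_ge0// ltW.
  rewrite (_ : (197 + _ + _) * rho = 197 * rho + 8 * r * rho + 32 * r * c * rho); last by ring.
  move: (32 * r * c) (8 * r) rho0 => x y.
  by move: (rho) (x * rho) (y * rho) => a b d; clear; lra.
Qed.

(** * Smooth approximation of measurable functions *)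

Section density.
Variables (R : realType) (n : nat).
Local Notation E := (Cn R n).
Variable mu : {measure set E -> \bar R}.
Variable h : E -> R.
Hypotheses (h0 : forall z, 0 <= h z) (Ih : rintegrable mu h).
Implicit Types (A B : set E) (z : E).
Local Notation Imu f := (Rintegral mu setT f).

Let mh : measurable_fun setT h.
Proof. by move/measurable_int : Ih => /measurable_EFinP. Qed.

Lemma weight_integrable (f : E -> R) M : measurable_fun setT f ->
  (forall z, `|f z| <= M) -> rintegrable mu (fun z => f z * h z).
Proof.
move=> mf fM; apply: (rintegrable_le (h' := fun z => M * h z)).
- exact: measurable_funM.
- exact: rintegrableZ.
- by move=> z; rewrite normrM (ger0_norm (h0 z)) ler_wpM2r.
Qed.

Let I_indic A : measurable A -> rintegrable mu (fun z => \1_A z * h z).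
Proof.
move=> mA; apply: (@weight_integrable _ 1) => [|z]; first exact: measurable_indic.
by rewrite indicE; case: (_ \in _); rewrite /= ?normr1 ?normr0.
Qed.

Lemma exhaust (B : nat -> set E) (e : R) : 0 < e -> (forall k, measurable (B k)) ->
  (forall k m, (k <= m)%N -> B k `<=` B m) ->
  exists N, Imu (fun z => \1_(\bigcup_k B k) z * h z) -
            Imu (fun z => \1_(B N) z * h z) <= e.
Proof.
move=> e0 mB ndB.
have mU : measurable (\bigcup_k B k) by exact: bigcup_measurable.
have ndB' : {homo B : k m / (k <= m)%N >-> (k <= m)%O}.
  by move=> k m km; apply/subsetPset; exact: ndB.
have mh' : measurable_fun setT (fun z => (h z)%:E) by exact/measurable_EFinP.
have cv := ge0_nondecreasing_set_cvg_integral (mu := mu) ndB' mB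
  (fun k => measurable_funTS mh') (fun k x _ => h0 x).
have IE A : measurable A -> (\int[mu]_(x in A) (h x)%:E = (Imu (fun z => \1_A z * h z))%:E)%E.
  move=> mA; rewrite integral_mkcond /Rintegral fineK; last first.
    by apply: integrable_fin_num => //; exact: I_indic.
  apply: eq_integral => z _; rewrite /patch indicE; case: ifP => _.
    by rewrite mul1r.
  by rewrite mul0r.
have cv' : (Imu (fun z => \1_(B k) z * h z)) @[k --> \oo] -->
    Imu (fun z => \1_(\bigcup_k B k) z * h z).
  have := cv; rewrite (IE _ mU).
  by under eq_fun do rewrite (IE _ (mB _)); exact: fine_cvg.
move/cvgrPdist_le : cv' => /(_ e e0)[N _ HN]; exists N.
by apply: le_trans (HN N (leqnn N)); exact: ler_norm.
Qed.

(** Sets whose indicator can be approximated in L^1(h mu) by smooth functions with values in [0, 1].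
    They form a sigma-algebra containing the real coordinate half-spaces, hence include every
    measurable set. The range [0, 1] is what later lets an approximation keep the exact bound
    [M]. *)
Definition app A := measurable A /\ forall e : R, 0 < e ->
  exists F : E -> R, [/\ Sm (fun z => (F z)%:C),
    (forall z, 0 <= F z <= 1) &
    Imu (fun z => `|\1_A z - F z| * h z) <= e].

Lemma Sm_real_measurable (F : E -> R) : Sm (fun z => (F z)%:C) -> measurable_fun setT F.
Proof. by move=> /Sm_cmeas[]. Qed.

Let I_err A F : measurable A -> Sm (fun z => (F z)%:C) -> (forall z, 0 <= F z <= 1) ->
  rintegrable mu (fun z => `|\1_A z - F z| * h z).
Proof.
move=> mA sF F01; apply: (@weight_integrable _ 1).
  apply: measurableT_comp; first exact: normr_measurable.
  by apply: measurable_funB; [exact: measurable_indic|exact: Sm_real_measurable].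
move=> z; rewrite normr_id indicE ler_norml; have /andP[a b] := F01 z.
by case: (_ \in _) => /=; apply/andP; split; lra.
Qed.

Lemma Sm_real_sub1 F : Sm (fun z : E => (F z)%:C) -> Sm (fun z : E => (1 - F z)%:C).
Proof.
move=> sF; have -> : (fun z => (1 - F z)%:C) = (fun z => 1 + - (F z)%:C).
  by apply/funext => z; rewrite rmorphB.
by apply: Sm_add; [exact: Sm_cst|exact: Sm_opp].
Qed.

Lemma Sm_realM F G : Sm (fun z : E => (F z)%:C) -> Sm (fun z : E => (G z)%:C) ->
  Sm (fun z : E => (F z * G z)%:C).
Proof.
move=> sF sG; have -> : (fun z => (F z * G z)%:C) = (fun z => (F z)%:C * (G z)%:C).
  by apply/funext => z; rewrite rmorphM.
exact: Sm_mul.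
Qed.

Lemma app0 : app set0.
Proof.
split; first exact: measurable0.
move=> e e0; exists (fun=> 0); split; [exact: Sm_cst|by move=> z; rewrite lexx ler01|].
apply: le_trans (ltW e0); rewrite le_eqVlt; apply/orP; left; apply/eqP.
rewrite [X in Rintegral _ _ X](_ : _ = fun=> 0); first by rewrite /Rintegral integral0.
by apply/funext => z; rewrite indic0 subrr normr0 mul0r.
Qed.

Lemma appC A : app A -> app (~` A).
Proof.
move=> [mA H]; split; first exact: measurableC.
move=> e e0; have [F [sF F01 FI]] := H e e0; exists (fun z => 1 - F z); split.
- exact: Sm_real_sub1.
- by move=> z; have /andP[a b] := F01 z; apply/andP; split; lra.
- apply: le_trans FI; rewrite le_eqVlt; apply/orP; left; apply/eqP.
  congr Rintegral; apply/funext => z; congr (_ * _).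
  by rewrite -normrN; congr (`|_|); rewrite !indicE in_setC; case: (_ \in _) => /=; ring.
Qed.

(** The complement of a union is approximated by the product of the approximate complements; the
    errors add up. *)
Lemma appU A B : app A -> app B -> app (A `|` B).
Proof.
move=> [mA HA] [mB HB]; split; first exact: measurableU.
move=> e e0; have e2 : 0 < e / 2 by rewrite divr_gt0.
have [F [sF F01 FI]] := HA _ e2; have [G [sG G01 GI]] := HB _ e2.
pose H z := 1 - (1 - F z) * (1 - G z).
have sH : Sm (fun z => (H z)%:C).
  by apply: Sm_real_sub1; apply: Sm_realM; exact: Sm_real_sub1.
have H01 z : 0 <= H z <= 1.
  have /andP[a b] := F01 z; have /andP[a' b'] := G01 z; rewrite /H; apply/andP; split; nra.
exists H; split => //.
rewrite [e]splitr; apply: le_trans (lerD FI GI).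
have I1 := I_err mA sF F01; have I2 := I_err mB sG G01.
rewrite -RintegralD//; apply: Rintegral_le; [|exact: rintegrableD|].
  by apply: I_err => //; exact: measurableU.
move=> z; rewrite -mulrDl ler_wpM2r//.
have /andP[a b] := F01 z; have /andP[a' b'] := G01 z.
rewrite !indicE in_setU /H; case: (_ \in A); case: (_ \in B) => /=.
- rewrite [leRHS](_ : _ = (1 - F z) + (1 - G z)); last by rewrite !ger0_norm; lra.
  rewrite ger0_norm; nra.
- rewrite [leRHS](_ : _ = (1 - F z) + G z); last first.
    by rewrite ger0_norm; [rewrite sub0r normrN ger0_norm|lra].
  rewrite ger0_norm; nra.
- rewrite [leRHS](_ : _ = F z + (1 - G z)); last first.
    by rewrite sub0r normrN ger0_norm// ger0_norm; lra.
  rewrite ger0_norm; nra.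
- rewrite !sub0r !normrN [leRHS](_ : _ = F z + G z); last by rewrite !ger0_norm.
  rewrite ger0_norm; nra.
Qed.

(** It suffices to approximate an increasing union up to the weight of what one stage misses, which
    tends to 0. *)
Lemma app_exhaust (B : nat -> set E) : (forall k, measurable (B k)) ->
  (forall k m, (k <= m)%N -> B k `<=` B m) ->
  (forall N (e : R), 0 < e -> exists F : E -> R, [/\ Sm (fun z => (F z)%:C),
    (forall z, 0 <= F z <= 1) &
    Imu (fun z => `|\1_(\bigcup_k B k) z - F z| * h z) <=
    Imu (fun z => \1_(\bigcup_k B k) z * h z) - Imu (fun z => \1_(B N) z * h z) + e]) ->
  app (\bigcup_k B k).
Proof.
move=> mB ndB H; split; first exact: bigcup_measurable.
move=> e e0; have e2 : 0 < e / 2 by rewrite divr_gt0.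
have [N HN] := exhaust e2 mB ndB; have [F [sF F01 FI]] := H N _ e2.
by exists F; split => //; apply: le_trans FI _; rewrite [leRHS]splitr lerD2r.
Qed.

Lemma app_bigcup (A : nat -> set E) : (forall k, app (A k)) -> app (\bigcup_k A k).
Proof.
move=> HA; pose B N := \bigcup_(k in [set k | (k < N)%N]) A k.
have BS N : B N.+1 = B N `|` A N.
  apply/seteqP; split => z.
    by move=> [k /=]; rewrite ltnS leq_eqVlt => /orP[/eqP ->|kN] Az; [right|left; exists k].
  by move=> [[k /= kN Az]|Az]; [exists k => //=; exact: ltnW|exists N => /=].
have appB N : app (B N).
  elim: N => [|N IH]; last by rewrite BS; exact: appU.
  have -> : B 0%N = set0 by apply/seteqP; split => z // -[].
  exact: app0.
have -> : \bigcup_k A k = \bigcup_k B k.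
  apply/seteqP; split => z; first by move=> [k _ Az]; exists k.+1 => //; exists k => /=.
  by move=> [N _ [k _ Az]]; exists k.
have mB k : measurable (B k) by case: (appB k).
have ndB k m : (k <= m)%N -> B k `<=` B m.
  by move=> km z [i /= ik Az]; exists i => //=; exact: leq_trans km.
apply: app_exhaust => // N e e0.
have [_ /(_ e e0)[F [sF F01 FI]]] := appB N; exists F; split => //.
have mU : measurable (\bigcup_k B k) by exact: bigcup_measurable.
apply: le_trans (lerD (lexx _) FI).
have I1 := I_indic mU; have I2 := I_indic (mB N); have I3 := I_err (mB N) sF F01.
have I4 : rintegrable mu (fun z => \1_(\bigcup_k B k) z * h z - \1_(B N) z * h z).
  exact: (integrableB measurableT I1 I2).
rewrite -RintegralB// -RintegralD//.
apply: Rintegral_le; [exact: I_err|exact: rintegrableD|].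
move=> z; rewrite -mulrBl -mulrDl ler_wpM2r//.
have -> : \1_(\bigcup_k B k) z - F z = (\1_(\bigcup_k B k) z - \1_(B N) z) + (\1_(B N) z - F z) by ring.
apply: le_trans (ler_normD _ _) _; rewrite lerD2r ger0_norm// subr_ge0.
rewrite !indicE; case: (boolP (z \in B N)) => [|_] //=.
by rewrite inE => zN; rewrite mem_set//; exists N.
Qed.

(** A step applied to [f], rising from [a] to [a + N.+1%:R^-1], agrees with the indicator except
    between the stage [B N] and the whole set. *)
Lemma app_half (f : E -> R) (a : R) : Sm (fun z => (f z)%:C) ->
  app [set z | a < f z].
Proof.
move=> sf; have mf := Sm_real_measurable sf.
pose B (k : nat) := [set z | a + k.+1%:R^-1 <= f z].
have mB k : measurable (B k).
  rewrite (_ : B k = f @^-1` `[a + k.+1%:R^-1, +oo[); last first.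
    by apply/seteqP; split => z /=; rewrite in_itv/= andbT.
  by rewrite -[X in measurable X]setTI; apply: mf => //; exact: measurable_itv.
have k0 (k : nat) : 0 < k.+1%:R^-1 :> R by rewrite invr_gt0.
have ndB k m : (k <= m)%N -> B k `<=` B m.
  move=> km z /=; apply: le_trans; rewrite lerD2l lef_pV2 ?posrE//.
  by rewrite ler_nat ltnS.
have UE : [set z | a < f z] = \bigcup_k B k.
  apply/seteqP; split => z /=.
    move=> az; exists (Num.truncn (f z - a)^-1) => //=.
    rewrite /B/= -lerBrDl; apply/ltW; rewrite invf_plt ?posrE ?subr_gt0//.
    exact: truncnS_gt.
  by move=> [k _ /=]; apply: lt_le_trans; rewrite ltrDl.
rewrite UE; apply: app_exhaust => // N e e0.
pose F z := stp a N.+1%:R^-1 (f z).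
have sF : Sm (fun z => (F z)%:C) by exact: (Sm_comp (smoothR_stp a _) sf).
have F01 z : 0 <= F z <= 1 by rewrite stp_ge0 stp_le1.
exists F; split => //.
have mU : measurable (\bigcup_k B k) by exact: bigcup_measurable.
have I1 := I_indic mU; have I2 := I_indic (mB N).
rewrite -RintegralB// -[leLHS]addr0 lerD ?(ltW e0)//.
apply: Rintegral_le; [exact: I_err|exact: (integrableB measurableT I1 I2)|].
move=> z; rewrite -mulrBl ler_wpM2r// -UE !indicE.
have /andP[F0 F1] := F01 z.
have [az|za] := ltP a (f z); last first.
  rewrite memNset ?[z \in B N]memNset /F ?stp_le ?subrr ?normr0//=.
    by rewrite /B/= => /(lt_le_trans (ltr_pwDr (k0 N) (lexx a))); rewrite ltNge za.
  by move=> /=; rewrite ltNge za.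
rewrite mem_set//; have [bz|zb] := leP (a + N.+1%:R^-1) (f z).
  by rewrite mem_set// /F stp_ge// subrr normr0.
rewrite [z \in B N]memNset /=; last by rewrite /B/= leNgt zb.
by rewrite subr0 ger0_norm; lra.
Qed.

Lemma app_sigma_algebra (T : Type) (f : E -> T) :
  sigma_algebra setT [set D : set T | app (f @^-1` D)].
Proof.
split => /=.
- by rewrite preimage_set0; exact: app0.
- by move=> D HD; rewrite setTD preimage_setC; exact: appC.
- by move=> F HF; rewrite preimage_bigcup; exact: app_bigcup.
Qed.

Lemma app_real (f : E -> R) (D : set (measurableTypeR R)) :
  Sm (fun z => (f z)%:C) -> measurable D -> app (f @^-1` D).
Proof.
move=> sf mD; have {mD} : (@ocitv R).-sigma.-measurable D by [].
rewrite RGenOInfty.measurableE; move: D.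
apply: smallest_sub; first exact: app_sigma_algebra.
move=> _ [a ->] /=; rewrite (_ : f @^-1` _ = [set z | a < f z]); first exact: app_half.
by apply/seteqP; split => z /=; rewrite in_itv/= andbT.
Qed.

Lemma app_measurable A : measurable A -> app A.
Proof.
move=> mA; pose re z := [tuple complex.Re (z 0 i) | i < n] : n.-tuple (measurableTypeR R).
pose im z := [tuple complex.Im (z 0 i) | i < n] : n.-tuple (measurableTypeR R).
pose co z := (re z, im z).
have coK z : of_coords (co z) = z.
  by apply/rowP => i; rewrite !mxE !tnth_mktuple; apply: complex_ext.
have -> : A = co @^-1` (@of_coords R n @^-1` A).
  by apply/seteqP; split => z /=; rewrite coK.
have : measurable (@of_coords R n @^-1` A).
  by rewrite -[X in measurable X]setTI; exact: measurable_of_coords.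
move: (_ @^-1` A) => D.
have tupl (f : E -> n.-tuple (measurableTypeR R)) :
    (forall i, Sm (fun z => (tnth (f z) i : R)%:C)) ->
    forall C, measurable C -> app (f @^-1` C).
  move=> sf; apply: smallest_sub; first exact: app_sigma_algebra.
  move=> C /=; rewrite -bigcup_seq => -[i /= _ [B mB <-]].
  rewrite setTI -comp_preimage.
  exact: (app_real (f := fun z => tnth (f z) i)).
have sre i : Sm (fun z => (tnth (re z) i : R)%:C).
  under [X in Sm X]eq_fun do rewrite tnth_mktuple.
  by apply: (Sm_comp (smoothR_id R)); exact: Sm_coord.
have sim i : Sm (fun z => (tnth (im z) i : R)%:C).
  under [X in Sm X]eq_fun => z do rewrite tnth_mktuple.
  have -> : (fun z : E => (complex.Im (z 0 i))%:C) = (fun z => (id (complex.Re (- 'i * z 0 i)))%:C).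
    by apply/funext => z /=; congr (_%:C); rewrite creM/=; ring.
  apply: (Sm_comp (smoothR_id R)); apply: Sm_mul; [exact: Sm_cst|exact: Sm_coord].
move: D; apply: smallest_sub; first exact: app_sigma_algebra.
move=> D /= [[C mC <-]|[C mC <-]]; rewrite setTI -comp_preimage.
  exact: (tupl re sre).
exact: (tupl im sim).
Qed.



(** The first set of the list that contains [z] decides the value, so the sets may overlap. The
    nested convex combinations keep the bound [M] when the indicators are replaced by functions with
    values in [0, 1]. *)
Fixpoint simple (T : Type) (A : T -> set E) (c : T -> R[i]) (l : seq T) z : R[i] :=
  if l is p :: l' then
    (\1_(A p) z)%:C * c p + (1 - \1_(A p) z)%:C * simple A c l' z
  else 0.

Let convex_nc (t M : R) (x y : R[i]) : 0 <= t <= 1 -> nc x <= M -> nc y <= M ->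
  nc (t%:C * x + (1 - t)%:C * y) <= M.
Proof.
move=> /andP[t0 t1] xM yM; apply: le_trans (ncD _ _) _.
rewrite !ncM !nc_real !ger0_norm ?subr_ge0//.
have := ler_wpM2l t0 xM; have := ler_wpM2l (x := 1 - t) _ yM; rewrite subr_ge0 => /(_ t1).
move: (t * nc x) ((1 - t) * nc y) => X Y; rewrite mulrBl mul1r; move: (t * M) => Z; lra.
Qed.

Let indic01 A z : 0 <= (\1_A z : R) <= 1.
Proof. by rewrite indicE; case: (_ \in _); rewrite lexx ler01. Qed.

Lemma simple_bound (T : Type) (A : T -> set E) (c : T -> R[i]) (l : seq T) (M : R) :
  0 <= M -> (forall p, nc (c p) <= M) -> forall z, nc (simple A c l z) <= M.
Proof.
move=> M0 cM z; elim: l => [|p l IH]; first by rewrite nc0.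
exact: convex_nc.
Qed.

Lemma cmeas_simple (T : Type) (A : T -> set E) (c : T -> R[i]) (l : seq T) :
  (forall p, measurable (A p)) -> cmeas (simple A c l).
Proof.
move=> mA; elim: l => [|p l IH] /=; first exact: cmeas_cst.
have m1 : measurable_fun setT (\1_(A p) : E -> R) by exact: measurable_indic.
have m2 : measurable_fun setT (fun z => 1 - \1_(A p) z : R).
  by apply: measurable_funB => //; exact: measurable_cst.
apply: cmeasD; first exact: (cmeasM (cmeas_real m1) (cmeas_cst _ _)).
exact: (cmeasM (cmeas_real m2) IH).
Qed.

Let I_bnd (f : E -> R[i]) M : cmeas f -> (forall z, nc (f z) <= M) ->
  rintegrable mu (fun z => nc (f z) * h z).
Proof.
move=> mf fM; apply: (@weight_integrable _ M); first exact: measurable_nc.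
by move=> z; rewrite ger0_norm ?nc_ge0.
Qed.

Let nc_sub (x y : R[i]) M : nc x <= M -> nc y <= M -> nc (x - y) <= 2 * M.
Proof. by move=> xM yM; apply: le_trans (ncB _ _) _; lra. Qed.

Lemma app_simple (T : Type) (A : T -> set E) (c : T -> R[i]) (l : seq T) (M : R) :
  0 <= M -> (forall p, nc (c p) <= M) -> (forall p, measurable (A p)) ->
  forall e, 0 < e -> exists f, [/\ Sm f, forall z, nc (f z) <= M &
    Imu (fun z => nc (simple A c l z - f z) * h z) <= e].
Proof.
move=> M0 cM mA; elim: l => [|p l IH] /= e e0.
  exists (fun=> 0); split; [exact: Sm_cst|by move=> z; rewrite nc0|].
  apply: le_trans (ltW e0); rewrite le_eqVlt; apply/orP; left; apply/eqP.
  rewrite [X in Rintegral _ _ X](_ : _ = fun=> 0); first by rewrite /Rintegral integral0.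
  by apply/funext => z; rewrite subr0 nc0 mul0r.
have e2 : 0 < e / 2 by rewrite divr_gt0.
have [g [sg gM gI]] := IH _ e2.
have M1 : 0 < 2 * M + 1 by lra.
(* An error in the indicator is multiplied by a difference of two values, at most [2 * M]; the
   summand 1 allows for [M = 0]. *)
have e3 : 0 < e / 2 / (2 * M + 1) by rewrite divr_gt0.
have [_ /(_ _ e3)[F [sF F01 FI]]] := app_measurable (mA p).
pose f z := (F z)%:C * c p + (1 - F z)%:C * g z.
have sf : Sm f.
  by apply: Sm_add; apply: Sm_mul => //; [exact: Sm_cst|exact: Sm_real_sub1].
have fM z : nc (f z) <= M by exact: convex_nc.
exists f; split => //.
have sM := simple_bound A l M0 cM.
have ms := cmeas_simple c l mA; have mg := Sm_cmeas sg.
have I1 := I_err (mA p) sF F01.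
have I2 : rintegrable mu (fun z => nc (simple A c l z - g z) * h z).
  by apply: (@I_bnd _ (2 * M)) => [|z]; [exact: cmeasB|exact: nc_sub].
have I3 := rintegrableZ (2 * M + 1) I1.
apply: (@le_trans _ _ (Imu (fun z => (2 * M + 1) * (`|\1_(A p) z - F z| * h z) +
    nc (simple A c l z - g z) * h z))); last first.
  rewrite RintegralD// RintegralZl// [leRHS]splitr lerD//.
  by rewrite mulrC -ler_pdivlMr.
apply: Rintegral_le; [|exact: rintegrableD|].
  apply: (@I_bnd _ (2 * M)) => [|z].
    apply: cmeasB; last exact: Sm_cmeas.
    exact: (cmeas_simple c (p :: l) mA).
  by apply: nc_sub => //; exact: (simple_bound A (p :: l) M0 cM).
move=> z; rewrite mulrA -mulrDl ler_wpM2r//.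
have -> : (\1_(A p) z)%:C * c p + (1 - \1_(A p) z)%:C * simple A c l z - f z =
    (\1_(A p) z - F z)%:C * (c p - simple A c l z) + (1 - F z)%:C * (simple A c l z - g z).
  by rewrite /f !rmorphB !rmorph1 /=; ring.
apply: le_trans (ncD _ _) _; rewrite !ncM !nc_real; have /andP[F0 F1] := F01 z; apply: lerD.
  rewrite mulrC ler_wpM2r//; have := nc_sub (cM p) (sM z); lra.
by rewrite ger0_norm ?subr_ge0// ler_piMl ?nc_ge0//; lra.
Qed.

(** Rounding goes towards 0, so that it never increases the modulus. *)
Let grid (y M eta : R) : 0 < eta -> `|y| <= M ->
  exists (s : bool) (k : 'I_(Num.truncn (M / eta)).+1),
    `|(-1) ^+ s * (k%:R * eta)| <= `|y| /\ `|y - (-1) ^+ s * (k%:R * eta)| <= eta.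
Proof.
move=> eta0 yM.
have y0 : 0 <= `|y| / eta by rewrite divr_ge0// ltW.
have /andP[k1 k2] := truncn_itv y0.
have kM : (Num.truncn (`|y| / eta) < (Num.truncn (M / eta)).+1)%N.
  by rewrite ltnS; apply: le_truncn; rewrite ler_wpM2r// invr_ge0 ltW.
exists (y < 0), (Ordinal kM) => /=; move: k1 k2; rewrite ler_pdivlMr// ltr_pdivrMr//.
set k := Num.truncn _ => k1 k2.
have ke : 0 <= k%:R * eta by rewrite mulr_ge0 ?ler0n ?ltW.
split; first by rewrite normrM normrX normrN1 expr1n mul1r ger0_norm.
rewrite [X in `|X - _|]realEsign ?num_real// -mulrBr normrM normrX normrN1 expr1n mul1r.
rewrite ger0_norm ?subr_ge0// lerBlDl ltW//; apply: lt_le_trans k2 _.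
by rewrite -natr1 mulrDl mul1r.
Qed.

Lemma density (v : E -> R[i]) (M e : R) : 0 <= M -> cmeas v -> (forall z, nc (v z) <= M) ->
  0 < e -> exists f, [/\ Sm f, forall z, nc (f z) <= M &
    Imu (fun z => nc (v z - f z) * h z) <= e].
Proof.
move=> M0 mv vM e0.
have e2 : 0 < e / 2 by rewrite divr_gt0.
have H0 : 0 <= Imu h by apply: Rintegral_ge0.
have H1 : 0 < Imu h + 1 by lra.
(* Each value is met up to [2 * eta], one [eta] per real component; integrated against [h] this
   costs at most [e / 2]. *)
pose eta := e / 2 / (Imu h + 1) / 2.
have eta0 : 0 < eta by rewrite !divr_gt0.
pose K := (Num.truncn (M / eta)).+1.
pose T : finType := ((bool * 'I_K) * (bool * 'I_K))%type.
pose c0 (p : T) : R[i] := ((-1) ^+ p.1.1 * (p.1.2%:R * eta)) +i* ((-1) ^+ p.2.1 * (p.2.2%:R * eta)).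
(* Grid points outside the disc of radius [M] are replaced by 0, so that the bound holds for every
   index; the rounding of a value of [v] is never among them. *)
pose c (p : T) : R[i] := if (nc (c0 p) <= M)%R then c0 p else 0.
have cM p : nc (c p) <= M by rewrite /c; case: ifPn => //; rewrite nc0.
pose A p := [set z | nc (v z - c p) <= 2 * eta].
have mA p : measurable (A p).
  have : measurable_fun setT (fun z => nc (v z - c p)).
    by apply: measurable_nc; apply: cmeasB => //; exact: cmeas_cst.
  move=> /(_ measurableT [set` `]-oo, 2 * eta]] (measurable_itv _)); rewrite setTI.
  by congr measurable; apply/seteqP; split => z /=; rewrite in_itv.
pose s := simple A c (enum T).
have vs z : nc (v z - s z) <= 2 * eta.
  have [p pz] : exists p, A p z.
    have [b1 [k1 [h1 h2]]] := grid eta0 (le_trans (nc_ge_Re _) (vM z)).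
    have [b2 [k2 [h3 h4]]] := grid eta0 (le_trans (nc_ge_Im _) (vM z)).
    exists ((b1, k1), (b2, k2)); rewrite /A/= /c ifT.
      by apply: le_trans (nc_le_ReIm _) _; rewrite creD cimD creN cimN /=; lra.
    apply: le_trans (vM z); rewrite -ler_sqr ?nnegrE ?nc_ge0// !nc_sqr /=.
    rewrite -(real_normK (num_real (_ * _))) -[X in _ + X <= _](real_normK (num_real _)).
    rewrite -[X in _ <= X + _](real_normK (num_real _)) -[X in _ <= _ + X](real_normK (num_real _)).
    by apply: lerD; rewrite ler_sqr ?nnegrE ?normr_ge0.
  have : p \in enum T by rewrite mem_enum.
  rewrite /s; elim: (enum T) => [//|q l IH]; rewrite inE /= indicE.
  have [qz _|qz] := boolP (z \in A q).
    by rewrite subrr mul1r mul0r addr0; move: qz; rewrite inE.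
  rewrite mul0r add0r subr0 mul1r => /orP[/eqP pq|/IH//].
  by move: qz; rewrite notin_setE -pq.
have [f [sf fM fI]] := app_simple (enum T) M0 cM mA e2.
exists f; split => //.
have sM := simple_bound A (enum T) M0 cM.
have ms : cmeas s := cmeas_simple c (enum T) mA.
have mf := Sm_cmeas sf.
have I1 : rintegrable mu (fun z => nc (s z - f z) * h z).
  by apply: (@I_bnd _ (2 * M)) => [|z]; [exact: cmeasB|exact: nc_sub].
have I2 := rintegrableZ (2 * eta) Ih.
apply: (@le_trans _ _ (Imu (fun z => 2 * eta * h z + nc (s z - f z) * h z))); last first.
  rewrite RintegralD// RintegralZl// [leRHS]splitr lerD//.
  rewrite /eta [2 * _]mulrC divfK// mulrAC ler_pdivrMr// ler_wpM2l ?(ltW e2)//; lra.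
apply: Rintegral_le; [|exact: rintegrableD|].
  by apply: (@I_bnd _ (2 * M)) => [|z]; [exact: cmeasB|exact: nc_sub].
move=> z; rewrite -mulrDl ler_wpM2r//.
have -> : v z - f z = (v z - s z) + (s z - f z) by ring.
by apply: le_trans (ncD _ _) _; rewrite lerD2r.
Qed.

End density.

(** * The weak equation *)

Section compactness.
Variables (R : realType) (n : nat).
Local Notation E := (Cn R n).
Implicit Types (z v : E) (f : E -> R[i]) (K : set E) (r : R).

Let mkc (p : R * R) : R[i]^o := (p.1 +i* p.2).

Let mkc_continuous : continuous mkc.
Proof.
move=> p; apply/cvgrPdist_lt => e /gt0_complexP[d d0 ->].
have d2 : 0 < d / 2 by rewrite divr_gt0.
have : nbhs p (ball p (d / 2)) by exact: nbhsx_ballx.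
apply: filterS => q [/= q1 q2]; rewrite -nc_norm ltcR.
apply: le_lt_trans (nc_le_ReIm _) _; rewrite creD cimD creN cimN /=.
by rewrite [d]splitr ltrD.
Qed.

Lemma square_compact r : compact [set x : R[i]^o | `|complex.Re x| <= r /\ `|complex.Im x| <= r].
Proof.
have -> : [set x : R[i]^o | `|complex.Re x| <= r /\ `|complex.Im x| <= r] =
    mkc @` ([set` `[- r, r]] `*` [set` `[- r, r]]).
  apply/seteqP; split => x /=.
    move=> [h1 h2]; exists (complex.Re x, complex.Im x); last by case: x h1 h2.
    by split; rewrite /= in_itv/= -ler_norml.
  by move=> [[a b] [/= ha hb] <-]; rewrite !in_itv/= -!ler_norml in ha hb.
apply: continuous_compact; first exact/continuous_subspaceT/mkc_continuous.
by apply: compact_setX; exact: segment_compact.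
Qed.

Lemma cn_compact K r : closed K -> (forall z, K z -> cbnd r z) -> compact K.
Proof.
move=> cK Kr.
have := @rV_compact (R[i]^o) n (fun=> [set x : R[i]^o | `|complex.Re x| <= r /\ `|complex.Im x| <= r])
  (fun=> @square_compact r).
move=> /(subclosed_compact cK); apply => z /Kr zr i /=.
by split; apply: le_trans (zr i); [exact: nc_ge_Re|exact: nc_ge_Im].
Qed.

Lemma closed_nc_le f (r : R) : continuous (f : E -> R[i]^o) -> closed [set z | nc (f z) <= r].
Proof.
move=> cf; rewrite -openC openE => z /= /negP; rewrite -ltNge => rz.
have e0 : 0 < nc (f z) - r by rewrite subr_gt0.
have [d d0 H] := continuous_nearP z cf e0.
apply/cn_nbhsP; exists d => // y /H yz /=; apply/negP; rewrite -ltNge.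
have := nc_dist (f z) (f y); rewrite ncBC => /(le_trans (ler_norm _)); lra.
Qed.

Lemma closed_nc_ge f (r : R) : continuous (f : E -> R[i]^o) -> closed [set z | r <= nc (f z)].
Proof.
move=> cf; rewrite -openC openE => z /= /negP; rewrite -ltNge => rz.
have e0 : 0 < r - nc (f z) by rewrite subr_gt0.
have [d d0 H] := continuous_nearP z cf e0.
apply/cn_nbhsP; exists d => // y /H yz /=; apply/negP; rewrite -ltNge.
have := nc_dist (f y) (f z) => /(le_trans (ler_norm _)); lra.
Qed.

Lemma dbar_near0 j f z (d : R) : 0 < d -> Sm f -> (forall y, near_by d z y -> f y = 0) ->
  dbar j (f : E -> R[i]^o) z = 0.
Proof.
move=> d0 sf f0.
have van v g : isdir v -> dd v f g -> g z = 0.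
  move=> dv df; have [r r0 rz] := cbnd_ex z; have [B B0 HB] := df r.
  have fz : f z = 0 by apply: f0 => i; rewrite subrr nc0.
  apply/eqP; rewrite -nc_eq0 eq_le nc_ge0 andbT.
  pose e : R := Num.min 1 (d / 2).
  have e0 : 0 < e by rewrite lt_min ltr01 divr_gt0.
  have e1 : e <= 1 by rewrite ge_min lexx.
  have ed : e <= d / 2 by rewrite ge_min lexx orbT.
  apply: (@le0_small _ _ (B * e)) => [|t t0 t1]; first by rewrite mulr_ge0// ltW.
  have et0 : 0 < e * t by rewrite mulr_gt0.
  have et1 : e * t <= e by rewrite ler_piMr// ltW.
  have := HB z (e * t) rz; rewrite gtr0_norm// => /(_ (le_trans et1 e1)).
  rewrite f0 ?fz ?subrr ?sub0r ?ncN ?ncM ?nc_real ?gtr0_norm//.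
    by rewrite expr2 mulrCA ler_pM2l// mulrA.
  move=> i; rewrite !mxE addrAC subrr add0r ncM nc_real gtr0_norm//.
  have v1 : nc (v 0 i) <= 1 by exact: isdir_le1.
  apply: le_lt_trans (_ : e * t * 1 < d); first by rewrite ler_wpM2l// ltW.
  rewrite mulr1; lra.
have [gx [gy [sx sy dx dy ->]]] := dbar_ddP j sf.
by rewrite (van _ _ (isdir_x _ j) dx) (van _ _ (isdir_y _ j) dy) mulr0 addr0 mulr0.
Qed.

Lemma dbar_out j f K z : Sm f -> closed K -> (forall z, ~ K z -> f z = 0) -> ~ K z ->
  dbar j (f : E -> R[i]^o) z = 0.
Proof.
move=> sf cK f0 nKz.
have : nbhs z (~` K) by apply: open_nbhs_nbhs; split => //; rewrite openC.
move=> /cn_nbhsP[d d0 H]; apply: (dbar_near0 j d0 sf) => y /H; exact: f0.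
Qed.

Lemma Sm_test_function (D K : set E) f : Sm f -> compact K -> closed K -> K `<=` D ->
  (forall z, ~ K z -> f z = 0) -> test_function D f.
Proof.
move=> sf cK clK KD f0.
have sub : closure [set z | f z != 0] `<=` K.
  rewrite [X in _ `<=` X](_ : K = closure K); last exact: (closure_id K).1.
  apply: closure_subset => z /= fz.
  by apply: contrapT => nK; move: fz; rewrite (f0 _ nK) eqxx.
split; first by move=> k; exact: Sm_Ck.
  by apply: subclosed_compact cK sub; exact: closed_closure.
exact: subset_trans KD.
Qed.

End compactness.

Section restriction.
Variables (R : realType) (n : nat).
Local Notation E := (Cn R n).
Local Notation mu := (@lebesgue_Cn R n).
Implicit Types (f g : E -> R[i]^o) (D K : set E).

Lemma cmeas_patch D f : measurable D -> cmeasurable_fun D f -> cmeas (f \_ D).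
Proof.
move=> mD [f1 f2]; split.
  have := f1; rewrite (measurable_restrictT _ mD).
  by congr measurable_fun; apply/funext => z; rewrite /patch; case: ifP.
have := f2; rewrite (measurable_restrictT _ mD).
by congr measurable_fun; apply/funext => z; rewrite /patch; case: ifP.
Qed.

Lemma cintegral_cint D f : cintegral D f = cint mu (f \_ D).
Proof.
apply: complex_ext; rewrite /cintegral /cint/= Rintegral_mkcond; congr Rintegral;
  by apply/funext => z; rewrite /patch; case: ifP.
Qed.

Lemma ae_cint f g : cmeas f -> cmeas g -> {ae mu, forall z, f z = g z} ->
  cint mu f = cint mu g.
Proof.
move=> [f1 f2] [g1 g2] fg; apply: complex_ext; rewrite /cint/= /Rintegral; congr fine;
  (apply: ae_eq_integral => //; [exact/measurable_EFinP|exact/measurable_EFinP|]);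
  by apply: filterS fg => z e _ /=; rewrite e.
Qed.

Lemma L1loc_integrable D K f : measurable D -> L1loc D f -> compact K -> closed K -> K `<=` D ->
  cintegrable mu (f \_ K).
Proof.
move=> mD [mf fK] cK clK KD.
have mK := closed_measurable_Cn clK.
have m : cmeas (f \_ K).
  have -> : f \_ K = (f \_ D) \_ K.
    apply/funext => z; rewrite /patch; case: ifPn => // zK; case: ifPn => //.
    by move: zK; rewrite !inE => /KD Dz; rewrite notin_setE.
  apply: cmeas_patch => //; have [m1 m2] := cmeas_patch mD mf.
  by split; exact: measurable_funTS.
apply: cintegrable_nc => //; apply/integrableP; split.
  by apply/measurable_EFinP; exact: measurable_nc.
apply: le_lt_trans (fK K cK KD); rewrite integral_mkcond le_eqVlt; apply/orP; left.
apply/eqP; rewrite patch_setT [RHS]integral_mkcond; apply: eq_integral => z _ /=; rewrite ger0_norm ?nc_ge0// /patch.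
by case: ifP => //; rewrite nc0.
Qed.

End restriction.

Section weak_form.
Variables (R : realType) (n : nat) (rho : R).
Hypothesis rho0 : 0 < rho.
Local Notation E := (Cn R n).
Local Notation mu := (@lebesgue_Cn R n).
Local Notation D := (@exterior R n rho).
Variables (u : E -> R[i]^o) (V : E -> E).
Hypothesis (u_L1loc : L1loc D u) (V_Linfty : Linfty D V) (u_sol : weak_dbar_solution D V u).

Lemma l2norm_sqr (z : E) : l2norm z ^+ 2 = \sum_i nc (z 0 i) ^+ 2.
Proof. by rewrite sqr_sqrtr// sumr_ge0// => i _; rewrite sqr_ge0. Qed.

Lemma exteriorE (z : E) : D z <-> rho ^+ 2 < \sum_i nc (z 0 i) ^+ 2.
Proof.
rewrite -l2norm_sqr ltr_sqr ?nnegrE ?sqrtr_ge0 ?(ltW rho0)//.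
by rewrite ltNge; split => [/negP|/negP].
Qed.

Lemma Sm_sqdist (a : E) : Sm (fun z : E => (\sum_i nc (z 0 i - a 0 i) ^+ 2)%:C).
Proof.
have -> : (fun z : E => (\sum_i nc (z 0 i - a 0 i) ^+ 2)%:C) =
    (fun z => \sum_i (z 0 i - a 0 i) * (z 0 i - a 0 i)^*%C).
  by apply/funext => z; rewrite rmorph_sum; apply: eq_bigr => i _; rewrite conj_nc.
elim: (index_enum _) => [|i l IH].
  by under [X in Sm X]eq_fun do rewrite big_nil; exact: Sm_cst.
under [X in Sm X]eq_fun do rewrite big_cons.
by apply: Sm_add IH; apply: Sm_mul; [|apply: Sm_conj]; exact: Sm_coordB.
Qed.

Lemma Sm_sqsum : Sm (fun z : E => (\sum_i nc (z 0 i) ^+ 2)%:C).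
Proof.
have := Sm_sqdist 0; congr Sm; apply/funext => z; congr _%:C.
by apply: eq_bigr => i _; rewrite mxE subr0.
Qed.

Lemma open_exterior : open D.
Proof.
rewrite openE => z /exteriorE rz.
have e0 : 0 < \sum_i nc (z 0 i) ^+ 2 - rho ^+ 2 by rewrite subr_gt0.
have [d d0 H] := continuous_nearP z (Sm_continuous Sm_sqsum) e0.
apply/cn_nbhsP; exists d => // y /H yz; apply/exteriorE.
have := le_lt_trans (nc_ge_Re _) yz; rewrite creD creN /= ltr_norml => /andP[h1 h2].
by move: h1 h2; move: (\sum_i nc (y 0 i) ^+ 2) (\sum_i nc (z 0 i) ^+ 2) (rho ^+ 2) => a b c; lra.
Qed.

Let mD : measurable D. Proof. by apply: open_measurable_Cn; exact: open_exterior. Qed.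

Definition Vbound : R := fine (Linfty_norm D V).

Lemma Vbound_ge0 : 0 <= Vbound.
Proof.
rewrite /Vbound /Linfty_norm; apply: fine_ge0.
apply: Lnorm_ge0. Qed.

Let VD j : E -> R[i]^o := (fun z => V z 0 j : R[i]^o) \_ D.

Let mVD j : cmeas (VD j).
Proof. by apply: cmeas_patch => //; have [mV _] := V_Linfty; exact: mV. Qed.

(** A representative of the component, extended by 0, that obeys the essential bound at every
    point. *)
Definition Vcut j : E -> R[i]^o := VD j \_ [set z | nc (VD j z) <= Vbound].

Lemma cmeas_Vcut j : cmeas (Vcut j).
Proof.
apply: cmeas_patch; last by have [m1 m2] := mVD j; split; exact: measurable_funTS.
have := measurable_nc (mVD j).
move=> /(_ measurableT [set` `]-oo, Vbound]] (measurable_itv _)); rewrite setTI.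
by congr measurable; apply/seteqP; split => z /=; rewrite in_itv.
Qed.

Lemma Vcut_le j z : nc (Vcut j z) <= Vbound.
Proof.
rewrite /Vcut /patch; case: ifPn; first by rewrite inE.
by rewrite nc0 Vbound_ge0.
Qed.

Lemma ae_Vcut j : {ae mu, forall z, VD j z = Vcut j z}.
Proof.
have H : {ae mu, forall z, (`| ((fun z => (l2norm (V z))%:E) \_ D) z | <= Linfty_norm D V)%E}.
  (* The L^oo norm unfolds to an essential supremum only for a nonzero measure; for the zero measure
     the whole space is negligible. *)
  have [mu0|mu0] := boolP (0 < mu [set: E])%E.
    by rewrite /Linfty_norm unlock mu0; exact: ess_sup_ge.
  exists setT; split => //; apply/eqP; rewrite eq_le measure_ge0 andbT.
  by rewrite leNgt.
apply: filterS H => z; rewrite -[Linfty_norm D V]fineK; last first.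
  by rewrite ge0_fin_numE; [case: V_Linfty|exact: Lnorm_ge0].
move=> h; rewrite /Vcut /patch mem_set//=; move: h.
rewrite /VD /patch; case: ifPn => _; last by rewrite nc0 Vbound_ge0.
rewrite lee_fin; apply: le_trans; rewrite ger0_norm ?sqrtr_ge0//.
rewrite -ler_sqr ?nnegrE ?nc_ge0 ?sqrtr_ge0// l2norm_sqr.
by rewrite (bigD1 j)//= lerDl sumr_ge0// => i _; rewrite sqr_ge0.
Qed.

(** The weak equation as a single integral over the whole space: restricting [u] to a compact set
    carrying [f] makes it integrable, and [Vcut] differs from the component of [V] only on a null
    set. *)
Lemma weak_cut j K f (r : R) : closed K -> (forall z, K z -> cbnd r z) -> K `<=` D -> Sm f ->
  (forall z, ~ K z -> f z = 0) ->
  cintegrable mu (fun z => (u \_ K) z * (dbar j (f : E -> R[i]^o) z + Vcut j z * f z)) /\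
  cint mu (fun z => (u \_ K) z * (dbar j (f : E -> R[i]^o) z + Vcut j z * f z)) = 0.
Proof.
move=> clK Kr KD sf f0; have cK := cn_compact clK Kr.
have Iu := L1loc_integrable mD u_L1loc cK clK KD.
have bnd (g : E -> R[i]) : Sm g -> (forall z, ~ K z -> g z = 0) -> exists B, forall z, nc (g z) <= B.
  move=> sg g0; have [B B0 HB] := Sm_locbounded sg r.
  by exists B => z; have [/Kr/HB//|/g0 ->] := pselect (K z); rewrite nc0.
have df0 z : ~ K z -> dbar j (f : E -> R[i]^o) z = 0 by exact: dbar_out.
have sdf := Sm_dbar j sf.
have [B1 HB1] := bnd _ sdf df0; have [B2 HB2] := bnd _ sf f0.
have I1 : cintegrable mu (fun z => (u \_ K) z * dbar j (f : E -> R[i]^o) z).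
  have := cintegrable_bM (Sm_cmeas sdf) HB1 Iu.
  by congr cintegrable; apply/funext => z; rewrite mulrC.
have I2 : cintegrable mu (fun z => (u \_ K) z * (Vcut j z * f z)).
  have mVf : cmeas (fun z => Vcut j z * f z).
    by apply: cmeasM; [exact: cmeas_Vcut|exact: Sm_cmeas].
  have := cintegrable_bM (M := Vbound * B2) mVf _ Iu.
  move=> /(_ _)/wrap[].
    by move=> z; rewrite ncM ler_pM ?nc_ge0//; exact: Vcut_le.
  by congr cintegrable; apply/funext => z; rewrite mulrC.
have -> : (fun z => (u \_ K) z * (dbar j (f : E -> R[i]^o) z + Vcut j z * f z)) =
    (fun z => (u \_ K) z * dbar j (f : E -> R[i]^o) z + (u \_ K) z * (Vcut j z * f z)).
  by apply/funext => z; rewrite mulrDr.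
split; first exact: cintegrableD.
rewrite (cintD I1 I2).
have := u_sol j (Sm_test_function sf cK clK KD f0); rewrite !cintegral_cint.
have -> : (fun z => u z * dbar j (f : E -> R[i]^o) z) \_ D =
    (fun z => (u \_ K) z * dbar j (f : E -> R[i]^o) z).
  apply/funext => z; rewrite /patch; have [zK|zK] := pselect (K z).
    by rewrite !mem_set//; exact: KD.
  by rewrite df0// !mulr0; case: ifP.
have -> : cint mu ((fun z => V z 0 j * u z * f z) \_ D) =
    cint mu (fun z => (u \_ K) z * (Vcut j z * f z)).
  have -> : (fun z => V z 0 j * u z * f z) \_ D = (fun z => (u \_ K) z * (VD j z * f z)).
    apply/funext => z; rewrite /VD /patch; have [zK|zK] := pselect (K z).
      by rewrite !mem_set//; [ring|exact: KD].
    by rewrite f0// !mulr0; case: ifP.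
  apply: ae_cint.
  - apply: cmeasM; first exact: cintegrable_meas Iu.
    by apply: cmeasM; [exact: mVD|exact: Sm_cmeas].
  - exact: cintegrable_meas I2.
  - by have := ae_Vcut j; apply: filterS => z ->.
by move=> ->; rewrite addNr.
Qed.

End weak_form.

Section volume.
Variable R : realType.
Local Notation leb := (@lebesgue_measure R).
Implicit Types (n : nat) (A : R).

Definition cube n A : set (n.-tuple (measurableTypeR R)) :=
  [set t | forall i, `|(tnth t i : R)| <= A].

Arguments cube : clear implicits.

Let abs_le A : [set x : measurableTypeR R | `|(x : R)| <= A] = [set` `[- A, A]].
Proof. by apply/seteqP; split => x /=; rewrite in_itv/= ler_norml. Qed.

Lemma measurable_cube n A : measurable (cube n A).
Proof.
have -> : cube n A = \bigcap_(i in [set: 'I_n])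
    ((fun t : n.-tuple (measurableTypeR R) => tnth t i) @^-1` [set` `[- A, A]]).
  apply/seteqP; split => t H i; last by have := H i I; rewrite -abs_le.
  by move=> _; rewrite -abs_le; exact: H.
apply: fin_bigcap_measurable => // i _.
rewrite -[X in measurable X]setTI.
by apply: (measurable_tnth i) => //; exact: measurable_itv.
Qed.

Lemma power_measure_cube n A : 0 <= A ->
  (power_measure leb n (cube n A) <= ((2 * A) ^+ n)%:E)%E.
Proof.
move=> A0; elim: n => [|n IH] /=.
  by rewrite expr0 /power_measure0 diracE lee_fin; case: (_ \in _).
rewrite /power_measureS /pushforward.
have -> : tuple_cons (n := n) @^-1` cube n.+1 A = [set` `[- A, A]] `*` cube n A.
  apply/seteqP; split => -[x t] /=.
    move=> H; split; first by have := H ord0; rewrite (tnth_nth 0) /= in_itv/= ler_norml.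
    by move=> i; have := H (lift ord0 i); rewrite !(tnth_nth 0).
  move=> [xA tA] i; rewrite (tnth_nth 0) /=; case: (unliftP ord0 i) => [k ->|->] /=.
    by have := tA k; rewrite (tnth_nth 0).
  by move: xA; rewrite in_itv/= ler_norml.
rewrite product_measure1E//; last exact: measurable_cube.
have hA : leb [set` `[- A, A]] = (2 * A)%:E.
  rewrite lebesgue_measure_itv/= lte_fin; case: ltP => h.
    by congr (_%:E); ring.
  by congr (_%:E); lra.
apply: (@le_trans _ _ ((2 * A)%:E * power_measure leb n (cube n A))%E).
  by rewrite -hA.
by rewrite exprS [leRHS]EFinM lee_wpmul2l// lee_fin mulr_ge0.
Qed.

Lemma measurable_cbnd n A : measurable [set z : Cn R n | cbnd A z].
Proof.
have -> : [set z : Cn R n | cbnd A z] = \bigcap_(i in [set: 'I_n]) [set z | nc (z 0 i) <= A].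
  by apply/seteqP; split => z H i; [move=> _; exact: H|exact: (H i I)].
apply: fin_bigcap_measurable => // i _; apply: closed_measurable_Cn.
by apply: closed_nc_le; exact: (Sm_continuous (Sm_coord R i)).
Qed.

(** A polydisc lies in a product of two real cubes. The bound is polynomial in the radius, hence
    harmless against the exponential decay of [u]. *)
Lemma cn_volume n A : 0 <= A ->
  (@lebesgue_Cn R n [set z | cbnd A z] <= (((2 * A) ^+ n) ^+ 2)%:E)%E.
Proof.
move=> A0.
have sub : of_coords (n := n) @^-1` [set z | cbnd A z] `<=` cube n A `*` cube n A.
  move=> [p q] /= H; split => i /=.
    by have := H i; rewrite mxE => /(le_trans (nc_ge_Re _)).
  by have := H i; rewrite mxE => /(le_trans (nc_ge_Im _)).
have mB := @measurable_cbnd n A.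
have mpre : measurable (of_coords (n := n) @^-1` [set z | cbnd A z]).
  by rewrite -[X in measurable X]setTI; exact: measurable_of_coords.
have mC : measurable (cube n A `*` cube n A).
  by apply: measurableX; exact: measurable_cube.
rewrite /lebesgue_Cn /pushforward.
apply: (@le_trans _ _ ((power_measure leb n \x power_measure leb n)%E (cube n A `*` cube n A))).
  by apply: le_measure; rewrite ?inE.
rewrite product_measure1E; [|exact: measurable_cube|exact: measurable_cube].
by rewrite [leRHS]EFinM lee_pmul//; exact: power_measure_cube.
Qed.

End volume.

(** * The weighted test function *)

Lemma dstep_bounded (R : realType) : exists2 B : R, 0 <= B & forall s, `|dstep s| <= B :> R.
Proof.
have [B B0 HB] := smoothR_bounded 0 1 (smoothR_dstep R).
exists B => // s; have [s0|s0] := leP s 0; first by rewrite dstep_out ?normr0// s0.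
have [s1|s1] := leP 1 s; first by rewrite dstep_out ?normr0// s1 orbT.
by apply: HB; rewrite !ltW.
Qed.

Section cutoff.
Variables (R : realType) (n : nat) (j : 'I_n).
Local Notation E := (Cn R n).
Local Notation db f := (dbar j (f : E -> R[i]^o) : E -> R[i]).
Implicit Types (z : E) (a b : R).

Definition cutin a b z : R[i] := (stp (a ^+ 2) (b ^+ 2 - a ^+ 2) (nc (z 0 j) ^+ 2))%:C.
Definition cutout a b z : R[i] := 1 - cutin a b z.
Definition dcut a b z : R[i] :=
  (dstp (a ^+ 2) (b ^+ 2 - a ^+ 2) (nc (z 0 j) ^+ 2))%:C * z 0 j.

Let cutinE a b : cutin a b =
  (fun z => (stp (a ^+ 2) (b ^+ 2 - a ^+ 2) (nc (z 0 j - 0) ^+ 2))%:C).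
Proof. by apply/funext => z; rewrite subr0. Qed.

Lemma Sm_cutin a b : Sm (cutin a b).
Proof. by rewrite cutinE; apply: Sm_radial; exact: smoothR_stp. Qed.

Lemma Sm_cutout a b : Sm (cutout a b).
Proof. by apply: Sm_add; [exact: Sm_cst|apply: Sm_opp; exact: Sm_cutin]. Qed.

Lemma dbar_cutin a b : db (cutin a b) = dcut a b.
Proof.
rewrite cutinE (dbar_radial j 0 (smoothR_stp _ _) (smoothR_dstp _ _) (is_derive_stp _ _)).
by apply/funext => z; rewrite subr0.
Qed.

Lemma dbar_opp (f : E -> R[i]) : Sm f -> db (fun z => - f z) = (fun z => - db f z).
Proof.
move=> sf; have -> : (fun z => - f z) = (fun z => -1 * f z).
  by apply/funext => z; rewrite mulN1r.
rewrite (dbar_mul j (Sm_cst _ (-1)) sf); apply/funext => z.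
by rewrite dbar_cst mul0r addr0 mulN1r.
Qed.

Lemma dbar_cutout a b : db (cutout a b) = (fun z => - dcut a b z).
Proof.
rewrite /cutout (dbar_add j (Sm_cst _ 1) (Sm_opp (Sm_cutin a b))).
by rewrite (dbar_opp (Sm_cutin a b)) dbar_cutin dbar_cst; apply/funext => z; rewrite add0r.
Qed.

Section ordered.
Variables a b : R.
Hypotheses (a0 : 0 <= a) (ab : a < b).

Let d0 : 0 < b ^+ 2 - a ^+ 2.
Proof. by rewrite subr_gt0 ltr_sqr ?nnegrE// (le_trans a0)// ltW. Qed.

Let b0 : 0 <= b. Proof. exact: le_trans a0 (ltW ab). Qed.

Lemma cutin_le z : nc (z 0 j) <= a -> cutin a b z = 0.
Proof. by move=> za; rewrite /cutin stp_le// ler_sqr ?nnegrE ?nc_ge0. Qed.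

Lemma cutin_ge z : b <= nc (z 0 j) -> cutin a b z = 1.
Proof.
by move=> bz; rewrite /cutin stp_ge// addrC subrK ler_sqr ?nnegrE ?nc_ge0.
Qed.

Lemma cutout_le z : nc (z 0 j) <= a -> cutout a b z = 1.
Proof. by move=> za; rewrite /cutout cutin_le// subr0. Qed.

Lemma cutout_ge z : b <= nc (z 0 j) -> cutout a b z = 0.
Proof. by move=> bz; rewrite /cutout cutin_ge// subrr. Qed.

Lemma nc_cutin z : nc (cutin a b z) <= 1.
Proof. by rewrite /cutin nc_real ger0_norm ?stp_ge0 ?stp_le1. Qed.

Lemma nc_cutout z : nc (cutout a b z) <= 1.
Proof.
rewrite /cutout /cutin; set x := stp _ _ _.
have -> : 1 - x%:C = (1 - x)%:C by rewrite rmorphB.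
by rewrite nc_real ger0_norm ?subr_ge0 ?stp_le1// gerBl stp_ge0.
Qed.

Lemma dcut_out z : (nc (z 0 j) <= a) || (b <= nc (z 0 j)) -> dcut a b z = 0.
Proof.
move=> H; rewrite /dcut dstp_out ?mul0r//; case/orP: H => H.
  by rewrite ler_sqr ?nnegrE ?nc_ge0// H.
by apply/orP; right; rewrite addrC subrK ler_sqr ?nnegrE ?nc_ge0.
Qed.

Lemma nc_dcut z (B : R) : (forall s, `|dstep s| <= B :> R) ->
  nc (dcut a b z) <= B / (b ^+ 2 - a ^+ 2) * b.
Proof.
move=> HB; have B0 : 0 <= B := le_trans (normr_ge0 _) (HB 0).
have q0 : 0 <= B / (b ^+ 2 - a ^+ 2) by rewrite divr_ge0// ltW.
have [bz|zb] := leP b (nc (z 0 j)).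
  by rewrite dcut_out ?bz ?orbT// nc0 mulr_ge0.
rewrite /dcut ncM nc_real ler_pM ?nc_ge0 ?(ltW zb)//.
rewrite /dstp normrM (gtr0_norm (x := _^-1)) ?invr_gt0//.
by rewrite ler_wpM2r// invr_ge0 ltW.
Qed.

End ordered.
End cutoff.

Section test_function_estimate.
Variables (R : realType) (n : nat) (j : 'I_n).
Local Notation E := (Cn R n).
Local Notation db f := (dbar j (f : E -> R[i]^o) : E -> R[i]).
Implicit Types (z : E).
Variables (z0 : E) (r1 r2 r3 r4 eta : R) (th : E -> R).
Hypotheses (r1_0 : 0 < r1) (r12 : r1 < r2) (r23 : r2 <= r3) (r34 : r3 <= r4).
Hypotheses (sth : Sm (fun z => (th z)%:C)) (th01 : forall z, 0 <= th z <= 1).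
Hypothesis th_supp : forall z, th z != 0 ->
  r3 <= nc (z 0 j) /\ nc (z 0 j) <= r4 /\ forall i, nc (z 0 i - z0 0 i) <= eta.
(** In the application [kap] is the O(sqrt S) error of the gauge, [Gam] is 2 M S, and [B] is a bound
    of no particular growth, used only in front of an error that is sent to 0. *)
Variables (S kap Gam B : R) (k : nat).
Hypothesis r4S : 4 * (r4 + 2) <= S.
Variables (sig f w : E -> R[i]) (g : E -> R).
Hypotheses (ssig : Sm sig) (sig1 : forall z, nc (sig z) <= 1).
Hypotheses (sw : Sm w) (dw : forall z, nc (z 0 j) <= S - 1 -> db w z = f z).
Hypothesis wB : forall z, nc (z 0 j) <= S -> `|complex.Re (w z)| <= B.
Hypothesis wkap : forall z, S - 2 <= nc (z 0 j) -> nc (z 0 j) <= S - 1 ->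
  `|complex.Re (w z)| <= kap.
Hypothesis wg : forall z, nc (z 0 j) <= r4 ->
  `|complex.Re (w z) - g (zero_at j z)| <= kap /\ `|g (zero_at j z)| <= Gam.

(** The inner radius keeps this set inside the exterior domain, however large [A] is; in the other
    variables it stays close to [z0]. *)
Definition shell (A : R) : set E := [set z | [/\ r1 <= nc (z 0 j), nc (z 0 j) <= A &
  forall i, i != j -> nc (z 0 i - z0 0 i) <= eta]].

(** Seen from a point with |z_j| <= S - 1, the source lies within [S - 1 + r4], inside the radius
    [L - 1] required by [dbar_solve]. *)
Let L : R := S + r4 + 1.
Let src z : R[i] := sig z * (th z)%:C * (cexp (w z) * ((z 0 j)^*%C) ^+ k).
Let T : E -> R[i] := solve j L src.
Let chi z : R[i] := cutin j r1 r2 z * cutout j (S - 2) (S - 1) z.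
(* [T] solves [dbar T = src], and [src] is chosen so that the main term of
   [dbar test] is [sig * th * |z_j|^2k]. *)
Definition test z : R[i] := cexp (- w z) * (chi z * (z 0 j ^+ k * T z)).

Let r2_0 : 0 < r2. Proof. exact: lt_trans r1_0 r12. Qed.
Let r4_0 : 0 < r4. Proof. by apply: lt_le_trans r2_0 (le_trans r23 r34). Qed.
Let L0 : 0 < L. Proof. by rewrite /L; move: r4_0 r4S; lra. Qed.
Let LS : L <= 2 * S. Proof. by rewrite /L; move: r4_0 r4S; lra. Qed.
Let S8 : 8 <= S. Proof. by move: r4_0 r4S; lra. Qed.
Let S20 : 0 <= S - 2. Proof. by move: S8; lra. Qed.
Let S21 : S - 2 < S - 1. Proof. by move: S8; lra. Qed.

Let ssrc : Sm src.
Proof.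
apply: Sm_mul; first exact: Sm_mul.
by apply: Sm_mul; [exact: Sm_cexp|apply: Sm_exp; apply: Sm_conj; exact: Sm_coord].
Qed.

Let sT : Sm T. Proof. exact: Sm_solve. Qed.

Let schi : Sm chi.
Proof. by apply: Sm_mul; [exact: Sm_cutin|exact: Sm_cutout]. Qed.

Let sz : Sm (fun z : E => z 0 j ^+ k). Proof. by apply: Sm_exp; exact: Sm_coord. Qed.

Let sew : Sm (fun z => cexp (- w z)). Proof. by apply: Sm_cexp; exact: Sm_opp. Qed.

Lemma Sm_test : Sm test.
Proof. by apply: Sm_mul => //; apply: Sm_mul => //; exact: Sm_mul. Qed.

Let src0 z : th z = 0 -> src z = 0.
Proof. by move=> e; rewrite /src e mulr0 mul0r. Qed.

Let proj_slide z p : zero_at j (slide j z p) = zero_at j z.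
Proof.
rewrite /zero_at slide_coord /slide scalerDl opprD addrA addrAC; congr (_ - _).
by rewrite addrK.
Qed.

Let proj_proj z : zero_at j (zero_at j z) = zero_at j z.
Proof. by rewrite {1}/zero_at zero_atE scale0r subr0. Qed.

Let nc_src z : nc (src z) <= r4 ^+ k * expR (g (zero_at j z) + kap).
Proof.
have Y0 : 0 <= r4 ^+ k * expR (g (zero_at j z) + kap).
  by rewrite mulr_ge0 ?expR_ge0// exprn_ge0// ltW.
have [e|/th_supp[_ [z4 _]]] := eqVneq (th z) 0; first by rewrite src0// nc0.
have [+ _] := wg z4; rewrite ler_norml => /andP[_ wz].
rewrite /src ncM (ncM (sig z)) (ncM (cexp _)) nc_real ncX nc_conj nc_cexp; have /andP[t0 t1] := th01 z.
rewrite -[leRHS]mul1r ler_pM ?mulr_ge0 ?nc_ge0 ?expR_ge0 ?exprn_ge0 ?nc_ge0//.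
  by rewrite -[leRHS]mulr1 ler_pM ?nc_ge0// ger0_norm.
rewrite mulrC ler_pM ?expR_ge0 ?exprn_ge0 ?nc_ge0//.
  by rewrite lerXn2r ?nnegrE ?nc_ge0// ltW.
by rewrite ler_expR; move: wz; lra.
Qed.

(** [T z] only integrates over the slice through [z], on which [g (zero_at j z)] is one number. It
    is kept here so that it can cancel in [inner_bound]. *)
Let nc_T z : nc (T z) <= 4 * S * (r4 ^+ k * expR (g (zero_at j z) + kap)).
Proof.
have Y0 : 0 <= r4 ^+ k * expR (g (zero_at j z) + kap).
  by rewrite mulr_ge0 ?expR_ge0// exprn_ge0// ltW.
apply: le_trans (nc_solve L0 ssrc Y0 _) _.
  by move=> p; rewrite -(proj_slide z p); exact: nc_src.
by rewrite ler_wpM2r//; move: LS; lra.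
Qed.

Let nc_T2 z : nc (T z) <= 4 * S * (r4 ^+ k * expR (Gam + kap)).
Proof.
apply: le_trans (nc_T z) _; rewrite ler_wpM2l//; first by move: S8; lra.
rewrite ler_wpM2l ?exprn_ge0 ?(ltW r4_0)// ler_expR lerD2r.
have [|_] := wg (z := zero_at j z); first by rewrite zero_atE nc0 ltW.
by rewrite proj_proj; exact: le_trans (ler_norm _).
Qed.

(** Only the [j]-th variable is integrated, so in the others [T] inherits the support of the source;
    this is why no cut-off in those variables is needed. *)
Let T_out z i : i != j -> eta < nc (z 0 i - z0 0 i) -> T z = 0.
Proof.
move=> ij zi; apply: solve0 => p; apply: src0; apply/eqP; rewrite -[_ == _]negbK.
apply/negP => /th_supp[_ [_ /(_ i)]]; rewrite slideE (negbTE ij) addr0.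
by move: zi; rewrite ltNge => /negP.
Qed.

Lemma test_out z : ~ shell (S - 1) z -> test z = 0.
Proof.
move=> nz; rewrite /test /chi.
have [h1|h1] := leP (nc (z 0 j)) r1.
  by rewrite (cutin_le (ltW r1_0) r12 h1) !mul0r mulr0.
have [h2|h2] := leP (S - 1) (nc (z 0 j)).
  by rewrite (cutout_ge S20 S21 h2) mulr0 !mul0r mulr0.
have [i ij zi] : exists2 i, i != j & eta < nc (z 0 i - z0 0 i).
  apply: contrapT => H; apply: nz; split; [exact: ltW|exact: ltW|] => i ij.
  by rewrite leNgt; apply/negP => hi; apply: H; exists i.
by rewrite (T_out ij zi) !mulr0.
Qed.

Let dT z : nc (z 0 j) <= S - 1 -> db T z = src z.
Proof.
move=> zS; apply: dbar_solve => // p pL; apply: src0; apply/eqP; rewrite -[_ == _]negbK.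
apply/negP => /th_supp[_ [h _]]; move: h; rewrite slide_coord.
have := ncB (z 0 j + pt p) (z 0 j); rewrite addrAC subrr add0r.
by move: pL zS; rewrite /L; lra.
Qed.

(** The derivative of [T] gives the first term, since [chi] is 1 on the support of [th] and the two
    exponentials cancel; the cut-offs give the second, the exponential the third. *)
Lemma dbar_test z : nc (z 0 j) <= S - 1 -> db test z =
  sig z * (th z)%:C * (nc (z 0 j) ^+ 2 ^+ k)%:C +
  cexp (- w z) * (z 0 j ^+ k * T z) *
    (dcut j r1 r2 z * cutout j (S - 2) (S - 1) z - cutin j r1 r2 z * dcut j (S - 2) (S - 1) z) -
  f z * test z.
Proof.
move=> zS.
have szT : Sm (fun z => z 0 j ^+ k * T z) by exact: Sm_mul.
have scT : Sm (fun z => chi z * (z 0 j ^+ k * T z)) by exact: Sm_mul.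
rewrite /test (dbar_mul j sew scT) (dbar_mul j schi szT) (dbar_mul j sz sT).
rewrite (dbar_cexp j (Sm_opp sw)) (dbar_opp j sw) dT// dw//.
rewrite (dbar_expn0 k (Sm_coord R j)) ?dbar_coord// mul0r addr0.
rewrite (dbar_mul j (Sm_cutin j r1 r2) (Sm_cutout j (S - 2) (S - 1))).
rewrite dbar_cutin dbar_cutout.
have e : chi z * src z = src z.
  have [e|/th_supp[h1 [h2 _]]] := eqVneq (th z) 0; first by rewrite src0// mulr0.
  rewrite /chi (cutin_ge (ltW r1_0) r12 (le_trans r23 h1)).
  by rewrite (cutout_le S20 S21) ?mul1r ?mul1r//; move: h2 r4S r4_0; lra.
have e2 : cexp (- w z) * (z 0 j ^+ k * src z) = sig z * (th z)%:C * (nc (z 0 j) ^+ 2 ^+ k)%:C.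
  rewrite rmorphXn/= -conj_nc exprMn /src.
  rewrite (_ : _ * _ = (cexp (- w z) * cexp (w z)) * (sig z * (th z)%:C * (z 0 j ^+ k * (z 0 j)^*%C ^+ k))); last by ring.
  by rewrite cexpN mul1r.
rewrite -e2 -[in RHS]e /chi; move: (T z) (src z) (cexp _) => t x y; ring.
Qed.

Variable Bs : R.
Hypothesis HBs : forall s, `|dstep s| <= Bs :> R.

Let Bs0 : 0 <= Bs. Proof. exact: le_trans (normr_ge0 _) (HBs 0). Qed.

(** Both transition regions have one [kap] from e^{-w} and one from the source. In the inner one [g]
    cancels; in the outer one e^{-w} costs only [kap], and the [g] of the source remains as [Gam].
    In [error_const] e^{-w} is bounded by [B]. *)
Definition inner_const : R :=
  Bs / (r2 ^+ 2 - r1 ^+ 2) * r2 * (4 * S) * (r2 * r4) ^+ k * expR (2 * kap).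
Definition outer_const : R := Bs * S * (4 * S) * (S * r4) ^+ k * expR (Gam + 2 * kap).
Definition error_const : R := 4 * S * (S * r4) ^+ k * expR (B + Gam + kap).

Let S0 : 0 <= S. Proof. by move: S8; lra. Qed.

Lemma test_bound z : nc (z 0 j) <= S - 1 -> nc (test z) <= error_const.
Proof.
move=> zS; rewrite /test /error_const ncM nc_cexp creN !ncM.
apply: le_trans (_ : expR B * (1 * (S ^+ k * (4 * S * (r4 ^+ k * expR (Gam + kap))))) <= _).
  rewrite ler_pM ?expR_ge0 ?mulr_ge0 ?nc_ge0//.
    rewrite ler_expR; apply: le_trans (ler_norm _) _; rewrite normrN; apply: wB.
    by move: zS; lra.
  rewrite ler_pM ?mulr_ge0 ?nc_ge0//.
    rewrite -[leRHS]mulr1 ler_pM ?nc_ge0//; first exact: nc_cutin.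
    exact: nc_cutout.
  rewrite ler_pM ?nc_ge0//.
  by rewrite ncX lerXn2r ?nnegrE ?nc_ge0//; move: zS; lra.
rewrite le_eqVlt; apply/orP; left; apply/eqP.
have -> : expR (B + Gam + kap) = expR B * expR (Gam + kap) by rewrite -expRD addrA.
by rewrite exprMn; ring.
Qed.

Lemma inner_bound z : nc (cexp (- w z) * (z 0 j ^+ k * T z) *
    (dcut j r1 r2 z * cutout j (S - 2) (S - 1) z)) <=
  if nc (z 0 j) <= r2 then inner_const else 0.
Proof.
have [h|h] := leP (nc (z 0 j)) r2; last by rewrite (dcut_out (ltW r1_0) r12) ?(ltW h) ?orbT// mul0r mulr0 nc0.
have [+ _] := wg (le_trans h (le_trans r23 r34)); rewrite ler_norml => /andP[wz _].
rewrite ncM (ncM (cexp _)) nc_cexp creN (ncM (z 0 j ^+ k)) (ncM (dcut _ _ _ _)) /inner_const.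
set G := g (zero_at j z) in wz *.
have q0 : 0 <= Bs / (r2 ^+ 2 - r1 ^+ 2) * r2.
  rewrite mulr_ge0 ?(ltW r2_0)// divr_ge0// subr_ge0 ler_sqr ?nnegrE ?(ltW r1_0) ?(ltW r2_0)//.
  exact: ltW.
apply: le_trans (_ : expR (kap - G) * (r2 ^+ k * (4 * S * (r4 ^+ k * expR (G + kap)))) *
   (Bs / (r2 ^+ 2 - r1 ^+ 2) * r2 * 1) <= _).
  rewrite ler_pM ?expR_ge0 ?mulr_ge0 ?nc_ge0//.
    rewrite ler_pM ?expR_ge0 ?mulr_ge0 ?nc_ge0//.
      by rewrite ler_expR; move: wz; lra.
    rewrite ler_pM ?nc_ge0//.
    by rewrite ncX lerXn2r ?nnegrE ?nc_ge0// ltW.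
  rewrite ler_pM ?nc_ge0//; last exact: nc_cutout.
  exact: (nc_dcut j (ltW r1_0) r12 z HBs).
rewrite le_eqVlt; apply/orP; left; apply/eqP.
have -> : expR (2 * kap) = expR (kap - G) * expR (G + kap).
  by rewrite -expRD; congr expR; ring.
by rewrite exprMn; ring.
Qed.

Lemma outer_bound z : nc (z 0 j) <= S - 1 -> nc (cexp (- w z) * (z 0 j ^+ k * T z) *
    (cutin j r1 r2 z * dcut j (S - 2) (S - 1) z)) <=
  if S - 2 <= nc (z 0 j) then outer_const else 0.
Proof.
move=> zS; have [h|h] := leP (S - 2) (nc (z 0 j)); last by rewrite (dcut_out S20 S21) ?(ltW h)// !mulr0 nc0.
rewrite ncM (ncM (cexp _)) nc_cexp creN (ncM (z 0 j ^+ k)) (ncM (cutin _ _ _ _)) /outer_const.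
have dd : nc (dcut j (S - 2) (S - 1) z) <= Bs * S.
  apply: le_trans (nc_dcut j S20 S21 z HBs) _.
  have d1 : 1 <= (S - 1) ^+ 2 - (S - 2) ^+ 2 by move: S8; rewrite !expr2; nra.
  have d0 : 0 < (S - 1) ^+ 2 - (S - 2) ^+ 2 by apply: lt_le_trans d1.
  rewrite ler_pM//.
  - by rewrite divr_ge0// ltW.
  - by move: S8; lra.
  - by rewrite ler_pdivrMr// ler_peMr.
  - by rewrite gerBl.
apply: le_trans (_ : expR kap * (S ^+ k * (4 * S * (r4 ^+ k * expR (Gam + kap)))) *
   (1 * (Bs * S)) <= _).
  rewrite ler_pM ?expR_ge0 ?mulr_ge0 ?nc_ge0//.
    rewrite ler_pM ?expR_ge0 ?mulr_ge0 ?nc_ge0//.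
      by rewrite ler_expR; apply: le_trans (ler_norm _) _; rewrite normrN; exact: wkap.
    rewrite ler_pM ?nc_ge0//.
    by rewrite ncX lerXn2r ?nnegrE ?nc_ge0//; move: zS; lra.
  by rewrite ler_pM ?nc_ge0//; exact: nc_cutin.
rewrite le_eqVlt; apply/orP; left; apply/eqP.
have -> : expR (Gam + 2 * kap) = expR kap * expR (Gam + kap).
  by rewrite -expRD; congr expR; ring.
by rewrite exprMn; ring.
Qed.

(** [v] is to be the conjugate phase of [u] and [vt] the true coefficient. The term [f * test] of
    [dbar_test] cancels against [vt * test] up to |vt - f|. *)
Lemma pointwise_bound (v vt : R[i]) z : nc (z 0 j) <= S - 1 ->
  nc (v * (th z * nc (z 0 j) ^+ 2 ^+ k)%:C - (db test z + vt * test z)) <=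
  (r4 ^+ 2) ^+ k * nc (v - sig z) + (if nc (z 0 j) <= r2 then inner_const else 0) +
  (if S - 2 <= nc (z 0 j) then outer_const else 0) + error_const * nc (vt - f z).
Proof.
move=> zS; rewrite dbar_test//.
set X := cexp (- w z) * (z 0 j ^+ k * T z).
set a := dcut _ _ _ _; set b := cutout _ _ _ _; set c := cutin _ _ _ _; set d := dcut _ _ _ _.
have -> : v * (th z * nc (z 0 j) ^+ 2 ^+ k)%:C -
    (sig z * (th z)%:C * (nc (z 0 j) ^+ 2 ^+ k)%:C + X * (a * b - c * d) - f z * test z + vt * test z) =
  (v - sig z) * (th z * nc (z 0 j) ^+ 2 ^+ k)%:C - X * (a * b) + X * (c * d) - (vt - f z) * test z.
  by rewrite rmorphM /=; ring.
apply: le_trans (ncB _ _) _; apply: lerD; last first.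
  by rewrite ncM mulrC ler_wpM2r ?nc_ge0//; exact: test_bound.
apply: le_trans (ncD _ _) _; apply: lerD; last exact: outer_bound.
apply: le_trans (ncB _ _) _; apply: lerD; last exact: inner_bound.
rewrite ncM mulrC ler_wpM2r ?nc_ge0// nc_real.
have [->|/th_supp[_ [h _]]] := eqVneq (th z) 0.
  by rewrite mul0r normr0 !exprn_ge0// ltW.
have /andP[t0 t1] := th01 z.
rewrite ger0_norm ?mulr_ge0 ?exprn_ge0 ?nc_ge0//.
rewrite -[leRHS]mul1r ler_pM ?exprn_ge0 ?nc_ge0//.
by rewrite !lerXn2r ?nnegrE ?exprn_ge0 ?nc_ge0 ?(ltW r4_0)// lerXn2r ?nnegrE ?nc_ge0 ?(ltW r4_0).
Qed.

End test_function_estimate.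

Lemma closed_shell (R : realType) (n : nat) (j : 'I_n) (z0 : Cn R n) (r1 eta A : R) :
  closed (shell j z0 r1 eta A).
Proof.
have c i : continuous (fun z : Cn R n => z 0 i : R[i]^o) := Sm_continuous (Sm_coord R i).
have -> : shell j z0 r1 eta A = [set z : Cn R n | r1 <= nc (z 0 j)] `&`
    ([set z : Cn R n | nc (z 0 j) <= A] `&`
    \bigcap_(i in [set i | i != j]) [set z : Cn R n | nc (z 0 i - z0 0 i) <= eta]).
  by apply/seteqP; split => z [h1]; [move=> h2 h3|move=> [h2 h3]]; split.
apply: closedI; first exact: closed_nc_ge.
apply: closedI; first exact: closed_nc_le.
apply: closed_bigI => i _; apply: closed_nc_le.
exact: (Sm_continuous (Sm_coordB i (z0 0 i))).
Qed.

(** * Testing the weak equation *)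

Section estimate.
Variables (R : realType) (n : nat) (rho : R).
Hypothesis rho0 : 0 < rho.
Local Notation E := (Cn R n).
Local Notation mu := (@lebesgue_Cn R n).
Local Notation D := (@exterior R n rho).
Variables (u : E -> R[i]^o) (V : E -> E).
Hypothesis (u_L1loc : L1loc D u) (V_Linfty : Linfty D V) (u_sol : weak_dbar_solution D V u).
Variables (C r : R).
Hypothesis C0 : 0 <= C.
Hypothesis u_decay : forall z : E, r < l2norm z -> nc (u z) <= expR (- C * l2norm z).
Implicit Types (z : E).
Variables (j : 'I_n) (z0 : E) (r1 r2 r3 r4 eta Z : R) (th : E -> R).
Hypotheses (r1_0 : 0 < r1) (r12 : r1 < r2) (r23 : r2 <= r3) (r34 : r3 <= r4).
Hypotheses (sth : Sm (fun z => (th z)%:C)) (th01 : forall z, 0 <= th z <= 1).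
Hypothesis th_supp : forall z, th z != 0 ->
  r3 <= nc (z 0 j) /\ nc (z 0 j) <= r4 /\ forall i, nc (z 0 i - z0 0 i) <= eta.
Hypothesis shellD : forall A, shell j z0 r1 eta A `<=` D.
Hypothesis z0Z : forall i, nc (z0 0 i) + eta <= Z.
Variable Bs : R.
Hypothesis HBs : forall s, `|dstep s| <= Bs :> R.

Local Notation uA A := (u \_ (shell j z0 r1 eta A)).
Local Notation M := (Vbound rho V).
Local Notation Imu f := (Rintegral mu setT f).

Let r4_0 : 0 < r4.
Proof. by apply: lt_le_trans (lt_trans r1_0 r12) (le_trans r23 r34). Qed.

Let nc_le_l2 z i : nc (z 0 i) <= l2norm z.
Proof.
rewrite -ler_sqr ?nnegrE ?nc_ge0 ?sqrtr_ge0// l2norm_sqr.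
by rewrite (bigD1 i)//= lerDl sumr_ge0// => k _; rewrite sqr_ge0.
Qed.

Lemma shell_cbnd A B z : A <= B -> Z <= B -> shell j z0 r1 eta A z -> cbnd B z.
Proof.
move=> AB ZB [_ zA zi] i; have [->|ij] := eqVneq i j; first exact: le_trans AB.
apply: le_trans ZB; apply: le_trans (z0Z i).
rewrite -[z 0 i](subrK (z0 0 i)); apply: le_trans (ncD _ _) _.
by rewrite addrC lerD2l; exact: zi.
Qed.

Lemma shell_integrable A : cintegrable mu (uA A).
Proof.
have clK : closed (shell j z0 r1 eta A) := @closed_shell _ _ _ _ _ _ _.
have AB : A <= Num.max A Z by rewrite le_max lexx.
have ZB : Z <= Num.max A Z by rewrite le_max lexx orbT.
apply: (L1loc_integrable _ u_L1loc) => //.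
  by apply: open_measurable_Cn; exact: (open_exterior rho0).
exact: (cn_compact clK (fun z => @shell_cbnd A _ z AB ZB)).
Qed.

Let nc_uA_le A z : nc (uA A z) <= nc (u z).
Proof. by rewrite /patch; case: ifP => // _; rewrite nc0 nc_ge0. Qed.

(** The constant [K] is that of [gauge] and depends on neither [S] nor [k], which remain free. Apart
    from explicit constants, the right-hand side involves [u] only through its integral over a fixed
    shell. *)
Lemma shell_estimate : exists2 K, 0 <= K & forall (S : R) (k : nat),
  4 * (r4 + 2) <= S -> Z <= S -> r + 2 < S ->
  (r3 ^+ 2) ^+ k * Imu (fun z => th z * nc (uA r4 z)) <=
  inner_const r1 r2 r4 S (K * M * Num.sqrt S) k Bs * Imu (fun z => nc (uA r4 z)) +
  outer_const r4 S (K * M * Num.sqrt S) (2 * M * S) k Bs * expR (- C * (S - 2)) *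
    ((2 * S) ^+ n) ^+ 2.
Proof.
have [K K0 HK] := gauge j (ltW r4_0); exists K => // S k r4S ZS rS.
have M0 : 0 <= M := Vbound_ge0 rho V.
have [B HB] := HK S r4S M M0.
have S8 : 8 <= S by move: r4_0 r4S; lra.
have S20 : 0 <= S - 1 by move: S8; lra.
have S21 : S - 1 < S by move: S8; lra.
set kap := K * M * Num.sqrt S; set Gam := 2 * M * S.
have kap0 : 0 <= kap by rewrite !mulr_ge0// sqrtr_ge0.
have S_0 : 0 <= S by move: S8; lra.
have Gam0 : 0 <= Gam by rewrite !mulr_ge0.
set c1 := inner_const _ _ _ _ _ _ _; set c2 := outer_const _ _ _ _ _ _.
(* This constant is fixed before the accuracy [t] of the approximations; that is possible because
   [B] does not depend on the function to which the gauge is fitted. *)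
set c3 := error_const r4 S kap Gam B k.
pose uK := uA (S - 1).
have Iu : cintegrable mu uK := shell_integrable (S - 1).
have Inu := rintegrable_nc Iu.
have mu_u := cintegrable_meas Iu.
have nu0 z : 0 <= nc (uK z) := nc_ge0 _.
(* the conjugate phase of [u], 0 where [u] vanishes *)
pose v z : R[i] := (uK z)^*%C * ((nc (uK z))%:C)^-1.
have mv : cmeas v.
  apply: cmeasM; first exact: cmeas_conj.
  by apply: cmeas_inv; apply: cmeas_real; exact: measurable_nc.
have v1 z : nc (v z) <= 1.
  rewrite /v ncM ncV nc_conj nc_real ger0_norm//.
  have [->|n0] := eqVneq (nc (uK z)) 0; first by rewrite mul0r.
  by rewrite divff.
have uv z : uK z * v z = (nc (uK z))%:C.
  rewrite /v mulrA conj_nc; have [->|n0] := eqVneq (nc (uK z)) 0.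
    by rewrite expr0n mul0r.
  by rewrite rmorphXn/= expr2 mulfK// -nc_eq0 nc_real normr_eq0.
have c30 : 0 <= c3.
  by rewrite /c3 /error_const mulr_ge0 ?expR_ge0// mulr_ge0 ?mulr_ge0// exprn_ge0// mulr_ge0// ltW.
set J := Imu (fun z => th z * nc (uA r4 z)); set I0 := Imu (fun z => nc (uA r4 z)); set q2 := expR _.
rewrite -subr_le0.
have err0 : 0 <= (r4 ^+ 2) ^+ k + c3 by rewrite addr_ge0 ?exprn_ge0 ?(ltW r4_0).
apply: (le0_small err0) => t t0 t1.
have [f [sf fM fI]] := density nu0 Inu M0 (cmeas_Vcut rho0 V_Linfty j) (Vcut_le rho V j) t0.
have [sig [ssig sig1 sigI]] := density nu0 Inu ler01 mv v1 t0.
(* [gauge] wants a source vanishing for |z_j| >= S; for |z_j| <= S - 1, where the test function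
   lives, nothing is changed. *)
pose W z := f z * cutout j (S - 1) S z.
have sW : Sm W by apply: Sm_mul => //; exact: Sm_cutout.
have WM z : nc (W z) <= M.
  by rewrite /W ncM -[leRHS]mulr1 ler_pM ?nc_ge0//; exact: nc_cutout.
have W0 z : S <= nc (z 0 j) -> W z = 0.
  by move=> zS; rewrite /W cutout_ge// mulr0.
have [w [g [sw dw wB wkap wg]]] := HB W sW WM W0.
have dw' z : nc (z 0 j) <= S - 1 -> dbar j (w : E -> R[i]^o) z = f z.
  by move=> zS; rewrite dw ?(le_trans zS (ltW S21))// /W cutout_le// mulr1.
pose phi := test j r1 r2 r4 th S k sig w.
have sphi : Sm phi by exact: (Sm_test j r1_0 r12 r23 r34 sth k r4S ssig sw).
have phi0 z : ~ shell j z0 r1 eta (S - 1) z -> phi z = 0.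
  exact: (test_out r1_0 r12 r23 r34 th_supp k r4S).
have clK : closed (shell j z0 r1 eta (S - 1)) := @closed_shell _ _ _ _ _ _ _.
have Kb z : shell j z0 r1 eta (S - 1) z -> cbnd S z.
  exact: (shell_cbnd (ltW S21) ZS).
have [Iw wk0] := weak_cut rho0 u_L1loc V_Linfty u_sol j clK Kb (@shellD _) sphi phi0.
have PB := pointwise_bound r1_0 r12 r23 r34 sth th01 th_supp k r4S ssig sig1
  sw dw' wB wkap wg HBs.
have thb z : 0 <= th z * nc (z 0 j) ^+ 2 ^+ k <= (r4 ^+ 2) ^+ k.
  have /andP[t0' t1'] := th01 z; rewrite mulr_ge0 ?exprn_ge0 ?nc_ge0//=.
  have [->|/th_supp[_ [h _]]] := eqVneq (th z) 0; first by rewrite mul0r !exprn_ge0// ltW.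
  rewrite -[leRHS]mul1r ler_pM ?exprn_ge0 ?nc_ge0//.
  by rewrite !lerXn2r ?nnegrE ?exprn_ge0 ?nc_ge0 ?(ltW r4_0)// lerXn2r ?nnegrE ?nc_ge0 ?(ltW r4_0).
pose X z := nc (uK z) * (th z * nc (z 0 j) ^+ 2 ^+ k).
have mth : measurable_fun setT th by exact: (Sm_real_measurable sth).
have mX : measurable_fun setT (fun z => th z * nc (z 0 j) ^+ 2 ^+ k).
  apply: measurable_funM => //; apply: measurable_funX; apply: measurable_funX.
  by apply: measurable_nc; exact: cmeas_coord.
have IX : rintegrable mu X.
  apply: (rintegrable_le _ (rintegrableZ ((r4 ^+ 2) ^+ k) Inu)).
    by apply: measurable_funM => //; exact: measurable_nc.
  move=> z; have /andP[h0 h1] := thb z.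
  by rewrite /X ger0_norm; [rewrite [leLHS]mulrC ler_wpM2r|rewrite mulr_ge0].
have JX : (r3 ^+ 2) ^+ k * J <= Imu X.
  have It : rintegrable mu (fun z => th z * nc (uA r4 z)).
    apply: (rintegrable_le _ (rintegrable_nc (shell_integrable r4))).
      by apply: measurable_funM => //; apply: measurable_nc; exact: cintegrable_meas (shell_integrable r4).
    move=> z; have /andP[h0 h1] := th01 z.
    by rewrite ger0_norm ?mulr_ge0 ?nc_ge0// ler_piMl ?nc_ge0.
  rewrite -RintegralZl//; apply: Rintegral_le => //; first exact: rintegrableZ.
  move=> z; have [e|n0] := eqVneq (th z) 0; first by rewrite /X e !mul0r !mulr0.
  have [h1 [h2 h3]] := th_supp n0; have /andP[t0' t1'] := th01 z.
  have zK : shell j z0 r1 eta (S - 1) z.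
    split; [by apply: le_trans h1; exact: le_trans (ltW r12) r23| |by move=> i _].
    by apply: le_trans h2 _; move: r4S r4_0; lra.
  have zK4 : shell j z0 r1 eta r4 z.
    by split; [by apply: le_trans h1; exact: le_trans (ltW r12) r23| |move=> i _].
  rewrite /X /uK /patch !mem_set// mulrCA [leRHS]mulrCA ler_wpM2l// mulrC ler_wpM2l ?nc_ge0//.
  have r30 : 0 <= r3 by apply: le_trans r23; apply: ltW; exact: lt_trans r12.
  by apply: lerXn2r; rewrite ?nnegrE ?exprn_ge0 ?nc_ge0// lerXn2r ?nnegrE ?nc_ge0.
(* Against [uK] the subtracted term integrates to 0 by the weak equation and the first one to the
   integral of [X], while [pointwise_bound] controls [F] itself. *)
pose F z := v z * (th z * nc (z 0 j) ^+ 2 ^+ k)%:C -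
  (dbar j (phi : E -> R[i]^o) z + Vcut rho V j z * phi z).
have FE : (fun z => uK z * F z) = (fun z => (X z)%:C -
    uK z * (dbar j (phi : E -> R[i]^o) z + Vcut rho V j z * phi z)).
  by apply/funext => z; rewrite /F mulrBr mulrA uv /X [in RHS]rmorphM.
have IXc := cintegrable_real IX.
have IF : cintegrable mu (fun z => uK z * F z) by rewrite FE; exact: cintegrableB.
have intF : cint mu (fun z => uK z * F z) = (Imu X)%:C.
  by rewrite FE (cintB IXc Iw) wk0 subr0 cint_real.
have X0 : 0 <= Imu X.
  apply: Rintegral_ge0 => z _; have /andP[h0 _] := thb z.
  by rewrite /X mulr_ge0.
have ncF : Imu X = nc (cint mu (fun z => uK z * F z)) by rewrite intF nc_real ger0_norm.
have vS : (mu [set z | cbnd S z] < +oo)%E.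
  by apply: le_lt_trans (cn_volume n S_0) (ltry _).
have mS := measurable_cbnd S : measurable [set z : E | cbnd S z].
have IS := rintegrable_indic mS vS.
have I1 : rintegrable mu (fun z => nc (v z - sig z) * nc (uK z)).
  apply: (weight_integrable nu0 Inu (M := 2)).
    by apply: measurable_nc; apply: cmeasB => //; exact: Sm_cmeas.
  move=> z; rewrite ger0_norm ?nc_ge0//; apply: le_trans (ncB _ _) _.
  by have := v1 z; have := sig1 z; lra.
have I2 : rintegrable mu (fun z => nc (Vcut rho V j z - f z) * nc (uK z)).
  apply: (weight_integrable nu0 Inu (M := M + M)).
    apply: measurable_nc; apply: cmeasB; [exact: cmeas_Vcut|exact: Sm_cmeas].
  move=> z; rewrite ger0_norm ?nc_ge0//; apply: le_trans (ncB _ _) _.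
  by rewrite lerD//; exact: Vcut_le.
have I3 := rintegrable_nc (shell_integrable r4).
pose q := c2 * q2.
pose h z := ((r4 ^+ 2) ^+ k * (nc (v z - sig z) * nc (uK z)) +
   c3 * (nc (Vcut rho V j z - f z) * nc (uK z))) +
   (c1 * nc (uA r4 z) + q * \1_[set z | cbnd S z] z).
have J1 := rintegrableZ ((r4 ^+ 2) ^+ k) I1; have J2 := rintegrableZ c3 I2.
have J3 := rintegrableZ c1 I3; have J4 := rintegrableZ q IS.
have J12 := rintegrableD J1 J2; have J34 := rintegrableD J3 J4.
have c10 : 0 <= c1.
  have r20 := lt_trans r1_0 r12.
  rewrite /c1 /inner_const mulr_ge0 ?expR_ge0// mulr_ge0 ?exprn_ge0 ?mulr_ge0 ?(ltW r4_0) ?(ltW r20)//.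
    exact: le_trans (normr_ge0 _) (HBs 0).
  by rewrite invr_ge0 subr_ge0 ler_sqr ?nnegrE ?(ltW r1_0) ?(ltW r20) ?(ltW r12).
have c20 : 0 <= c2.
  rewrite /c2 /outer_const mulr_ge0 ?expR_ge0// mulr_ge0 ?exprn_ge0 ?mulr_ge0 ?(ltW r4_0)//.
  exact: le_trans (normr_ge0 _) (HBs 0).
have q0 : 0 <= q by rewrite mulr_ge0 ?expR_ge0.
have Fh z : nc (uK z * F z) <= h z.
  have [zK|zK] := pselect (shell j z0 r1 eta (S - 1) z); last first.
    rewrite [uK z]/patch memNset// mul0r nc0 /h.
    have i0 : 0 <= \1_[set z | cbnd S z] z :> R by rewrite indicE.
    have p4 : 0 <= (r4 ^+ 2) ^+ k by rewrite !exprn_ge0// ltW.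
    have N2 (a b : R[i]) : 0 <= nc a * nc b by rewrite mulr_ge0 ?nc_ge0.
    by apply: addr_ge0; apply: addr_ge0; apply: mulr_ge0 => //; exact: nc_ge0.
  have [zK1 zK2 zK3] := zK.
  have /(ler_wpM2l (nu0 z)) := PB (v z) (Vcut rho V j z) z zK2.
  rewrite -ncM => /le_trans; apply.
  (* The inner region lies in the shell up to [r4], which does not grow with [S]. *)
  have h1 : nc (uK z) * (if nc (z 0 j) <= r2 then c1 else 0) <= c1 * nc (uA r4 z).
    have [z2|z2] := leP (nc (z 0 j)) r2; last by rewrite mulr0 mulr_ge0 ?nc_ge0.
    rewrite mulrC /uK /patch !mem_set//; split => //.
    by apply: le_trans z2 _; exact: le_trans r34.
  (* In the outer region |z| >= |z_j| >= S - 2 > r, so the decay hypothesis applies. *)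
  have h2 : nc (uK z) * (if S - 2 <= nc (z 0 j) then c2 else 0) <= q * \1_[set z | cbnd S z] z.
    have [z2|z2] := leP (S - 2) (nc (z 0 j)); last by rewrite mulr0 mulr_ge0.
    rewrite indicE mem_set ?mulr1; last exact: Kb.
    rewrite mulrC /q ler_wpM2l//; apply: le_trans (nc_uA_le _ _) _.
    have zl := le_trans z2 (nc_le_l2 z j).
    apply: le_trans (u_decay _) _; first by apply: lt_le_trans zl; rewrite ltrBrDr.
    by rewrite ler_expR !mulNr lerN2 ler_wpM2l.
  move: h1 h2; rewrite /h -/kap -/Gam -/c1 -/c2 -/c3.
  set A := nc (v z - sig z); set A' := nc (Vcut _ _ _ _ - _); set a := (if _ then _ else _).
  set b := (if _ then _ else _) => h1 h2.
  rewrite [leLHS](_ : _ = (r4 ^+ 2) ^+ k * (A * nc (uK z)) + c3 * (A' * nc (uK z)) +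
     (nc (uK z) * a + nc (uK z) * b)); last by ring.
  by rewrite lerD2l lerD.
have := nc_cint_le IF (rintegrableD J12 J34) Fh.
rewrite -ncF !RintegralD// !RintegralZl// Rintegral_indic// => XH.
have vol : fine (mu [set z | cbnd S z]) <= ((2 * S) ^+ n) ^+ 2.
  rewrite -lee_fin fineK; first exact: cn_volume.
  by rewrite ge0_fin_numE.
rewrite lerBlDr; apply: le_trans JX _; apply: le_trans XH _.
rewrite mulrDl; apply: lerD; first by apply: lerD; rewrite ler_wpM2l ?exprn_ge0 ?(ltW r4_0).
by rewrite lerD2l ler_wpM2l.
Qed.

End estimate.

(** * Vanishing *)

Section asymptotics.
Variable R : realType.
Implicit Types x : R.

Let le_expR x : x <= expR x.
Proof. by apply: le_trans (expR_ge1Dx x); rewrite lerDr. Qed.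

Let pow_le x (a b : nat) : 1 <= x -> (a <= b)%N -> x ^+ a <= x ^+ b.
Proof. by move=> x1 ab; apply: ler_weXn2l. Qed.

(* The parameters are coupled by [S = X ^ 8] and [k = X ^ 5]. *)
Lemma asymptotic_le0 (J c1 c2 r3 q r4 K M C : R) (n : nat) (S1 : R) :
  0 < r3 -> 0 < q -> q < r3 ^+ 2 -> 0 < r4 -> 0 <= c1 -> 0 <= c2 -> 0 <= K -> 0 <= C ->
  2 * M < C ->
  (forall (S : R) (k : nat), S1 <= S -> 0 <= S ->
    (r3 ^+ 2) ^+ k * J <= c1 * S * q ^+ k * expR (2 * (K * Num.sqrt S)) +
      c2 * S ^+ 2 * (S * r4) ^+ k * expR (2 * M * S + 2 * (K * Num.sqrt S)) *
      expR (- C * (S - 2)) * ((2 * S) ^+ n) ^+ 2) ->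
  J <= 0.
Proof.
move=> r30 q0 qr r40 c10 c20 K0 C0 MC H.
have r320 : 0 < r3 ^+ 2 by rewrite exprn_gt0.
(* The inner term decays like [expR (- lam * k)]. *)
pose lam := - ln (q / r3 ^+ 2).
have lam0 : 0 < lam.
  by rewrite oppr_gt0 ln_lt0// divr_gt0//= ltr_pdivrMr// mul1r.
have qE : q = r3 ^+ 2 * expR (- lam).
  by rewrite opprK lnK ?posrE ?divr_gt0// mulrC divfK// gt_eqF.
pose b := r4 / r3 ^+ 2.
have b0 : 0 < b by rewrite divr_gt0.
pose del := C - 2 * M.
have del0 : 0 < del by rewrite subr_gt0.
(* [P1] and [P2] collect the coefficients of the competing terms, all bounded by multiples of X^4
   and X^6 respectively, with one more unit for the final [expR (- X)]: 9 = 8 + 1, 25 = 16 + 8 + 1,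
   18 = 2 + 16. *)
pose P1 := 9 + 2 * K.
pose P2 := 25 + b + 2 * K + 2 * C + 18 * n%:R.
have key (N : nat) : let X : R := N%:R in 1 <= X -> S1 <= X -> P1 / lam <= X -> P2 / del <= X ->
    J <= (c1 + c2) * expR (- X).
  move=> X X1 XS Xl Xd; have X0 : 0 <= X by apply: le_trans X1.
  pose S := X ^+ 8; pose k := (N ^ 5)%N.
  have kE : k%:R = X ^+ 5 by rewrite /k natrX.
  have sS : Num.sqrt S = X ^+ 4.
    by rewrite /S (_ : 8 = 4 * 2)%N// exprM sqrtr_sqr ger0_norm ?exprn_ge0.
  have SX : X <= S by rewrite /S -{1}[X]expr1; exact: pow_le.
  (* This stands in for log S <= 8 X, so that powers of [S] can be moved into the exponents. *)
  have Se : S <= expR (8 * X).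
    by rewrite /S (expRM_natl 8); apply: lerXn2r; rewrite ?nnegrE ?expR_ge0.
  have S0 : 0 <= S by exact: exprn_ge0.
  have HS := H S k (le_trans XS SX) S0.
  have r3k : 0 < (r3 ^+ 2) ^+ k by rewrite exprn_gt0.
  have e1 : c1 * S * q ^+ k * expR (2 * (K * Num.sqrt S)) <=
      (r3 ^+ 2) ^+ k * (c1 * expR (8 * X - X ^+ 5 * lam + 2 * (K * X ^+ 4))).
    rewrite sS qE exprMn -(expRM_natl k) kE.
    rewrite !expRD [X ^+ 5 * - lam]mulrN.
    rewrite (_ : c1 * S * _ * _ = (r3 ^+ 2) ^+ k * (c1 * (S * expR (- (X ^+ 5 * lam)) * expR (2 * (K * X ^+ 4))))); last by ring.
    by rewrite ler_wpM2l ?(ltW r3k)// ler_wpM2l// ler_wpM2r ?expR_ge0// ler_wpM2r ?expR_ge0.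
  have e2 : c2 * S ^+ 2 * (S * r4) ^+ k * expR (2 * M * S + 2 * (K * Num.sqrt S)) *
      expR (- C * (S - 2)) * ((2 * S) ^+ n) ^+ 2 <=
      (r3 ^+ 2) ^+ k * (c2 * expR (2 * (8 * X) + X ^+ 5 * (8 * X + b) + 2 * (K * X ^+ 4) - del * S +
        2 * C + n%:R * 2 * (1 + 8 * X))).
    rewrite sS.
    have -> : S * r4 = r3 ^+ 2 * (S * b) by rewrite /b; field; rewrite gt_eqF.
    rewrite (exprMn k).
    have h1 : S ^+ 2 <= expR (2 * (8 * X)).
      by rewrite (expRM_natl 2); apply: lerXn2r; rewrite ?nnegrE ?expR_ge0.
    have h2 : (S * b) ^+ k <= expR (X ^+ 5 * (8 * X + b)).
      have h : S * b <= expR (8 * X + b) by rewrite expRD ler_pM// ltW.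
      by rewrite -kE (expRM_natl k); apply: lerXn2r h; rewrite nnegrE ?expR_ge0// mulr_ge0// ltW.
    have h3 : ((2 * S) ^+ n) ^+ 2 <= expR (n%:R * 2 * (1 + 8 * X)).
      rewrite -natrM (expRM_natl (n * 2)) -exprM expRD.
      have h : 2 * S <= expR 1 * expR (8 * X).
        by apply: ler_pM => //; apply: le_trans (expR_ge1Dx 1); lra.
      by apply: lerXn2r h; rewrite nnegrE mulr_ge0 ?expR_ge0.
    have h4 : expR (2 * M * S + 2 * (K * X ^+ 4)) * expR (- C * (S - 2)) =
        expR (2 * (K * X ^+ 4) - del * S + 2 * C).
      by rewrite -expRD /del; congr expR; ring.
    have -> : expR (2 * (8 * X) + X ^+ 5 * (8 * X + b) + 2 * (K * X ^+ 4) - del * S + 2 * C + n%:R * 2 * (1 + 8 * X)) =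
       expR (2 * (8 * X)) * expR (X ^+ 5 * (8 * X + b)) * expR (2 * (K * X ^+ 4) - del * S + 2 * C) *
       expR (n%:R * 2 * (1 + 8 * X)).
      by rewrite -!expRD; congr expR; ring.
    rewrite -h4; move: h1 h2 h3.
    set A := expR (2 * (8 * X)); set A' := S ^+ 2; set B' := (S * b) ^+ k.
    set B := expR (X ^+ 5 * _); set D' := ((2 * S) ^+ n) ^+ 2; set D := expR (n%:R * 2 * _).
    set F := expR (2 * M * _ + _); set G := expR (- C * _) => h1 h2 h3.
    have A0 : 0 <= A' by exact: sqr_ge0.
    have B0 : 0 <= B' by rewrite exprn_ge0// mulr_ge0// ltW.
    have D0 : 0 <= D' by exact: sqr_ge0.
    have FG0 : 0 <= F * G by rewrite mulr_ge0 ?expR_ge0.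
    rewrite [leLHS](_ : _ = (r3 ^+ 2) ^+ k * (c2 * (A' * B' * (F * G) * D'))); last by ring.
    rewrite ler_wpM2l ?(ltW r3k)// ler_wpM2l//; apply: ler_pM => //.
      by rewrite mulr_ge0// mulr_ge0.
    by apply: ler_wpM2r => //; exact: ler_pM.
  have := le_trans HS (lerD e1 e2); rewrite -mulrDr ler_pM2l// => /le_trans; apply.
  rewrite [leRHS]mulrDl; move: X1 Xl Xd; rewrite !ler_pdivrMr// => X1 Xl Xd.
  have X4 : 1 <= X ^+ 4 by rewrite exprn_ege1.
  have X14 : X <= X ^+ 4 by rewrite -{1}[X]expr1; exact: pow_le.
  have X6 : 1 <= X ^+ 6 by rewrite exprn_ege1.
  have X16 : X <= X ^+ 6 by rewrite -{1}[X]expr1; exact: pow_le.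
  have X46 : X ^+ 4 <= X ^+ 6 by exact: pow_le.
  have X56 : X ^+ 5 <= X ^+ 6 by exact: pow_le.
  apply: lerD; rewrite ler_wpM2l// ler_expR.
    have := ler_wpM2l (le_trans ler01 X4) Xl; rewrite /P1.
    have KX : 0 <= K * X ^+ 4 by rewrite mulr_ge0// exprn_ge0.
    rewrite (_ : X ^+ 4 * (X * lam) = X ^+ 5 * lam); last by ring.
    rewrite (_ : X ^+ 4 * (9 + 2 * K) = 9 * X ^+ 4 + 2 * (K * X ^+ 4)); last by ring.
    move: (X ^+ 5 * lam) (K * X ^+ 4) KX => U W ?; move: (X ^+ 4) X4 X14 => Y; lra.
  have Xd' : P2 <= X ^+ 2 * del.
    apply: le_trans Xd _; rewrite ler_wpM2r ?(ltW del0)// -{1}[X]expr1; exact: pow_le.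
  have := ler_wpM2l (le_trans ler01 X6) Xd'; rewrite /P2.
  rewrite (_ : X ^+ 6 * (X ^+ 2 * del) = del * S); last by rewrite /S; ring.
  have t1 : K * X ^+ 4 <= K * X ^+ 6 by rewrite ler_wpM2l.
  have t2 : b * X ^+ 5 <= b * X ^+ 6 by rewrite ler_wpM2l// ltW.
  have t3 : C <= C * X ^+ 6 by rewrite ler_peMr.
  have t4 : n%:R * X <= n%:R * X ^+ 6 by rewrite ler_wpM2l.
  have t5 : n%:R <= n%:R * X ^+ 6 by rewrite ler_peMr.
  rewrite (_ : X ^+ 6 * (_ + _) = 25 * X ^+ 6 + b * X ^+ 6 + 2 * (K * X ^+ 6) +
    2 * (C * X ^+ 6) + 18 * (n%:R * X ^+ 6)); last by ring.
  rewrite (_ : 2 * (8 * X) + _ + _ - _ + _ + _ = 16 * X + 8 * X ^+ 6 + b * X ^+ 5 + 2 * (K * X ^+ 4) -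
    del * S + 2 * C + 2 * n%:R + 16 * (n%:R * X)); last by ring.
  move: t1 t2 t3 t4 t5.
  move: (del * S) (K * X ^+ 4) (K * X ^+ 6) (b * X ^+ 5) (b * X ^+ 6) (C * X ^+ 6) (n%:R * X) (n%:R * X ^+ 6) => ? ? ? ? ? ? ? ?.
  by move: (X ^+ 6) X6 X16 => Y; lra.
pose X0 := Num.max (Num.max 1 S1) (Num.max (P1 / lam) (P2 / del)).
rewrite leNgt; apply/negP => J0.
(* For positive [J] the bound [key] would give [J * expR N%:R <= c1 + c2 <= J * N%:R], which is
   absurd. *)
pose X1 := Num.max X0 ((c1 + c2) / J).
have [N XN] : exists N : nat, X1 <= N%:R.
  by exists (Num.truncn X1).+1; apply/ltW/truncnS_gt.
have h : forall y, y <= X1 -> y <= N%:R by move=> y yX; exact: le_trans XN.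
have h0 : forall y, y <= X0 -> y <= N%:R by move=> y yX; apply: h; rewrite le_max yX.
have X1N : 1 <= N%:R :> R by apply: h0; rewrite /X0 !le_max lexx.
have := key N X1N.
move=> /(_ (h0 _ _) (h0 _ _) (h0 _ _)) JN.
have {}JN : J <= (c1 + c2) * expR (- N%:R) by apply: JN; rewrite /X0 !le_max lexx ?orbT.
have : (c1 + c2) / J <= N%:R by apply: h; rewrite /X1 le_max lexx orbT.
rewrite ler_pdivrMr// => cN; move: JN; rewrite expRN ler_pdivlMr ?expR_gt0// => JN.
have : J * expR N%:R <= J * N%:R by apply: le_trans JN _; rewrite mulrC mulrC [J * _]mulrC.
rewrite ler_pM2l// leNgt => /negP; apply.
by apply: lt_le_trans (expR_ge1Dx _); rewrite ltrDr.
Qed.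

End asymptotics.

(** * From the estimate to vanishing on the exterior domain *)

Section vanishing.
Variables (R : realType) (n : nat) (rho : R).
Hypothesis rho0 : 0 < rho.
Local Notation E := (Cn R n).
Local Notation mu := (@lebesgue_Cn R n).
Local Notation D := (@exterior R n rho).
Variables (u : E -> R[i]^o) (V : E -> E).
Hypothesis (u_L1loc : L1loc D u) (V_Linfty : Linfty D V) (u_sol : weak_dbar_solution D V u).
Variables (C r : R).
Hypothesis C_gt : 2 * Vbound rho V < C.
Hypothesis u_decay : forall z : E, r < l2norm z -> nc (u z) <= expR (- C * l2norm z).
Implicit Types (z y : E).

Let sqdist z y : R := \sum_i nc (y 0 i - z 0 i) ^+ 2.

Let bump z0 (eta : R) z : R := flat 0 (1 - sqdist z0 z / eta ^+ 2).

Let Sm_bump z0 eta : Sm (fun z => (bump z0 eta z)%:C).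
Proof.
have sq : Sm (fun z => 1 + (- (eta ^- 2))%:C * (sqdist z0 z)%:C).
  apply: Sm_add; [exact: Sm_cst|apply: Sm_mul; [exact: Sm_cst|exact: Sm_sqdist]].
have := Sm_comp (smoothR_flat R 0) sq; congr Sm; apply/funext => z.
rewrite /bump creD creM /= mul0r subr0; congr (flat 0 _)%:C.
by rewrite mulNr mulrC.
Qed.

Let bump01 z0 eta z : 0 <= bump z0 eta z <= 1.
Proof.
rewrite flat_ge0 /= /bump /flat; case: ifPn => // x0.
rewrite expr0 invr1 mul1r; apply: (@le_trans _ _ (expR 0)); last by rewrite expR0.
by rewrite ler_expR oppr_le0 invr_ge0 ltW.
Qed.

Let bump_neq0 z0 eta z : 0 < eta -> (bump z0 eta z != 0) = (sqdist z0 z < eta ^+ 2).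
Proof.
move=> eta0; rewrite /bump; have e2 : 0 < eta ^+ 2 by rewrite exprn_gt0.
have [h|h] := ltP 0 (1 - sqdist z0 z / eta ^+ 2).
  rewrite gt_eqF ?flat_gt0//=; move: h; rewrite subr_gt0 ltr_pdivrMr// mul1r => ->.
  by [].
rewrite flat_le0// eqxx /=; apply/esym/negbTE; rewrite -leNgt.
by move: h; rewrite subr_le0 ler_pdivlMr// mul1r.
Qed.

Let near_sqdist z0 (e : R) : 0 < e -> exists2 d : R, 0 < d &
  forall y, near_by d z0 y -> sqdist z0 y < e.
Proof.
move=> e0; have [d d0 H] := continuous_nearP z0 (Sm_continuous (Sm_sqdist z0)) e0.
exists d => // y /H yz.
have := le_lt_trans (ler_norm _) (le_lt_trans (nc_ge_Re _) yz); rewrite creD creN /=.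
rewrite [X in _ - X]big1 ?subr0// => i _; by rewrite subrr nc0 expr0n.
Qed.

(** The asymptotics make the integral of [th * |u|] zero for a bump that is positive near [z0]. A
    suitable coordinate [j] exists because the exterior does not contain 0. *)
Lemma local_vanishing z0 : D z0 -> exists2 d : R, 0 < d &
  {ae mu, forall z, near_by d z0 z -> u z = 0}.
Proof.
move=> Dz0.
have [j zj0] : exists j, z0 0 j != 0.
  apply: contrapT => H; move/(exteriorE rho0): Dz0; rewrite big1 => [|i _].
    by rewrite ltNge sqr_ge0.
  have [->|h] := eqVneq (z0 0 i) 0; first by rewrite nc0 expr0n.
  by case: H; exists i.
have [d d0 Hd] : exists2 d : R, 0 < d & forall y, near_by d z0 y -> D y.
  by apply/cn_nbhsP; apply: open_nbhs_nbhs; split => //; exact: open_exterior.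
pose a := nc (z0 0 j); have a0 : 0 < a by rewrite nc_gt0.
(* All radii differ from |z0_j| by at most [5 * t], so the inner radius stays positive and the
   points used stay within [d] of [z0]. *)
pose t := Num.min a d / 10.
have m0 : 0 < Num.min a d by rewrite lt_min a0.
have t0 : 0 < t by rewrite divr_gt0.
have ta : 10 * t <= a by rewrite /t mulrC divfK// ge_min lexx.
have td : 10 * t <= d by rewrite /t mulrC divfK// ge_min lexx orbT.
pose r1 := a - 5 * t; pose r2 := a - 4 * t; pose r3 := a - t; pose r4 := a + t.
have r1_0 : 0 < r1 by rewrite /r1; lra.
have r12 : r1 < r2 by rewrite /r1 /r2; lra.
have r23 : r2 <= r3 by rewrite /r2 /r3; lra.
have r34 : r3 <= r4 by rewrite /r3 /r4; lra.
have r2_0 : 0 < r2 := lt_trans r1_0 r12.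
have r3_0 : 0 < r3 := lt_le_trans r2_0 r23.
have r4_0 : 0 < r4 := lt_le_trans r3_0 r34.
(* (a - 4 t)(a + t) = a^2 - 3 a t - 4 t^2 is smaller than (a - t)^2 = a^2 - 2 a t + t^2: the inner
   transition lies far enough below the bump. *)
have r23' : r2 * r4 < r3 ^+ 2 by rewrite /r2 /r3 /r4; nra.
pose th := bump z0 t.
have th_supp z : th z != 0 ->
    r3 <= nc (z 0 j) /\ nc (z 0 j) <= r4 /\ forall i, nc (z 0 i - z0 0 i) <= t.
  rewrite bump_neq0// => h.
  have zi i : nc (z 0 i - z0 0 i) <= t.
    rewrite -ler_sqr ?nnegrE ?nc_ge0 ?(ltW t0)//; apply: le_trans (ltW h).
    by rewrite /sqdist (bigD1 i)//= lerDl sumr_ge0// => k _; rewrite sqr_ge0.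
  have := nc_dist (z 0 j) (z0 0 j) => /le_trans /(_ (zi j)).
  by rewrite ler_norml -/a => /andP[h1 h2]; split; [|split=> //]; rewrite /r3 /r4; lra.
have shellD A : shell j z0 r1 t A `<=` D.
  move=> z [z1 _ zi].
  (* [y] is close to [z0], hence in the exterior, and z is obtained from it by changing only the
     [j]-th coordinate, whose modulus does not decrease from [r1]. *)
  pose y : E := \row_i (if i == j then (r1 / a)%:C * z0 0 j else z 0 i).
  have : D y.
    apply: Hd => i; rewrite mxE; case: eqP => [->|/eqP ij]; last first.
      by apply: le_lt_trans (zi _ ij) _; lra.
    rewrite -{2}[z0 0 j]mul1r -mulrBl -[1]/((1 : R)%:C) -rmorphB/= ncM nc_real -/a.
    rewrite ler0_norm; last by rewrite subr_le0 ler_pdivrMr// mul1r /r1; lra.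
    by rewrite opprB mulrBl divfK ?gt_eqF// mul1r /r1; lra.
  move=> /(exteriorE rho0) Dy; apply/(exteriorE rho0); apply: lt_le_trans Dy _.
  apply: ler_sum => i _; rewrite mxE; case: eqP => // ->.
  rewrite ler_sqr ?nnegrE ?nc_ge0// ncM nc_real -/a ger0_norm ?divr_ge0 ?(ltW r1_0) ?(ltW a0)//.
  by rewrite divfK ?gt_eqF.
pose Z := \sum_i (nc (z0 0 i) + t).
have z0Z i : nc (z0 0 i) + t <= Z.
  by rewrite /Z (bigD1 i)//= lerDl sumr_ge0// => k _; rewrite addr_ge0 ?nc_ge0 ?(ltW t0).
have M0 : 0 <= Vbound rho V := Vbound_ge0 rho V.
have C0 : 0 <= C by apply: le_trans (ltW C_gt); rewrite mulr_ge0.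
have [Bs Bs0 HBs] := dstep_bounded R.
have [K K0 HK] := shell_estimate rho0 u_L1loc V_Linfty u_sol C0 u_decay r1_0 r12 r23 r34
  (Sm_bump z0 t) (bump01 z0 t) th_supp shellD z0Z HBs.
pose ua := u \_ (shell j z0 r1 t r4).
pose I0 := Rintegral mu setT (fun z => nc (ua z)).
have I0_0 : 0 <= I0 by apply: Rintegral_ge0 => z _; exact: nc_ge0.
have J0 : Rintegral mu setT (fun z => th z * nc (ua z)) <= 0.
  apply: (@asymptotic_le0 _ _ (Bs / (r2 ^+ 2 - r1 ^+ 2) * r2 * 4 * I0) (Bs * 4) r3 (r2 * r4) r4
    (K * Vbound rho V) (Vbound rho V) C n (Num.max (4 * (r4 + 2)) (Num.max Z (r + 3)))) => //.
  - by rewrite mulr_gt0.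
  - rewrite !mulr_ge0// ?(ltW r2_0)// invr_ge0 subr_ge0.
    by rewrite ler_sqr ?nnegrE ?(ltW r1_0) ?(ltW r2_0)// ltW.
  - by rewrite mulr_ge0.
  - by rewrite mulr_ge0.
  move=> S k; rewrite !ge_max => /andP[S1 /andP[S2 S3]] S0.
  have rS : r + 2 < S by lra.
  apply: le_trans (HK S k S1 S2 rS) _.
  rewrite /inner_const /outer_const -/ua -/I0.
  move: (Num.sqrt S) => sS.
  rewrite le_eqVlt; apply/orP; left; apply/eqP.
  by rewrite !exprMn; ring.
have mua : cintegrable mu ua := shell_integrable rho0 u_L1loc shellD z0Z r4.
have Ith : rintegrable mu (fun z => th z * nc (ua z)).
  apply: (rintegrable_le _ (rintegrable_nc mua)).
    apply: measurable_funM; first exact: (Sm_real_measurable (Sm_bump z0 t)).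
    by apply: measurable_nc; exact: cintegrable_meas mua.
  move=> z; have /andP[h0 h1] := bump01 z0 t z.
  by rewrite ger0_norm ?mulr_ge0 ?nc_ge0// ler_piMl ?nc_ge0.
have pos z : 0 <= th z * nc (ua z).
  by have /andP[h0 _] := bump01 z0 t z; rewrite mulr_ge0 ?nc_ge0.
have int0 : (\int[mu]_z `| (th z * nc (ua z))%:E | = 0)%E.
  under eq_integral do rewrite gee0_abs ?lee_fin//.
  apply/eqP; rewrite eq_le integral_ge0 ?andbT; last by move=> z _; rewrite lee_fin.
  by rewrite -(fineK (integrable_fin_num _ Ith))// lee_fin.
have mth : measurable_fun setT (fun z => (th z * nc (ua z))%:E).
  by case/integrableP: Ith.
have ae0 := (ae_eq_integral_abs mu measurableT mth).1 int0.
have t2 : 0 < t ^+ 2 by rewrite exprn_gt0.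
have [e e0 He] := near_sqdist z0 t2; exists e => //.
apply: filterS ae0 => z /(_ I) [thu] ze.
have thz : th z != 0 by rewrite bump_neq0//; exact: He.
have [h1 [h2 h3]] := th_supp z thz.
have zs : shell j z0 r1 t r4 z.
  split => //.
  by apply: le_trans h1; apply: le_trans r23; exact: ltW.
move/eqP: thu; rewrite mulf_eq0 (negbTE thz)/= nc_eq0 /ua /patch mem_set//.
by move/eqP.
Qed.

(** A Lindelof argument: every point of the domain lies in a rational box on which [u] vanishes
    almost everywhere, and there are countably many such boxes. *)
Lemma ae_vanishing : {ae mu, forall z, D z -> u z = 0}.
Proof.
pose P i := {ae mu, forall z : E, rbox i.1 i.2 z -> u z = 0}.
pose B i := [set z : E | P i /\ rbox i.1 i.2 z /\ u z <> 0].
have negB i : mu.-negligible (B i).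
  have [Pi|nPi] := pselect (P i); last first.
    by rewrite (_ : B i = set0); [exact: negligible_set0|apply/seteqP; split => z // -[]].
  apply: negligibleS Pi => z [_ [zi uz]] /= H; exact/uz/H.
pose F k := if unpickle k is Some i then B i else set0.
have negF : mu.-negligible (\bigcup_k F k).
  apply: negligible_bigcup => k; rewrite /F; case: unpickle => [i|]; first exact: negB.
  exact: negligible_set0.
apply: negligibleS negF => z /=.
move=> /not_implyP[Dz uz].
have [d d0 Hd] := local_vanishing Dz.
have [q [m [zq qd]]] : exists q m, rbox q m z /\ rbox q m `<=` [set y | near_by d z y].
  by apply: rbox_nbhs; apply/cn_nbhsP; exists d.
exists (pickle (q, m)) => //; rewrite /F pickleK; split => //.
by apply: filterS Hd => y Hy /= /qd; exact: Hy.
Qed.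

End vanishing.

Theorem theorem1p2 (R : realType) (n : nat) (n_ge1 : (1 <= n)%N)
    (rho : R) (rho_gt0 : 0 < rho)
    (u : Cn R n -> R[i]^o) (V : Cn R n -> Cn R n)
    (u_L1loc : L1loc (exterior rho) u)
    (u_rep : preferred_representative (exterior rho) u)
    (V_Linfty : Linfty (exterior rho) V)
    (u_sol : weak_dbar_solution (exterior rho) V u)
    (C : R) (C_gt : (2%:E * Linfty_norm (exterior rho) V < C%:E)%E)
    (u_decay : exists r : R, forall z : Cn R n, r < l2norm z ->
       Normc.normc (u z) <= expR (- C * l2norm z)) :
  forall z : Cn R n, exterior rho z -> u z = 0.
Proof.
have [r dec] := u_decay.
have MC : 2 * Vbound rho V < C.
  rewrite -lte_fin EFinM /Vbound fineK//.
  by rewrite ge0_fin_numE; [case: V_Linfty|exact: Lnorm_ge0].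
(* The zero function is a continuous representative of [u], so the convention on representatives
   turns almost everywhere into everywhere. *)
move=> z Dz; apply: (u_rep (fun=> 0)) => //.
  by apply: continuous_subspaceT => x; exact: cst_continuous.
exact: (ae_vanishing rho_gt0 u_L1loc V_Linfty u_sol MC dec).
Qed.
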